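(* Let $X_{1,0}\in H^1_0$, $X_{2,0}\in H^1_0$, $\widetilde X\in C_tH^1_0$ (deterministic) and $\sigma\in L^2_{\mathbb F}C_tH^1_0$. Let $(X_{1,h}^*,X_{2,h}^*,U_h^* )$ be the optimal tuple of SLQ$_h$ and $(Y_{1,h},Y_{2,h},Z_{1,h},Z_{2,h})$ the solution of the associated backward SDE. Let $U_{h\tau}\in\mathbb U_{h\tau}$ and write $X_i^0:=\mathcal X^0_{i,h\tau}[U_{h\tau}]$, $i=1,2$. Then $$\mathbb E\Big[\int_0^T\langle X_{1,h}^*(t)-\widetilde X_h(t),X_1^0(t)\rangle\,dt+\beta\langle X_{1,h}^*(T)-\widetilde X_h(T),X_1^0(T)\rangle\Big]=I_1+I_2+I_3+I_4,$$ where $$I_1=\frac\tau2\sum_{n=0}^{N-1}\mathbb E\big[\langle X_2^0(t_{n+1})+X_2^0(t_n),Y_{1,h}(t_{n+1})\rangle\big]-\sum_{n=0}^{N-1}\mathbb E\Big[\int_{t_n}^{t_{n+1}}\langle Y_{1,h}(t),X_2^0(t_n)\rangle\,dt\Big],$$ $$I_2=\sum_{n=0}^{N-1}\mathbb E\Big[\int_{t_n}^{t_{n+1}}\langle\nabla Y_{2,h}(t),\nabla X_1^0(t_n)\rangle\,dt\Big]-\frac\tau2\sum_{n=0}^{N-1}\mathbb E\big[\langle\nabla(X_1^0(t_{n+1})+X_1^0(t_n)),\nabla Y_{2,h}(t_{n+1})\rangle\big],$$ $$I_3=\tau\sum_{n=0}^{N-1}\mathbb E\big[\langle U_{h\tau}(t_n),Y_{2,h}(t_{n+1})\rangle\big],$$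 $$I_4=-\sum_{n=0}^{N-1}\mathbb E\Big[\Big\langle\int_{t_n}^{t_{n+1}}Y_{1,h}(t)\,dt,\ \gamma X_1^0(t_n)\,\Delta_{n+1}W\Big\rangle\Big].$$
   Context: Setting and notation. $D\subset\mathbb R^d$, $1\le d\le 3$, is a bounded domain with sufficiently smooth boundary; $T>0$, $\alpha>0$, $\beta\ge 0$, $\gamma\in\mathbb R$ are fixed. $(\Omega,\mathcal F,\mathbb F=\{\mathcal F_t\}_{t\in[0,T]},\mathbb P)$ is a complete filtered probability space whose filtration is generated by a real-valued Wiener process $W$ and augmented by all $\mathbb P$-null sets. $L^2_x:=L^2(D)$ with inner product $\langle\cdot,\cdot\rangle$; $H^1_0:=H^1_0(D)$. For a separable Hilbert space $K$: $L^2_tK:=L^2(0,T;K)$, $C_tK:=C([0,T];K)$; $L^2_{\mathbb F}L^2_tK$, $L^2_{\mathbb F}C_tK$ are the spaces of $\mathbb F$-adapted $K$-valued processes with finite second moment of the $L^2_tK$-, $C_tK$-norm, respectively. Space discretization. $\mathcal T_h$ is a regular triangulation of $D$ with maximum mesh size $h$; $\mathbb V_h\subset H^1_0$ is the space of functions that are continuous and affine on each element. $\mathcal R_h:H^1_0\to\mathbb V_h$ is the Ritz projection, $\langle\nabla(\mathcal R_hu-u),\nabla\phi_h\rangle=0$ for all $\phi_h\in\mathbb V_h$; $\Delta_h:\mathbb V_h\to\mathbb V_h$ is defined by $\langle\Delta_h\xi_h,\varphi_h\rangle=-\langle\nabla\xi_h,\nabla\varphi_h\rangle$ for all $\varphi_h\in\mathbb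 V_h$. $\widetilde X_h:=\mathcal R_h\widetilde X$. Problem SLQ$_h$. For $U_h\in L^2_{\mathbb F}L^2_t\mathbb V_h$ let $(\mathcal X_{1,h}[U_h],\mathcal X_{2,h}[U_h])=(X_{1,h},X_{2,h})$ solve $dX_{1,h}=X_{2,h}dt$, $dX_{2,h}=(\Delta_hX_{1,h}+U_h)dt+(\gamma X_{1,h}+\mathcal R_h\sigma)dW$, $X_{1,h}(0)=\mathcal R_hX_{1,0}$, $X_{2,h}(0)=\mathcal R_hX_{2,0}$. SLQ$_h$: minimize over $U_h\in L^2_{\mathbb F}L^2_t\mathbb V_h$ the functional $\tfrac12\mathbb E[\int_0^T(\|\mathcal X_{1,h}[U_h]-\widetilde X_h\|_{L^2_x}^2+\alpha\|U_h\|_{L^2_x}^2)dt+\beta\|\mathcal X_{1,h}[U_h](T)-\widetilde X_h(T)\|_{L^2_x}^2]$. The unique minimizer is $U_h^*$, and $X_{i,h}^*=\mathcal X_{i,h}[U_h^*]$. Backward SDE. $(Y_{1,h},Y_{2,h},Z_{1,h},Z_{2,h})$, with $(Y_{1,h},Y_{2,h})\in L^2_{\mathbb F}C_t(\mathbb V_h\times\mathbb V_h)$ and $(Z_{1,h},Z_{2,h})\in L^2_{\mathbb F}L^2_t(\mathbb V_h\times\mathbb V_h)$, is the unique solution on $[0,T]$ of $dY_{1,h}=-[\Delta_hY_{2,h}+\gamma Z_{2,h}+X_{1,h}^*-\widetilde X_h]dt+Z_{1,h}dW$, $dY_{2,h}=-Y_{1,h}dt+Z_{2,h}dW$, $Y_{1,h}(T)=\beta(X_{1,h}^*(T)-\widetilde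 X_h(T))$, $Y_{2,h}(T)=0$. Time discretization. $N\in\mathbb N$, $\tau=T/N<1$, $t_n=n\tau$, $\Delta_nW:=W(t_n)-W(t_{n-1})$. $\mathbb U_{h\tau}$ is the set of $U_{h\tau}\in L^2_{\mathbb F}L^2_t\mathbb V_h$ with $U_{h\tau}(t)=U_{h\tau}(t_n)$ for $t\in[t_n,t_{n+1})$, $n=0,\dots,N-1$. For $U_{h\tau}\in\mathbb U_{h\tau}$, $(\mathcal X^0_{1,h\tau}[U_{h\tau}],\mathcal X^0_{2,h\tau}[U_{h\tau}])=(X_1^0,X_2^0)$ is the unique $\mathbb F$-adapted $\mathbb V_h\times\mathbb V_h$-valued process, constant on each $[t_n,t_{n+1})$, satisfying $X_1^0(0)=X_2^0(0)=0$ and, for $n=0,\dots,N-1$, $$X_1^0(t_{n+1})-X_1^0(t_n)=\tfrac\tau2\big(X_2^0(t_{n+1})+X_2^0(t_n)\big),$$ $$X_2^0(t_{n+1})-X_2^0(t_n)=\tfrac\tau2\Delta_h\big(X_1^0(t_{n+1})+X_1^0(t_n)\big)+\tau U_{h\tau}(t_n)+\gamma X_1^0(t_n)\Delta_{n+1}W.$$ *)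

(* Defs.v *)
From HB Require Import structures.
From mathcomp Require Import all_boot all_order all_algebra.
From mathcomp Require Import all_classical all_reals all_analysis.

Set Implicit Arguments.
Unset Strict Implicit.
Unset Printing Implicit Defensive.

Import Order.TTheory GRing.Theory Num.Theory.
Import numFieldNormedType.Exports.

Local Open Scope classical_set_scope.
Local Open Scope ring_scope.

(** MathComp-Analysis has the product sigma-algebra on [n.-tuple T] but no
    n-dimensional Lebesgue measure; it is obtained by iterating the product
    measure. *)

Lemma sigma_finite_product d1 d2 (T1 : measurableType d1)
    (T2 : measurableType d2) (R : realType)
    (m1 : {sigma_finite_measure set T1 -> \bar R})
    (m2 : {sigma_finite_measure set T2 -> \bar R}) :
  sigma_finite setT (m1 \x m2)%E.
Proof.
have /sigma_finiteP[F [TF ndF Foo]] := sigma_finiteT m1.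
have /sigma_finiteP[G [TG ndG Goo]] := sigma_finiteT m2.
exists (fun n => F n `*` G n).
  rewrite -setXTT TF TG predeqE => -[x y]; split.
    move=> [/= [n _ Fnx] [k _ Gky]]; exists (maxn n k) => //; split.
    - by move: x Fnx; exact/subsetPset/ndF/leq_maxl.
    - by move: y Gky; exact/subsetPset/ndG/leq_maxr.
  by move=> [n _ []/= ? ?]; split; exists n.
move=> k; have [? ?] := Foo k; have [? ?] := Goo k.
split; first exact: measurableX.
by rewrite product_measure1E// lte_mul_pinfty// ge0_fin_numE.
Qed.

Section lebesgue_step.
Context {R : realType} (n : nat).
Variable mu : {sigma_finite_measure set (n.-tuple (measurableTypeR R)) -> \bar R}.

Let consp (p : measurableTypeR R * n.-tuple (measurableTypeR R)) :
  n.+1.-tuple (measurableTypeR R) := [the n.+1.-tuple _ of p.1 :: p.2].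

Let mconsp : measurable_fun setT consp.
Proof. exact: measurable_cons. Qed.

Definition leb_step : set (n.+1.-tuple (measurableTypeR R)) -> \bar R :=
  pushforward (lebesgue_measure \x mu)%E consp.

Let leb_step0 : leb_step set0 = 0%E.
Proof. by rewrite /leb_step /pushforward preimage_set0 measure0. Qed.

Let leb_step_ge0 A : (0 <= leb_step A)%E.
Proof. exact: measure_ge0. Qed.

Let leb_step_sigma_additive : semi_sigma_additive leb_step.
Proof.
move=> F mF tF mUF; rewrite /leb_step /pushforward preimage_bigcup.
apply: measure_semi_sigma_additive.
- by move=> k; rewrite -[X in measurable X]setTI; exact: mconsp.
- apply/trivIsetP => /= i j _ _ ij; rewrite -preimage_setI.
  by move/trivIsetP : tF => /(_ _ _ _ _ ij) ->//; rewrite preimage_set0.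
- by rewrite -preimage_bigcup -[X in measurable X]setTI; exact: mconsp.
Qed.

HB.instance Definition _ := isMeasure.Build _ _ _ leb_step
  leb_step0 leb_step_ge0 leb_step_sigma_additive.

Let leb_step_sigma_finite : sigma_finite setT leb_step.
Proof.
pose unc (t : n.+1.-tuple (measurableTypeR R)) :
    measurableTypeR R * n.-tuple (measurableTypeR R) :=
  (tnth t ord0, [tuple of behead t]).
have munc : measurable_fun setT unc.
  apply/measurable_fun_pair; last exact: measurable_behead.
  exact: measurable_tnth.
have uncK p : unc (consp p) = p.
  by case: p => x t; rewrite /unc /consp /=; congr pair; apply: val_inj.
have [F UF Ffin] := sigma_finite_product lebesgue_measure mu.
exists (fun k => unc @^-1` F k).
  by rewrite -preimage_bigcup -UF preimage_setT.
move=> k; have [mF Fk] := Ffin k; split.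
  by rewrite -[X in measurable X]setTI; exact: munc.
rewrite /leb_step /pushforward -comp_preimage.
by rewrite (_ : unc \o consp = id) //; apply/funext => p; exact: uncK.
Qed.

HB.instance Definition _ := Measure_isSigmaFinite.Build _ _ _ leb_step
  leb_step_sigma_finite.

End lebesgue_step.

Fixpoint leb {R : realType} (n : nat) :
    {sigma_finite_measure set (n.-tuple (measurableTypeR R)) -> \bar R} :=
  match n with
  | 0 => [the {sigma_finite_measure set _ -> \bar R} of dirac [tuple]]
  | n'.+1 => [the {sigma_finite_measure set _ -> \bar R} of leb_step (leb n')]
  end.

(** Functions are everywhere defined representatives ['rV[R]_d -> R]; the
    elements of L^2(D) and H^1_0(D) are their classes modulo equality almost
    everywhere in D, and every notion below only depends on the class. *)

Section function_spaces.
Context {R : realType} {d : nat}.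
Implicit Types (D A : set 'rV[R]_d) (u v : 'rV[R]_d -> R).

Definition row_of_tuple (t : d.-tuple (measurableTypeR R)) : 'rV[R]_d :=
  \row_i tnth t i.

(* the norm of ['rV[R]_d] in MathComp-Analysis is the sup norm *)
Definition enorm (x : 'rV[R]_d) : R := Num.sqrt (\sum_i x 0 i ^+ 2).

Definition partial (i : 'I_d) u : 'rV[R]_d -> R :=
  fun x => 'D_(delta_mx 0 i) u x.

Fixpoint Ck (k : nat) u : Prop :=
  continuous u /\
  match k with
  | 0 => True
  | k'.+1 => forall i, (forall x, derivable u x (delta_mx 0 i)) /\
                       Ck k' (partial i u)
  end.

Definition boundary A : set 'rV[R]_d := closure A `\` interior A.

Definition bounded_domain D : Prop :=
  [/\ open D, connected D, D !=set0 & bounded_set D].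

(* near each of its boundary points, D is {rho < 0} for some C^k function rho
   whose gradient does not vanish at that point *)
Definition Ck_boundary (k : nat) D : Prop :=
  forall x, boundary D x -> exists (U : set 'rV[R]_d) (rho : 'rV[R]_d -> R),
    [/\ open U, U x, Ck k rho, exists i, partial i rho x != 0 &
        D `&` U = [set y | U y /\ rho y < 0]].

Definition L2 D u : Prop :=
  (u \_ D) \o row_of_tuple \in Lfun (leb d) 2%:E.

Definition ip D u v : R :=
  \int[leb d]_(t in row_of_tuple @^-1` D)
    (u (row_of_tuple t) * v (row_of_tuple t)).

Definition L2norm D u : R := Num.sqrt (ip D u u).

Definition test_function D u : Prop :=
  (forall k, Ck k u) /\
  exists K : set 'rV[R]_d, [/\ compact K, K `<=` D & forall x, ~ K x -> u x = 0].

Definition is_weak_grad D u (g : 'I_d -> 'rV[R]_d -> R) : Prop :=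
  forall i, L2 D (g i) /\
    forall phi, test_function D phi ->
      ip D u (partial i phi) = - ip D (g i) phi.

Definition H1 D u : Prop := L2 D u /\ exists g, is_weak_grad D u g.

(* a choice of weak gradient, unique almost everywhere in D if u is in H^1(D) *)
Definition grad D u : 'I_d -> 'rV[R]_d -> R := get [set g | is_weak_grad D u g].

Definition ip_grad D u v : R := \sum_i ip D (grad D u i) (grad D v i).

Definition H1norm D u : R := Num.sqrt (ip D u u + ip_grad D u u).

(* closure of C_c^oo(D) in H^1(D) *)
Definition H10 D u : Prop :=
  H1 D u /\
  forall e : R, 0 < e -> exists phi, test_function D phi /\ H1norm D (u - phi) < e.

(* face of the simplex with vertices p spanned by the vertices in S *)
Definition face (p : 'I_d.+1 -> 'rV[R]_d) (S : {set 'I_d.+1}) : set 'rV[R]_d :=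
  [set x | exists c : 'I_d.+1 -> R,
    [/\ forall i, 0 <= c i, forall i, i \notin S -> c i = 0,
        \sum_i c i = 1 & x = \sum_i c i *: p i]].

Definition simplex (p : 'I_d.+1 -> 'rV[R]_d) : set 'rV[R]_d := face p [set: _].

Definition affinely_independent (p : 'I_d.+1 -> 'rV[R]_d) : Prop :=
  forall c : 'I_d.+1 -> R,
    \sum_i c i = 0 -> \sum_i c i *: p i = 0 -> forall i, c i = 0.

Definition diam A : R := sup [set r | exists x y, [/\ A x, A y & r = enorm (x - y)]].

Definition covered (m : nat) (p : 'I_m -> 'I_d.+1 -> 'rV[R]_d) : set 'rV[R]_d :=
  [set x | exists j, simplex (p j) x].

(* The elements are the simplices [simplex (p j)].  As the boundary of D is
   smooth, they cannot fill D when d > 1: they lie in the closure of D, and what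
   they leave out of D is a layer of width at most h along the boundary.  Two
   elements meet along a common proper face, possibly the empty one [set0];
   kappa is the shape regularity constant, h the maximum mesh size. *)
Definition regular_triangulation D (kappa h : R) (m : nat)
    (p : 'I_m -> 'I_d.+1 -> 'rV[R]_d) : Prop :=
  [/\ forall j, affinely_independent (p j),
      forall j k, j != k -> exists S S' : {set 'I_d.+1},
        [/\ S \proper [set: 'I_d.+1], S' \proper [set: 'I_d.+1],
            simplex (p j) `&` simplex (p k) = face (p j) S &
            simplex (p j) `&` simplex (p k) = face (p k) S'],
      forall j, exists (x : 'rV[R]_d) (r : R),
        [/\ 0 < r, forall y, enorm (y - x) <= r -> simplex (p j) y &
            diam (simplex (p j)) <= kappa * r],
      (forall j, diam (simplex (p j)) <= h) /\
      (exists j, diam (simplex (p j)) = h) &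
      covered p `<=` closure D /\
      forall x, D x -> ~ covered p x ->
        exists y, boundary D y /\ enorm (x - y) <= h].

(* the last clause is the extension by zero to the part of D left out by the
   elements *)
Definition Vh D (m : nat) (p : 'I_m -> 'I_d.+1 -> 'rV[R]_d) v : Prop :=
  [/\ H10 D v, continuous v,
      forall j, exists (a : 'rV[R]_d) (b : R),
        forall x, simplex (p j) x -> v x = \sum_i a 0 i * x 0 i + b &
      forall x, ~ covered p x -> v x = 0].

Definition is_ritz_projection D (V : set ('rV[R]_d -> R))
    (Rh : ('rV[R]_d -> R) -> 'rV[R]_d -> R) : Prop :=
  forall u, H10 D u ->
    V (Rh u) /\ forall phi, V phi -> ip_grad D (Rh u - u) phi = 0.

Definition is_discrete_laplacian D (V : set ('rV[R]_d -> R))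
    (Dh : ('rV[R]_d -> R) -> 'rV[R]_d -> R) : Prop :=
  forall xi, V xi ->
    V (Dh xi) /\ forall phi, V phi -> ip D (Dh xi) phi = - ip_grad D xi phi.

End function_spaces.

Record fspace (R : realType) (d : nat) := FSpace {
  carrier :> ('rV[R]_d -> R) -> Prop ;
  fnorm : ('rV[R]_d -> R) -> R }.

Definition H10_space (R : realType) d (D : set 'rV[R]_d) : fspace R d :=
  FSpace (H10 D) (H1norm D).

Definition Vh_space (R : realType) d (D : set 'rV[R]_d) m
    (p : 'I_m -> 'I_d.+1 -> 'rV[R]_d) : fspace R d :=
  FSpace (Vh D p) (L2norm D).

Definition fopen (R : realType) d (K : fspace R d)
    (O : set ('rV[R]_d -> R)) : Prop :=
  forall u, K u -> O u ->
    exists e : R, 0 < e /\ forall v, K v -> fnorm K (v - u) < e -> O v.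

(* integral of a V_h-valued function of time; as V_h is a finite-dimensional
   space of continuous functions, it is computed pointwise *)
Definition tint (R : realType) d (a b : R) (f : R -> 'rV[R]_d -> R) :
    'rV[R]_d -> R :=
  fun x => \int[lebesgue_measure]_(s in `[a, b]) f s x.

Definition path_continuous (R : realType) d (K : fspace R d) (T : R)
    (f : R -> 'rV[R]_d -> R) : Prop :=
  forall t, 0 <= t <= T -> forall e : R, 0 < e -> exists2 delta : R, 0 < delta &
    forall s, 0 <= s <= T -> `|s - t| < delta -> fnorm K (f s - f t) < e.

(* C([0, T]; K) *)
Definition CtK (R : realType) d (K : fspace R d) (T : R)
    (f : R -> 'rV[R]_d -> R) : Prop :=
  (forall t, 0 <= t <= T -> K (f t)) /\ path_continuous K T f.

Section processes.
Context {R : realType} {dO : measure_display} {Omega : measurableType dO}.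
Variable P : probability Omega R.
Context {d : nat}.
Implicit Types (K : fspace R d) (X Y Z J U : R -> Omega -> 'rV[R]_d -> R)
  (W : R -> Omega -> R) (F : R -> set (set Omega)) (T : R).

Definition Ex (f : Omega -> R) : R := \int[P]_w f w.

Definition increment W (s t : R) : Omega -> R := fun w => W t w - W s w.

Definition past W (s : R) : set (set Omega) :=
  <<s [set A | exists r B,
        [/\ 0 <= r <= s, measurable (B : set (measurableTypeR R)) &
            A = W r @^-1` B]] >>.

Definition wiener_process T W : Prop :=
  [/\ forall t, 0 <= t <= T -> measurable_fun setT (W t),
      {ae P, forall w, W 0 w = 0},
      {ae P, forall w, {within `[0, T], continuous (W ^~ w)}},
      forall s t, 0 <= s -> s < t -> t <= T ->
        forall B : set (measurableTypeR R), measurable B ->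
          P ((increment W s t) @^-1` B) = normal_prob 0 (Num.sqrt (t - s)) B &
      forall s t, 0 <= s -> s < t -> t <= T ->
        forall (A : set Omega) (B : set (measurableTypeR R)),
          past W s A -> measurable B ->
          P (A `&` (increment W s t) @^-1` B) =
          (P A * P ((increment W s t) @^-1` B))%E].

(* generated by W and augmented by the P-null sets *)
Definition filtration W (s : R) : set (set Omega) :=
  <<s past W s `|` [set A | P.-negligible A] >>.

Definition fmeasurable K (G : set (set Omega)) (xi : Omega -> 'rV[R]_d -> R) :
    Prop :=
  (forall w, K (xi w)) /\ forall O, fopen K O -> G (xi @^-1` O).

Definition adapted K F T X : Prop :=
  forall t, 0 <= t <= T -> fmeasurable K (F t) (X t).

Definition jointly_measurable K T X : Prop :=
  forall O, fopen K O ->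
    measurable ([set q | 0 <= q.1 <= T /\ O (X q.1 q.2)] :
      set (measurableTypeR R * Omega)).

Definition norm2_L2L2 K T X : \bar R :=
  (\int[P]_w \int[lebesgue_measure]_(t in `[0%R, T])
     ((fnorm K (X t w)) ^+ 2)%:E)%E.

(* L^2_F(Omega; L^2(0, T; K)) *)
Definition L2F_L2t K F T X : Prop :=
  [/\ adapted K F T X, jointly_measurable K T X & (norm2_L2L2 K T X < +oo)%E].

(* L^2_F(Omega; C([0, T]; K)) *)
Definition L2F_Ct K F T X : Prop :=
  [/\ adapted K F T X, forall w, path_continuous K T (X ^~ w) &
      (\int[P]_w ereal_sup
         [set ((fnorm K (X t w)) ^+ 2)%:E | t in `[0%R, T]] < +oo)%E].

Definition simple_process K F T (m : nat) (s : nat -> R)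
    (xi : nat -> Omega -> 'rV[R]_d -> R) : Prop :=
  [/\ forall i, (i <= m)%N -> 0 <= s i <= T,
      forall i, (i < m)%N -> s i <= s i.+1,
      forall i, (i < m)%N -> fmeasurable K (F (s i)) (xi i) &
      forall i, (i < m)%N -> exists C : R, forall w, fnorm K (xi i w) <= C].

Definition simple_val (m : nat) (s : nat -> R)
    (xi : nat -> Omega -> 'rV[R]_d -> R) : R -> Omega -> 'rV[R]_d -> R :=
  fun t w => \sum_(i < m | s i < t <= s i.+1) xi i w.

Definition simple_int W (m : nat) (s : nat -> R)
    (xi : nat -> Omega -> 'rV[R]_d -> R) : R -> Omega -> 'rV[R]_d -> R :=
  fun t w => \sum_(i < m)
    increment W (Num.min (s i) t) (Num.min (s i.+1) t) w *: xi i w.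

(* J is a version of the process t |-> int_0^t Z dW, t in [0, T], the Ito
   integral being defined as usual as a limit in mean square of the integrals
   of bounded adapted simple processes *)
Definition is_ito_integral K F T W Z J : Prop :=
  adapted K F T J /\
  exists (m : nat -> nat) (s : nat -> nat -> R)
         (xi : nat -> nat -> Omega -> 'rV[R]_d -> R),
    [/\ forall k, simple_process K F T (m k) (s k) (xi k),
        (fun k => norm2_L2L2 K T (Z - simple_val (m k) (s k) (xi k)))
          @ \oo --> 0%E &
        forall t, 0 <= t <= T ->
          (fun k => \int[P]_w
             ((fnorm K (J t w - simple_int W (m k) (s k) (xi k) t w)) ^+ 2)%:E)%E
          @ \oo --> 0%E].

Section semidiscrete.
Variables (T alpha beta gamma : R) (W : R -> Omega -> R) (V : fspace R d).
Variables (Rh Dh : ('rV[R]_d -> R) -> 'rV[R]_d -> R).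
Variables (X10 X20 : 'rV[R]_d -> R) (Xt : R -> 'rV[R]_d -> R)
  (sigma : R -> Omega -> 'rV[R]_d -> R).

Let F := filtration W.

Definition is_state U X1 X2 : Prop :=
  [/\ L2F_Ct V F T X1, L2F_Ct V F T X2 &
      exists2 J, is_ito_integral V F T W
                   (fun t w => gamma *: X1 t w + Rh (sigma t w)) J &
      forall t, 0 <= t <= T -> {ae P, forall w,
        X1 t w = Rh X10 + tint 0 t (X2 ^~ w) /\
        X2 t w = Rh X20 + tint 0 t (fun s => Dh (X1 s w) + U s w) + J t w}].

Definition cost U X1 : \bar R :=
  (2^-1%:E * \int[P]_w
    (\int[lebesgue_measure]_(t in `[0%R, T])
       ((fnorm V (X1 t w - Rh (Xt t))) ^+ 2 +
        alpha * (fnorm V (U t w)) ^+ 2)%:E +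
     (beta * (fnorm V (X1 T w - Rh (Xt T))) ^+ 2)%:E))%E.

Definition is_optimal U X1 X2 : Prop :=
  [/\ L2F_L2t V F T U, is_state U X1 X2 &
      forall U' X1' X2', L2F_L2t V F T U' -> is_state U' X1' X2' ->
        (cost U X1 <= cost U' X1')%E].

Definition is_adjoint X1 Y1 Y2 Z1 Z2 : Prop :=
  [/\ L2F_Ct V F T Y1 /\ L2F_Ct V F T Y2,
      L2F_L2t V F T Z1 /\ L2F_L2t V F T Z2 &
      exists J1 J2,
        [/\ is_ito_integral V F T W Z1 J1,
            is_ito_integral V F T W Z2 J2 &
            forall t, 0 <= t <= T -> {ae P, forall w,
              Y1 t w = beta *: (X1 T w - Rh (Xt T))
                + tint t T (fun s => Dh (Y2 s w) + gamma *: Z2 s w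
                                     + X1 s w - Rh (Xt s))
                - (J1 T w - J1 t w) /\
              Y2 t w = tint t T (Y1 ^~ w) - (J2 T w - J2 t w)}]].

Variable N : nat.

Definition tgrid (n : nat) : R := n%:R * (T / N%:R).

Definition piecewise_constant X : Prop :=
  forall n, (n < N)%N -> forall t w,
    tgrid n <= t < tgrid n.+1 -> X t w = X (tgrid n) w.

Definition discrete_control U : Prop :=
  L2F_L2t V F T U /\ piecewise_constant U.

Definition is_discrete_state0 U X1 X2 : Prop :=
  [/\ adapted V F T X1 /\ adapted V F T X2,
      piecewise_constant X1 /\ piecewise_constant X2,
      {ae P, forall w, X1 0 w = 0 /\ X2 0 w = 0} &
      forall n, (n < N)%N -> {ae P, forall w,
        X1 (tgrid n.+1) w - X1 (tgrid n) w =
          (T / N%:R / 2) *: (X2 (tgrid n.+1) w + X2 (tgrid n) w) /\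
        X2 (tgrid n.+1) w - X2 (tgrid n) w =
          (T / N%:R / 2) *: Dh (X1 (tgrid n.+1) w + X1 (tgrid n) w)
          + (T / N%:R) *: U (tgrid n) w
          + (gamma * increment W (tgrid n) (tgrid n.+1) w) *: X1 (tgrid n) w}].

End semidiscrete.
End processes.

(* Main.v *)
Require Import Defs.
From mathcomp Require Import all_boot all_order all_algebra.
From mathcomp Require Import all_classical all_reals all_analysis.
From mathcomp Require Import measurable_realfun ring lra.

Set Implicit Arguments.
Unset Strict Implicit.
Unset Printing Implicit Defensive.

Import Order.TTheory GRing.Theory Num.Theory.
Import numFieldNormedType.Exports.

Local Open Scope classical_set_scope.
Local Open Scope ring_scope.

(** The identity is a discrete integration by parts between the backward
    equation and the scheme. In a basis of V_h that is orthonormal in L^2(D), the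
    inner product becomes a finite sum of products of coordinates, the form
    <grad u, grad v> becomes the one of the stiffness matrix A, and the discrete
    Laplacian becomes -A. Over a step from t_n to t_(n+1), with values X, Y at its
    beginning and X', Y' at its end, write, in each coordinate,

      E(Y1' X1') - E(Y1 X1) = E(Y1' (X1' - X1)) + E((Y1' - Y1) X1),
      E(Y2' X2') - E(Y2 X2) = E(Y2' (X2' - X2)) + E((Y2' - Y2) X2),

    and replace X' - X by the scheme and Y' - Y by the backward equation. The
    stochastic integrals are orthogonal to X1 and X2, which are known at t_n. In
    gamma E(Y2' X1 dW), with dW the increment of the Wiener process, Y2' is
    replaced by Y2 - int Y1 + int Z2 dW: the first part contributes 0, the second
    one a term of I_4, and by the Ito isometry the third one is
    gamma E(X1 int Z2 dt), which cancels the term gamma Z2 of the backward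
    equation ([one_step_identity]). Summing over the steps, the left-hand sides
    telescope: the discrete state starts from 0, while at T the variables Y1, Y2
    are beta times the deviation, and 0 ([duality_telescope],
    [discrete_duality]).

    The rest makes these computations legitimate.
    - Stochastic analysis. Gaussian increments independent of the augmented past
      have the expected moments ([increment_moments], [filtration_indep]); from
      simple processes, the orthogonality and the isometry pass to the mean-square
      limit ([ito_orthogonal], [ito_isometry], [crd_ito]). Processes with
      continuous paths are jointly measurable ([cutoff_meas_paths]), hence their
      time integrals are random variables ([time_integralP]). The discrete state
      is square integrable since 1 + (tau / 2)^2 A is invertible
      ([psd_shift_inverse], [state_sqint]).
    - Function spaces. Weak gradients are unique a.e., as a function orthogonal to
      the smooth bumps vanishes ([orthogonal_to_tests_ae0], [weak_grad_unique]);
      this makes <grad u, grad v> bilinear on H^1. A finite element function is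
      determined by its values at finitely many vertices, whence the orthonormal
      basis ([Vh_orthonormal_basis]). Poincare's inequality ([poincare]) makes the
      Ritz projection continuous from H^1_0 to L^2 ([ritz_lipschitz]), so that the
      projected target is a continuous function of time. *)

(** * Square integrable functions *)

Section square_integrable.
Context {dT : measure_display} {T : measurableType dT} {R : realType}.
Variable mu : {measure set T -> \bar R}.
Implicit Types f g h : T -> R.

(** Integrable real-valued functions. *)
Definition rint f := mu.-integrable setT (EFin \o f).

Lemma rint_meas f : rint f -> measurable_fun setT f.
Proof. by move=> /integrableP[/measurable_EFinP]. Qed.

Lemma rint0 : rint (fun=> 0).
Proof. exact: integrable0. Qed.

Lemma rintD f g : rint f -> rint g -> rint (fun x => f x + g x).
Proof. by move=> If Ig; exact: (@integrableD _ _ _ mu setT measurableT (EFin \o f) (EFin \o g)). Qed.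

Lemma rintZ (a : R) f : rint f -> rint (fun x => a * f x).
Proof. by move=> If; exact: (@integrableZl _ _ _ mu setT measurableT a (EFin \o f)). Qed.

Lemma rintB f g : rint f -> rint g -> rint (fun x => f x - g x).
Proof. by move=> If Ig; exact: (@integrableB _ _ _ mu setT measurableT (EFin \o f) (EFin \o g)). Qed.

Lemma rint_sum (I : Type) (s : seq I) (p : pred I) (F : I -> T -> R) :
  (forall i, p i -> rint (F i)) -> rint (fun x => \sum_(i <- s | p i) F i x).
Proof.
move=> IF; elim: s => [|i s IH].
  by under [X in rint X]eq_fun do rewrite big_nil; exact: rint0.
have [pi|pi] := boolP (p i); last first.
  by under [X in rint X]eq_fun do rewrite big_cons (negbTE pi).
under [X in rint X]eq_fun do rewrite big_cons pi.
by apply: rintD; [exact: IF|].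
Qed.

Lemma rint_le f g : measurable_fun setT f -> (forall x, `|f x| <= g x) ->
  rint g -> rint f.
Proof.
move=> mf fg Ig; apply: le_integrable Ig => //; first exact/measurable_EFinP.
move=> x _ /=; rewrite lee_fin; apply: (le_trans (fg x)).
by rewrite ler_norm.
Qed.

Lemma rint_norm f : rint f -> rint (fun x => `|f x|).
Proof. by move=> If; exact: (integrable_norm If). Qed.

Lemma RintD f g : rint f -> rint g ->
  \int[mu]_x (f x + g x) = \int[mu]_x f x + \int[mu]_x g x.
Proof. exact: RintegralD. Qed.

Lemma RintB f g : rint f -> rint g ->
  \int[mu]_x (f x - g x) = \int[mu]_x f x - \int[mu]_x g x.
Proof. exact: RintegralB. Qed.

Lemma RintZ (a : R) f : rint f -> \int[mu]_x (a * f x) = a * \int[mu]_x f x.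
Proof. by move=> If; rewrite RintegralZl. Qed.

Lemma Rint_zero : \int[mu]_x (0 : R) = 0.
Proof. by rewrite /Rintegral integral0. Qed.

Lemma Rint_sum (I : Type) (s : seq I) (p : pred I) (F : I -> T -> R) :
  (forall i, p i -> rint (F i)) ->
  \int[mu]_x (\sum_(i <- s | p i) F i x) = \sum_(i <- s | p i) \int[mu]_x F i x.
Proof.
move=> IF; elim: s => [|i s IH].
  by rewrite big_nil; under eq_Rintegral do rewrite big_nil; exact: Rint_zero.
rewrite big_cons; have [pi|pi] := boolP (p i); last first.
  by under eq_Rintegral do rewrite big_cons (negbTE pi).
under eq_Rintegral do rewrite big_cons pi.
by rewrite RintD ?IH//; [exact: IF|exact: rint_sum].
Qed.

Lemma Rint_ae f g : measurable_fun setT f -> measurable_fun setT g ->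
  {ae mu, forall x, f x = g x} -> \int[mu]_x f x = \int[mu]_x g x.
Proof.
move=> mf mg fg; congr fine; apply: ae_eq_integral => //.
- exact/measurable_EFinP.
- exact/measurable_EFinP.
- by apply: filterS fg => x /= ->.
Qed.

Lemma rint_ae f g : measurable_fun setT g ->
  {ae mu, forall x, f x = g x} -> rint f -> rint g.
Proof.
move=> mg fg If; apply/integrableP; split; first exact/measurable_EFinP.
case/integrableP : (If) => mf.
rewrite (@ae_eq_integral _ _ _ mu setT (fun x => `|(EFin \o g) x|)%E)//.
- exact: measurableT_comp.
- by apply: measurableT_comp => //; exact/measurable_EFinP.
- by apply: filterS fg => x /= ->.
Qed.

(** Square integrable functions, as everywhere defined representatives; for the
    inner product below they form the space L^2 up to a.e. equality. *)
Definition sqint f := measurable_fun setT f /\ rint (fun x => f x ^+ 2).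

Definition inner f g := \int[mu]_x (f x * g x).

Lemma sqint_mul f g : sqint f -> sqint g -> rint (fun x => f x * g x).
Proof.
move=> [mf If] [mg Ig]; apply: rint_le (rintD If Ig).
  exact: measurable_funM.
move=> x; rewrite normrM -(real_normK (num_real (f x))).
rewrite -(real_normK (num_real (g x))).
set a := `|f x|; set b := `|g x|.
have a0 : 0 <= a by rewrite normr_ge0.
have b0 : 0 <= b by rewrite normr_ge0.
have := sqr_ge0 (a - b); rewrite sqrrB => h.
have ab : 0 <= a * b by rewrite mulr_ge0.
have : 0 <= a ^+ 2 + b ^+ 2 - (a * b) *+ 2 by rewrite addrAC.
rewrite subr_ge0; apply: le_trans; rewrite mulr2n lerDl//.
Qed.

Lemma sqint0 : sqint (fun=> 0).
Proof.
split; first exact: measurable_cst.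
by under [X in rint X]eq_fun do rewrite expr0n/=; exact: rint0.
Qed.

Lemma sqintZ (a : R) f : sqint f -> sqint (fun x => a * f x).
Proof.
move=> [mf If]; split; first exact: measurable_funM.
by under [X in rint X]eq_fun do rewrite exprMn; exact: rintZ.
Qed.

Lemma sqintD f g : sqint f -> sqint g -> sqint (fun x => f x + g x).
Proof.
move=> sf sg; have Ifg := sqint_mul sf sg; case: sf sg => [mf If] [mg Ig].
split; first exact: measurable_funD.
under [X in rint X]eq_fun do rewrite sqrrD mulr2n.
by apply: rintD => //; apply: rintD => //; exact: rintD.
Qed.

Lemma sqintN f : sqint f -> sqint (fun x => - f x).
Proof.
by under [X in _ -> sqint X]eq_fun do rewrite -mulN1r; exact: sqintZ.
Qed.

Lemma sqintB f g : sqint f -> sqint g -> sqint (fun x => f x - g x).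
Proof. by move=> sf sg; apply: sqintD => //; exact: sqintN. Qed.

Lemma sqint_sum (I : Type) (s : seq I) (p : pred I) (F : I -> T -> R) :
  (forall i, p i -> sqint (F i)) -> sqint (fun x => \sum_(i <- s | p i) F i x).
Proof.
move=> IF; elim: s => [|i s IH].
  by under [X in sqint X]eq_fun do rewrite big_nil; exact: sqint0.
have [pi|pi] := boolP (p i); last first.
  by under [X in sqint X]eq_fun do rewrite big_cons (negbTE pi).
under [X in sqint X]eq_fun do rewrite big_cons pi.
by apply: sqintD; [exact: IF|].
Qed.

Lemma sqint_le f g : measurable_fun setT f -> (forall x, `|f x| <= `|g x|) ->
  sqint g -> sqint f.
Proof.
move=> mf fg [mg Ig]; split => //; apply: rint_le Ig => //.
  exact: measurable_funX.
move=> x; rewrite normrX -(real_normK (num_real (g x))).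
by rewrite lerXn2r ?nnegrE.
Qed.

Lemma sqint_ae f g : measurable_fun setT g ->
  {ae mu, forall x, f x = g x} -> sqint f -> sqint g.
Proof.
move=> mg fg [mf If]; split => //.
apply: rint_ae If; first exact: measurable_funX.
by apply: filterS fg => x ->.
Qed.

Lemma innerC f g : inner f g = inner g f.
Proof. by apply: eq_Rintegral => x _; rewrite mulrC. Qed.

Lemma innerDl f g h : sqint f -> sqint g -> sqint h ->
  inner (fun x => f x + g x) h = inner f h + inner g h.
Proof.
move=> sf sg sh; rewrite /inner -RintD//; try exact: sqint_mul.
by apply: eq_Rintegral => x _; rewrite mulrDl.
Qed.

Lemma innerZl (a : R) f h : sqint f -> sqint h ->
  inner (fun x => a * f x) h = a * inner f h.
Proof.
move=> sf sh; rewrite /inner -RintZ//; try exact: sqint_mul.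
by apply: eq_Rintegral => x _; rewrite mulrA.
Qed.

Lemma innerNl f h : sqint f -> sqint h -> inner (fun x => - f x) h = - inner f h.
Proof.
move=> sf sh; rewrite -mulN1r -innerZl//.
by apply: eq_Rintegral => x _; rewrite mulN1r.
Qed.

Lemma innerBl f g h : sqint f -> sqint g -> sqint h ->
  inner (fun x => f x - g x) h = inner f h - inner g h.
Proof. by move=> sf sg sh; rewrite innerDl ?innerNl//; exact: sqintN. Qed.

Lemma inner_suml (I : Type) (s : seq I) (p : pred I) (F : I -> T -> R) h :
  (forall i, p i -> sqint (F i)) -> sqint h ->
  inner (fun x => \sum_(i <- s | p i) F i x) h =
  \sum_(i <- s | p i) inner (F i) h.
Proof.
move=> sF sh; rewrite /inner -Rint_sum.
  by apply: eq_Rintegral => x _; rewrite mulr_suml.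
by move=> i pi; apply: sqint_mul => //; exact: sF.
Qed.

Lemma inner_ge0 f : 0 <= inner f f.
Proof. by apply: Rintegral_ge0 => x _; rewrite -expr2 sqr_ge0. Qed.

Lemma inner_ae f f' g g' :
  measurable_fun setT f -> measurable_fun setT f' ->
  measurable_fun setT g -> measurable_fun setT g' ->
  {ae mu, forall x, f x = f' x} -> {ae mu, forall x, g x = g' x} ->
  inner f g = inner f' g'.
Proof.
move=> mf mf' mg mg' ff' gg'; apply: Rint_ae; try exact: measurable_funM.
by apply: filterS2 ff' gg' => x -> ->.
Qed.

Lemma inner_eq0 f : sqint f -> inner f f = 0 -> {ae mu, forall x, f x = 0}.
Proof.
move=> [mf If] f0.
have mf2 : measurable_fun setT (EFin \o (fun x => f x ^+ 2)).
  by apply/measurable_EFinP; exact: measurable_funX.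
have fE : (\int[mu]_x `|(f x ^+ 2)%:E| = 0)%E.
  under eq_integral do rewrite /= ger0_norm ?sqr_ge0//.
  rewrite -(fineK (integrable_fin_num _ If))//; congr EFin.
  by rewrite -[RHS]f0.
have := (ae_eq_integral_abs mu measurableT mf2).1 fE.
apply: filterS => x /(_ Logic.I)/= -[/eqP]; rewrite sqrf_eq0; exact/eqP.
Qed.

Lemma cauchy_schwarz f g : sqint f -> sqint g ->
  inner f g ^+ 2 <= inner f f * inner g g.
Proof.
move=> sf sg.
(* the square norm of t f - g is a nonnegative quadratic polynomial in t *)
have key (t : R) : 0 <= inner f f * t ^+ 2 - (inner f g * t) *+ 2 + inner g g.
  have s1 : sqint (fun x => t * f x) by exact: sqintZ.
  have -> : inner f f * t ^+ 2 - (inner f g * t) *+ 2 + inner g g =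
      inner (fun x => t * f x - g x) (fun x => t * f x - g x).
    rewrite innerBl//; last exact: sqintB.
    rewrite (innerC (fun x => t * f x)) (innerC g) !innerBl//.
    rewrite !innerZl// (innerC f (fun x => t * f x)) (innerC g (fun x => t * f x)).
    by rewrite !innerZl//; ring.
  exact: inner_ge0.
have := inner_ge0 f; rewrite le_eqVlt => /predU1P[f0|f0].
  rewrite -f0 mul0r real_exprn_even_le0 ?num_real//=.
  apply/eqP; apply: contrapT => /eqP fg0.
  have := key ((inner g g + 1) / (2 * inner f g)).
  rewrite -f0 mul0r sub0r (_ : inner f g * _ = (inner g g + 1) / 2); last by field.
  by lra.
have := key (inner f g / inner f f).
have n0 : inner f f != 0 by rewrite gt_eqF.
rewrite (_ : _ + _ = inner g g - inner f g ^+ 2 / inner f f); last by field.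
by rewrite subr_ge0 ler_pdivrMr// mulrC.
Qed.

Lemma inner_norm_le f g : sqint f -> sqint g ->
  `|inner f g| <= Num.sqrt (inner f f) * Num.sqrt (inner g g).
Proof.
move=> sf sg; rewrite -sqrtrM ?inner_ge0// -sqrtr_sqr ler_sqrt.
  exact: cauchy_schwarz.
by rewrite mulr_ge0 ?inner_ge0.
Qed.

(** Weak continuity of the inner product along mean-square limits. *)
Lemma inner_cvg (f_ : nat -> T -> R) f g :
  (forall k, sqint (f_ k)) -> sqint f -> sqint g ->
  inner (fun x => f_ k x - f x) (fun x => f_ k x - f x) @[k --> \oo] --> (0 : R) ->
  inner (f_ k) g @[k --> \oo] --> inner f g.
Proof.
move=> sf_ sf sg c0.
apply/subr_cvg0/norm_cvg0P.
have c1 : Num.sqrt (inner (fun x => f_ k x - f x) (fun x => f_ k x - f x)) *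
    Num.sqrt (inner g g) @[k --> \oo] --> (0 : R).
  rewrite -(mul0r (Num.sqrt (inner g g))); apply: cvgMl.
  rewrite -(@sqrtr0 R).
  exact: (continuous_cvg _ (@sqrt_continuous R 0)).
apply: (squeeze_cvgr _ (@cvg_cst _ _ _ _ _) c1).
near=> k; rewrite normr_ge0/= -innerBl//; apply: inner_norm_le => //.
exact: sqintB.
Unshelve. all: by end_near. Qed.

End square_integrable.

(** * Gaussian moments *)

Section convergence.
Context {dT : measure_display} {T : measurableType dT} {R : realType}.
Variable mu : {measure set T -> \bar R}.

Lemma Rint_dominated (f_ : nat -> T -> R) (f g : T -> R) :
  (forall n, measurable_fun setT (f_ n)) -> rint mu g ->
  (forall x, f_ n x @[n --> \oo] --> f x) ->
  (forall n x, `|f_ n x| <= g x) ->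
  rint mu f /\ \int[mu]_x f_ n x @[n --> \oo] --> \int[mu]_x f x.
Proof.
move=> mf_ Ig cf fg.
have mf : measurable_fun setT f.
  by apply: (@measurable_fun_cvg _ _ _ _ f_) => // x _; exact: cf.
have [||||If _ c] := @dominated_convergence _ T R mu setT measurableT
  (fun n => EFin \o f_ n) (EFin \o f) (EFin \o g) _ _ _ Ig.
- by move=> n; exact/measurable_EFinP.
- exact/measurable_EFinP.
- by apply/aeW => x _; apply: cvg_EFin; [exact: nearW|exact: cf].
- by apply/aeW => x n _; rewrite /= lee_fin fg.
split=> //.
apply: (@fine_cvg _ _ _ _ (fun n => \int[mu]_x (f_ n x)%:E)%E).
by rewrite /Rintegral fineK//; exact: integrable_fin_num.
Qed.

End convergence.

Section integral_on_the_line.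
Context {R : realType}.
Notation leb1 := (@lebesgue_measure R).

Lemma FTC_itv (a b : R) (f F : R -> R) : a < b -> continuous f ->
  (forall x, is_derive x (1 : R) F (f x)) ->
  \int[leb1]_(x in `[a, b]) f x = F b - F a.
Proof.
move=> ab cf dF.
have cF : continuous F.
  move=> x; apply/differentiable_continuous/derivable1_diffP.
  by have [] := dF x.
rewrite /Rintegral (@continuous_FTC2 _ f F a b)//.
- exact: continuous_subspaceT.
- split.
  + by move=> x _; have [] := dF x.
  + by apply: cvg_at_right_filter; exact: cF.
  + by apply: cvg_at_left_filter; exact: cF.
- by move=> x _; rewrite derive1E derive_val.
Qed.

Lemma Rint_sym_itv_cvg (f : R -> R) : rint leb1 f ->
  \int[leb1]_(x in `[- n%:R, n%:R]) f x @[n --> \oo] --> \int[leb1]_x f x.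
Proof.
move=> If.
under eq_fun do rewrite Rintegral_mkcond.
have mf := rint_meas If.
apply: (@Rint_dominated _ _ _ leb1 _ f (fun x => `|f x|) _ _ _ _).2.
- move=> n; apply/(measurable_restrictT f) => //.
  exact: measurable_funTS.
- exact: rint_norm.
- move=> x; apply: cvg_near_cst.
  have [n xn] : exists n : nat, `|x| <= n%:R.
    by exists (Num.trunc `|x|).+1; rewrite ltW// truncnS_gt.
  exists n => // k /= nk; rewrite patchE mem_set//= in_itv/= -ler_norml.
  by rewrite (le_trans xn)// ler_nat.
- by move=> n x; rewrite patchE; case: ifPn => //; rewrite normr0.
Qed.

Lemma rint_sym_itv_bounded (f : R -> R) (C : R) : measurable_fun setT f ->
  (forall x, 0 <= f x) ->
  (forall n : nat, (\int[leb1]_(x in `[(- n%:R)%R, n%:R]) (f x)%:E <= C%:E)%E) ->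
  rint leb1 f.
Proof.
move=> mf f0 fC; apply/integrableP; split; first exact/measurable_EFinP.
under eq_integral do rewrite /= ger0_norm//.
have UE : \bigcup_(n : nat) `[- n%:R, n%:R]%classic = [set: R].
  apply/seteqP; split=> // x _; exists (Num.trunc `|x|).+1 => //=.
  by rewrite in_itv/= -ler_norml ltW// truncnS_gt.
rewrite -UE; apply: (@le_lt_trans _ _ C%:E); last exact: ltry.
pose F (n : nat) : set (measurableTypeR R) := `[- n%:R, n%:R]%classic.
have ndF : nondecreasing_seq F.
  apply/nondecreasing_seqP => n; apply/subsetPset/subset_itvScc.
  + by rewrite bnd_simp lerN2 ler_nat.
  + by rewrite bnd_simp ler_nat.
have mF n : measurable (F n) by exact: measurable_itv.
have mFf n : measurable_fun (F n) (EFin \o f).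
  by apply/measurable_EFinP; exact: measurable_funTS.
have Ff0 i x : F i x -> (0 <= (EFin \o f) x)%E by rewrite /= lee_fin.
have c := @ge0_nondecreasing_set_cvg_integral _ _ _ _ _ leb1 ndF mF mFf Ff0.
rewrite -(cvg_lim _ c)//.
by apply: lime_le; [apply/cvg_ex; eexists; exact: c|exact: nearW].
Qed.

End integral_on_the_line.

Section gaussian_moments.
Context {R : realType}.
Variable s : R.
Hypothesis s0 : 0 < s.
Notation leb1 := (@lebesgue_measure R).
Let p := normal_pdf 0 s.

Let pE x : p x = normal_peak s * expR (- x ^+ 2 / (s ^+ 2 *+ 2)).
Proof. by rewrite /p normal_pdfE ?gt_eqF// /normal_fun subr0. Qed.

Let p_ge0 x : 0 <= p x. Proof. exact: normal_pdf_ge0. Qed.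

Let p_cont : continuous p. Proof. by apply: continuous_normal_pdf; rewrite gt_eqF. Qed.

Let p_derive (x : R) : is_derive x (1 : R) p (- (x / s ^+ 2) * p x).
Proof.
have -> : p = (fun x => normal_peak s * expR (- x ^+ 2 / (s ^+ 2 *+ 2))).
  by apply/funext => y; rewrite pE.
apply: is_derive_eq.
have sn : s != 0 by rewrite gt_eqF.
rewrite /GRing.scale/=.
by field.
Qed.

Let p_even x : p (- x) = p x. Proof. by rewrite !pE sqrrN. Qed.

Let p_bound (x : R) : 0 < x -> x * p x <= normal_peak s * (s ^+ 2 *+ 2) / x.
Proof.
move=> x0; rewrite pE mulrCA -[leRHS]mulrA. apply: ler_wpM2l; first exact: normal_peak_ge0.
have c0 : 0 < s ^+ 2 *+ 2 by rewrite pmulrn_lgt0// exprn_gt0.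
set c := s ^+ 2 *+ 2 in c0 *.
rewrite ler_pdivlMr// mulrC mulrA -expr2 -ler_pdivlMr ?expR_gt0//.
rewrite mulNr expRN invrK mulrC -ler_pdivrMr//.
by rewrite (le_trans _ (expR_ge1Dx _))// lerDr.
Qed.

Let np_cvg0 : n%:R * p n%:R @[n --> \oo] --> (0 : R).
Proof.
pose K := normal_peak s * (s ^+ 2 *+ 2).
have K0 : 0 <= K by rewrite mulr_ge0 ?normal_peak_ge0 ?mulrn_wge0 ?sqr_ge0.
have h0 : (2 * K) * harmonic n @[n --> \oo] --> (0 : R).
  by rewrite -(mulr0 (2 * K)); apply: cvgMr; exact: cvg_harmonic.
apply: (squeeze_cvgr _ (@cvg_cst _ _ _ _ _) h0).
near=> n; rewrite mulr_ge0//=.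
have n0 : (0 < n)%N by near: n; exact: nbhs_infty_gt.
apply: (le_trans (p_bound _)); first by rewrite ltr0n.
rewrite -/K [2 * K]mulrC -[leRHS]mulrA ler_wpM2l// /harmonic/= ler_pdivlMr//.
rewrite mulrC ler_pdivrMr ?ltr0n// -natrM ler_nat mul2n -addnn -addn1 leq_add2l//.
Unshelve. all: by end_near. Qed.

(* a primitive of x^2 p(x) - s^2 p(x) *)
Let G x := - s ^+ 2 * (x * p x).

Let G_derive (x : R) : is_derive x (1 : R) G (x ^+ 2 * p x - s ^+ 2 * p x).
Proof.
have hp := p_derive x.
apply: is_derive_eq.
have sn : s != 0 by rewrite gt_eqF.
rewrite /GRing.scale/=.
by field.
Qed.

Let cont_x2p : continuous (fun x : R => x ^+ 2 * p x).
Proof. by move=> x; apply: cvgM; [exact: sqr_continuous|exact: p_cont]. Qed.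

Let cont_G' : continuous (fun x : R => x ^+ 2 * p x - s ^+ 2 * p x).
Proof.
move=> x; apply: cvgB; first exact: cont_x2p.
by apply: cvgM; [exact: cvg_cst|exact: p_cont].
Qed.

Let rint_p : rint leb1 p.
Proof. exact: integrable_normal_pdf. Qed.

Let int_p : \int[leb1]_x p x = 1.
Proof. by rewrite /Rintegral integral_normal_pdf. Qed.

Let G_diff n : G n%:R - G (- n%:R) = - (2 * s ^+ 2) * (n%:R * p n%:R).
Proof. by rewrite /G p_even; ring. Qed.

Let rint_x2p : rint leb1 (fun x => x ^+ 2 * p x).
Proof.
apply: (@rint_sym_itv_bounded _ _ (s ^+ 2)).
- exact: continuous_measurable_fun.
- by move=> x; rewrite mulr_ge0 ?sqr_ge0.
move=> n; have [->|n0] := posnP n.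
  rewrite oppr0 set_itv1 integral_set1 lee_fin sqr_ge0//.
have Ic (f : R -> R) : continuous f ->
    leb1.-integrable `[- n%:R, n%:R] (EFin \o f).
  move=> cf; apply: continuous_compact_integrable.
    exact: segment_compact.
  exact: continuous_subspaceT.
rewrite -[leLHS]fineK; last exact: integrable_fin_num (Ic _ cont_x2p).
rewrite lee_fin -/(Rintegral _ _ _).
have nn : (- n%:R : R) < n%:R by rewrite gtrN// ltr0n.
have := FTC_itv nn cont_G' G_derive; rewrite G_diff RintegralB//; first last.
- by apply: Ic => x; apply: cvgM; [exact: cvg_cst|exact: p_cont].
- exact: Ic.
rewrite RintegralZl//; last exact: Ic.
move=> /eqP; rewrite subr_eq => /eqP ->.
rewrite (@le_trans _ _ (s ^+ 2 * \int[leb1]_(x in `[- n%:R, n%:R]) p x))//.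
  by rewrite gerDr mulNr oppr_le0 !mulr_ge0 ?(ltW s0).
rewrite ler_piMr ?sqr_ge0// -[leRHS]int_p Rintegral_mkcond le_Rintegral//.
- by rewrite -restrict_EFin; apply/integrable_restrict => //; rewrite setTI; exact: Ic.
- by move=> x _; rewrite patchE; case: ifPn.
Qed.

Lemma normal_pdf_second_moment :
  rint leb1 (fun x => x ^+ 2 * p x) /\ \int[leb1]_x (x ^+ 2 * p x) = s ^+ 2.
Proof.
split; first exact: rint_x2p.
have I2 : rint leb1 (fun x => s ^+ 2 * p x) by exact: rintZ.
have c1 := Rint_sym_itv_cvg (rintB rint_x2p I2).
have c2 : \int[leb1]_(x in `[- n%:R, n%:R]) (x ^+ 2 * p x - s ^+ 2 * p x)
    @[n --> \oo] --> (0 : R).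
  have h : - (2 * s ^+ 2) * (n%:R * p n%:R) @[n --> \oo] --> (0 : R).
    rewrite -[X in _ --> X](mulr0 (- (2 * s ^+ 2))); apply: cvgMr.
    exact: np_cvg0.
  apply: cvg_trans h; apply: near_eq_cvg.
  near=> n.
  have n0 : (0 < n)%N by near: n; exact: nbhs_infty_gt.
  rewrite -G_diff; apply/esym/FTC_itv => //.
  by rewrite gtrN// ltr0n.
have E : \int[leb1]_x (x ^+ 2 * p x - s ^+ 2 * p x) = 0.
  exact: (cvg_unique (@norm_hausdorff _ _) c1 c2).
apply/eqP; rewrite -subr_eq0; apply/eqP.
by rewrite -[RHS]E RintB// RintZ// int_p mulr1.
Unshelve. all: by end_near. Qed.

Lemma normal_pdf_first_moment :
  rint leb1 (fun x => x * p x) /\ \int[leb1]_x (x * p x) = 0.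
Proof.
have cxp : continuous (fun x : R => x * p x).
  by move=> x; apply: cvgM; [exact: cvg_id|exact: p_cont].
have Ixp : rint leb1 (fun x => x * p x).
  have Ig : rint leb1 (fun x => p x + x ^+ 2 * p x) by exact: rintD.
  apply: rint_le Ig; first exact: continuous_measurable_fun.
  move=> x; rewrite normrM (ger0_norm (p_ge0 x)) -[X in _ <= X + _]mul1r -mulrDl.
  rewrite ler_wpM2r// -(real_normK (num_real x)).
  by have := sqr_ge0 (`|x| - 1); have := normr_ge0 x; nra.
split=> //.
(* a primitive of x p(x) *)
pose F x := - s ^+ 2 * p x.
have dF x : is_derive x (1 : R) F (x * p x).
  have hp := p_derive x.
  apply: is_derive_eq.
  have sn : s != 0 by rewrite gt_eqF.
  by rewrite /GRing.scale/=; field.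
have c1 := Rint_sym_itv_cvg Ixp.
have c2 : \int[leb1]_(x in `[- n%:R, n%:R]) (x * p x) @[n --> \oo] --> (0 : R).
  apply: cvg_near_cst; near=> n.
  have n0 : (0 < n)%N by near: n; exact: nbhs_infty_gt.
  have nn : (- n%:R : R) < n%:R by rewrite gtrN// ltr0n.
  by rewrite (FTC_itv nn cxp dF) /F p_even subrr.
exact: (cvg_unique (@norm_hausdorff _ _) c1 c2).
Unshelve. all: by end_near. Qed.

Let normal_ge0_integral (f : R -> R) : (forall x, 0 <= f x) ->
  measurable_fun setT f ->
  (\int[normal_prob 0 s]_x (f x)%:E = \int[leb1]_x (f x * p x)%:E)%E.
Proof.
move=> f0 mf.
have dom := normal_prob_dominates (0 : R) s.
rewrite -(@Radon_Nikodym_SigmaFinite.change_of_variables _ _ _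
  (normal_prob 0 s) leb1 dom)//; last exact/measurable_EFinP.
have mrn : measurable_fun setT
    (Radon_Nikodym_SigmaFinite.f (normal_prob 0 s) leb1).
  exact: measurable_int (Radon_Nikodym_SigmaFinite.f_integrable dom).
apply: ae_eq_integral => //.
- by apply: emeasurable_funM => //; exact/measurable_EFinP.
- apply/measurable_EFinP/measurable_funM => //; exact: measurable_normal_pdf.
under [X in ae_eq _ _ _ X]eq_fun do rewrite EFinM.
apply: ae_eqe_mul2l; apply: integral_ae_eq => //.
- exact: Radon_Nikodym_SigmaFinite.f_integrable.
- by apply/measurable_EFinP; exact: measurable_normal_pdf.
- by move=> A _ mA; rewrite -Radon_Nikodym_SigmaFinite.f_integral.
Qed.

Lemma normal_Rintegral (f : R -> R) : measurable_fun setT f ->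
  rint leb1 (fun x => f x * p x) ->
  rint (normal_prob 0 s) f /\
  \int[normal_prob 0 s]_x f x = \int[leb1]_x (f x * p x).
Proof.
move=> mf If.
have If' : rint leb1 (fun x => `|f x| * p x).
  have := rint_norm If; under eq_fun do rewrite normrM (ger0_norm (p_ge0 _)).
  by [].
have Nf : rint (normal_prob 0 s) f.
  apply/integrableP; split; first exact/measurable_EFinP.
  rewrite normal_ge0_integral//; last exact: measurableT_comp.
  by rewrite -ge0_fin_numE ?(integrable_fin_num _ If')//; apply: integral_ge0 => x _;
    rewrite lee_fin mulr_ge0.
split=> //.
(* f is the difference of two nonnegative functions, |f| + f and |f| *)
pose g x := `|f x| + f x.
have Ng : rint (normal_prob 0 s) g by apply: rintD => //; exact: rint_norm.
have g0 x : 0 <= g x by rewrite /g addrC -lerBlDr sub0r lerNnormlW.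
have Nn := rint_norm Nf.
have := RintB Ng Nn.
under eq_Rintegral do rewrite /g addrAC subrr add0r.
move=> ->; rewrite /Rintegral !normal_ge0_integral//; first last.
- exact: rint_meas Ng.
- exact: rint_meas Nn.
rewrite -/(Rintegral _ _ _) -/(Rintegral _ _ (fun x => `|f x| * p x)).
rewrite -RintB//.
- by apply: eq_Rintegral => x _; rewrite /g; ring.
- by under [X in rint _ X]eq_fun do rewrite /g mulrDl; exact: rintD.
Qed.

End gaussian_moments.

(** * Increments of the Wiener process *)

Section expectation_of_independent_product.
Context {dO : measure_display} {Omega : measurableType dO} {R : realType}.
Variable P : probability Omega R.

Lemma indep_expectation (X Y : Omega -> R) : rint P X -> rint P Y ->
  (forall A B : set (measurableTypeR R), measurable A -> measurable B ->
    P (X @^-1` A `&` Y @^-1` B) = (P (X @^-1` A) * P (Y @^-1` B))%E) ->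
  rint P (fun w => X w * Y w) /\
  \int[P]_w (X w * Y w) = \int[P]_w X w * \int[P]_w Y w.
Proof.
move=> IX IY indep.
have mX := rint_meas IX; have mY := rint_meas IY.
have mXY : measurable_fun setT (fun w => (X w, Y w)).
  exact/measurable_fun_pair.
pose X' : {RV P >-> R} :=
  MeasurableFun.Pack (MeasurableFun.Class (isMeasurableFun.Build _ _ _ _ _ mX)).
pose Y' : {RV P >-> R} :=
  MeasurableFun.Pack (MeasurableFun.Class (isMeasurableFun.Build _ _ _ _ _ mY)).
pose XY' : {RV P >-> (R * R)%type} :=
  MeasurableFun.Pack (MeasurableFun.Class (isMeasurableFun.Build _ _ _ _ _ mXY)).
pose m1 := distribution P X'.
pose m2 := distribution P Y'.
pose m := distribution P XY'.
(* independence: the joint law is the product of the laws *)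
have mE A : measurable A -> (m1 \x m2)%E A = m A.
  by apply: product_measure_unique => B C mB mC; rewrite /m /= /distribution /pushforward -indep.
pose f (z : R * R) := z.1 * z.2.
have mf : measurable_fun setT f by apply: measurable_funM.
have I1 : m1.-integrable setT (EFin \o (idfun : R -> R)).
  apply/integrableP; split; first exact: EFin_measurable.
  rewrite ge0_integral_distribution//; last by apply: measurableT_comp => //; exact: EFin_measurable.
  by case/integrableP : IX.
have I2 : m2.-integrable setT (EFin \o (idfun : R -> R)).
  apply/integrableP; split; first exact: EFin_measurable.
  rewrite ge0_integral_distribution//; last by apply: measurableT_comp => //; exact: EFin_measurable.
  by case/integrableP : IY.
have E1 : \int[m1]_x x = \int[P]_w X w.
  by rewrite /Rintegral integral_distribution//; exact: EFin_measurable.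
have E2 : \int[m2]_x x = \int[P]_w Y w.
  by rewrite /Rintegral integral_distribution//; exact: EFin_measurable.
have fin1 := integrable_fin_num measurableT I1.
have fin2 := integrable_fin_num measurableT I2.
have If : (m1 \x m2)%E.-integrable setT (EFin \o f).
  apply/integrable12ltyP; first exact/measurable_EFinP.
  have mn : measurable_fun setT (fun y : R => `|y|%:E).
    by apply/measurable_EFinP; exact: normr_measurable.
  under eq_integral => x _.
    under eq_integral => y _ do rewrite /f /= normrM EFinM.
    rewrite ge0_integralZl//.
    over.
  have I1' := rint_norm I1; have I2' := rint_norm I2.
  rewrite /= ge0_integralZr//; last exact: integral_ge0.
  have f1 := integrable_fin_num measurableT I1'.
  have f2 := integrable_fin_num measurableT I2'.
  by rewrite ltey_eq fin_numM.
have Im : m.-integrable setT (EFin \o f).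
  apply/integrableP; split; first exact/measurable_EFinP.
  case/integrableP : If => _; congr (_ < _)%E.
  by apply: eq_measure_integral => A mA _; exact: mE.
have IXY : rint P (fun w => X w * Y w).
  apply/integrableP; split; first by apply/measurable_EFinP; exact: measurable_funM.
  case/integrableP : Im => mf' ; rewrite ge0_integral_distribution//.
  exact: measurableT_comp.
split=> //.
transitivity (\int[m]_z f z).
  by rewrite /Rintegral integral_distribution//; exact/measurable_EFinP.
transitivity (\int[(m1 \x m2)%E]_z f z).
  by congr fine; apply/esym/eq_measure_integral => A mA _; exact: mE.
rewrite -E1 -E2 /Rintegral -integral12_prod_meas1// /fubini_F.
rewrite -fineM//; congr fine.
rewrite -[X in _ = (_ * X)%E]fineK// -integralZr// fineK//.
apply: eq_integral => x _ /=.
by rewrite -integralZl//; apply: eq_integral => y _.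
Qed.

End expectation_of_independent_product.

Section wiener_increments.
Context {dO : measure_display} {Omega : measurableType dO} {R : realType}.
Variables (P : probability Omega R) (T : R) (W : R -> Omega -> R).
Hypothesis hP : measure_is_complete P.
Hypothesis hW : wiener_process P T W.

Lemma wiener_meas t : 0 <= t <= T -> measurable_fun setT (W t).
Proof. by case: hW => + _ _ _ _; exact. Qed.

Lemma past_measurable s : s <= T -> past W s `<=` measurable.
Proof.
move=> sT; apply: smallest_sub; first exact: sigma_algebra_measurable.
move=> _ [r [B [/andP[r0 rs] mB ->]]].
rewrite -[X in measurable X]setTI; apply: wiener_meas => //.
by rewrite r0 (le_trans rs).
Qed.

(** The sigma-algebra of the augmented filtration, as a measurable space. *)
Definition Fspace s := g_sigma_algebraType (past W s `|` [set A | P.-negligible A]).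

Lemma filtration_measurable s : s <= T -> filtration P W s `<=` measurable.
Proof.
move=> sT; apply: smallest_sub; first exact: sigma_algebra_measurable.
by move=> A [|]; [exact: past_measurable|exact: hP].
Qed.

Lemma past_mono s t : s <= t -> past W s `<=` past W t.
Proof.
move=> st; apply: sub_sigma_algebra2 => A [r [B [/andP[r0 rs] mB ->]]].
by exists r, B; split=> //; rewrite r0 (le_trans rs).
Qed.

Lemma filtration_mono s t : s <= t -> filtration P W s `<=` filtration P W t.
Proof.
move=> st; apply: sub_sigma_algebra2 => A [pA|nA]; [left|by right].
exact: past_mono pA.
Qed.

(** Augmentation by null sets only changes events by null sets. *)
Lemma filtration_past s A : s <= T -> filtration P W s A ->
  exists2 A', past W s A' & P.-negligible ((A `\` A') `|` (A' `\` A)).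
Proof.
move=> sT.
(* the events equal to a past event up to a null set form a sigma-algebra *)
pose C := [set A | exists2 A', past W s A' & P.-negligible ((A `\` A') `|` (A' `\` A))].
have [p0 pD pU] : sigma_algebra setT (past W s) by exact: smallest_sigma_algebra.
suff : filtration P W s `<=` C by apply.
apply: smallest_sub; first split.
- by exists set0 => //; rewrite !setD0 setU0; exact: negligible_set0.
- move=> B [A' pA' nA']; exists (setT `\` A'); first exact: pD.
  apply: negligibleS nA' => x [[[_ nBx] nA'x]|[[_ nA'x] nBx]].
    by right; split=> //; apply: contrapT => nA; apply: nA'x.
  by left; split=> //; apply: contrapT => nB; apply: nBx.
- move=> B CB.
  have [B' B'P] := choice (fun n => let: ex_intro2 A' a b := CB n in ex_intro
    (fun A' => past W s A' /\ P.-negligible ((B n `\` A') `|` (A' `\` B n))) A' (conj a b)).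
  exists (\bigcup_k B' k); first by apply: pU => n; exact: (B'P n).1.
  apply: negligibleS (negligible_bigcup (fun k => (B'P k).2)).
  move=> x [[[k _ Bkx] nB']|[[k _ Bkx] nB]]; exists k => //.
    by left; split=> // B'x; apply: nB'; exists k.
  by right; split=> // B'x; apply: nB; exists k.
move=> B [pB|nB].
  by exists B => //; rewrite setDv setU0; exact: negligible_set0.
by exists set0 => //; rewrite setD0 set0D setU0.
Qed.

Lemma increment_meas s t : 0 <= s -> s <= t -> t <= T ->
  measurable_fun setT (increment W s t).
Proof.
move=> s0 st tT; apply: measurable_funB; apply: wiener_meas.
- by rewrite (le_trans s0)//.
- by rewrite s0 (le_trans st).
Qed.

(** The increments stay independent of the past after the augmentation. *)
Lemma filtration_indep s t A (B : set (measurableTypeR R)) :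
  0 <= s -> s < t -> t <= T -> filtration P W s A -> measurable B ->
  P (A `&` increment W s t @^-1` B) = (P A * P (increment W s t @^-1` B))%E.
Proof.
move=> s0 st tT fA mB.
have sT : s <= T by exact: le_trans (ltW st) tT.
have [A' pA' [N [mN PN AN]]] := filtration_past sT fA.
have mA := filtration_measurable sT fA; have mA' := past_measurable sT pA'.
case: hW => _ _ _ _ /(_ s t s0 st tT A' B pA' mB) key.
have mD : measurable (increment W s t @^-1` B).
  by rewrite -[X in measurable X]setTI; apply: increment_meas => //; exact: ltW.
have eqP C D : measurable C -> measurable D -> (C `\` D) `|` (D `\` C) `<=` N -> P C = P D.
  move=> mC mD' CD.
  have nul E F : measurable E -> measurable F -> (E `\` F) `<=` N -> (P E <= P F)%E.
    move=> mE mF EF.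
    have -> : P E = P (E `&` F).
      rewrite -{1}(setDUK (@subIsetl _ E F)) measureU; last 3 first.
      - exact: measurableI.
      - by apply: measurableD => //; exact: measurableI.
      - by rewrite setDIK.
      rewrite [X in (_ + X)%E](_ : _ = 0%E) ?adde0//.
      apply/eqP; rewrite -measure_le0 -PN le_measure// ?inE//.
        by apply: measurableD => //; exact: measurableI.
      by move=> x [Ex nEF]; apply: EF; split=> // Fx; apply: nEF.
    by apply: le_measure; rewrite ?inE//; exact: measurableI.
  by apply/eqP; rewrite eq_le !nul// => x Hx; apply: CD; [right|left].
rewrite (eqP A A')// -key; apply: eqP.
- exact: measurableI.
- exact: measurableI.
- move=> x [[[Ax Dx] nA]|[[Ax Dx] nA]]; apply: AN; [left|right]; split=> //.
    by move=> A'x; apply: nA.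
  by move=> A'x; apply: nA.
Qed.

Lemma increment_moments s t : 0 <= s -> s < t -> t <= T ->
  [/\ rint P (increment W s t), \int[P]_w increment W s t w = 0,
      rint P (fun w => increment W s t w ^+ 2) &
      \int[P]_w (increment W s t w ^+ 2) = t - s].
Proof.
move=> s0 st tT.
case: hW => _ _ _ /(_ s t s0 st tT) law _.
have sg : 0 < Num.sqrt (t - s) by rewrite sqrtr_gt0 subr_gt0.
have mD : @measurable_fun _ _ Omega (measurableTypeR R) setT (increment W s t).
  exact: increment_meas s0 (ltW st) tT.
pose D' : {RV P >-> (measurableTypeR R)} :=
  MeasurableFun.Pack (MeasurableFun.Class (isMeasurableFun.Build _ _ _ _ _ mD)).
have lawE A : measurable A -> distribution P D' A = normal_prob 0 (Num.sqrt (t - s)) A.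
  by move=> mA; rewrite /distribution /pushforward /= law.
have chg (g : R -> \bar R) :
    (\int[distribution P D']_x g x = \int[normal_prob 0 (Num.sqrt (t - s))]_x g x)%E.
  refine (@eq_measure_integral _ (measurableTypeR R) R setT
    (normal_prob 0 (Num.sqrt (t - s))) (distribution P D') g _) => A mA _.
  exact: lawE.
have key (f : R -> R) : measurable_fun setT f ->
    rint lebesgue_measure (fun x => f x * normal_pdf 0 (Num.sqrt (t - s)) x) ->
    rint P (fun w => f (increment W s t w)) /\
    \int[P]_w f (increment W s t w) =
    \int[lebesgue_measure]_x (f x * normal_pdf 0 (Num.sqrt (t - s)) x).
  move=> mf If.
  have [Nf <-] := normal_Rintegral mf If.
  have mf' : measurable_fun setT (EFin \o f) by exact/measurable_EFinP.
  have IP : rint P (fun w => f (increment W s t w)).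
    apply/integrableP; split; first by apply/measurable_EFinP; exact: (measurableT_comp mf mD).
    case/integrableP : Nf => _; rewrite -chg ge0_integral_distribution//.
    exact: measurableT_comp.
  split=> //.
  by rewrite /Rintegral -chg integral_distribution.
have [I1 E1] := normal_pdf_first_moment sg.
have [I2 E2] := normal_pdf_second_moment sg.
have [? ?] := key id (@measurable_id _ _ _) I1.
have [? ?] := key (fun x => x ^+ 2) (measurable_funX _ (@measurable_id _ _ _)) I2.
split=> //; first by rewrite -[RHS]E1.
by rewrite -[RHS](@sqr_sqrtr _ (t - s)) ?subr_ge0 ?ltW// -[RHS]E2.
Qed.

(** Random variables measurable with respect to the augmented filtration. *)
Definition Fmeas s (xi : Omega -> R) :=
  @measurable_fun _ _ (Fspace s) (measurableTypeR R) setT xi.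

Lemma FmeasP s (xi : Omega -> R) (B : set (measurableTypeR R)) :
  Fmeas s xi -> measurable B -> filtration P W s (xi @^-1` B).
Proof.
by move=> mxi mB; have := mxi measurableT B mB; rewrite setTI.
Qed.

Lemma Fmeas_measurable s xi : s <= T -> Fmeas s xi -> measurable_fun setT xi.
Proof.
move=> sT fxi _ B mB; rewrite setTI.
by apply: filtration_measurable sT _ _; exact: FmeasP.
Qed.

Lemma Fmeas_mono s t xi : s <= t -> Fmeas s xi -> Fmeas t xi.
Proof.
move=> st fxi _ B mB; rewrite setTI.
by apply: filtration_mono st _ _; exact: FmeasP.
Qed.

Lemma Fmeas_W s : 0 <= s -> Fmeas s (W s).
Proof.
move=> s0 _ B mB; rewrite setTI; apply: sub_sigma_algebra; left.
by apply: sub_sigma_algebra; exists s, B; split=> //; rewrite s0 lexx.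
Qed.

Lemma Fmeas_increment r s : 0 <= r -> r <= s -> Fmeas s (increment W r s).
Proof.
move=> r0 rs; apply: measurable_funB; first by apply: Fmeas_W; exact: le_trans rs.
by apply: Fmeas_mono rs _; exact: Fmeas_W.
Qed.

Lemma expectation_increment s t xi : 0 <= s -> s <= t -> t <= T ->
  Fmeas s xi -> rint P xi ->
  rint P (fun w => increment W s t w * xi w) /\
  \int[P]_w (increment W s t w * xi w) = 0.
Proof.
move=> s0; rewrite le_eqVlt => /predU1P[<- _ _ _|st tT fxi Ixi].
  under [X in rint _ X]eq_fun do rewrite /increment subrr mul0r.
  under eq_Rintegral do rewrite /increment subrr mul0r.
  by rewrite Rint_zero; split=> //; exact: rint0.
have [I1 E1 _ _] := increment_moments s0 st tT.
have [] := indep_expectation I1 Ixi; last by rewrite E1 mul0r.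
move=> A B mA mB; rewrite setIC muleC; apply: filtration_indep => //.
exact: FmeasP.
Qed.

Lemma expectation_increment_sqr s t xi : 0 <= s -> s <= t -> t <= T ->
  Fmeas s xi -> rint P xi ->
  rint P (fun w => increment W s t w ^+ 2 * xi w) /\
  \int[P]_w (increment W s t w ^+ 2 * xi w) = (t - s) * \int[P]_w xi w.
Proof.
move=> s0; rewrite le_eqVlt => /predU1P[<- _ _ _|st tT fxi Ixi].
  under [X in rint _ X]eq_fun do rewrite /increment subrr expr0n mul0r.
  under eq_Rintegral do rewrite /increment subrr expr0n mul0r.
  by rewrite Rint_zero subrr mul0r; split=> //; exact: rint0.
have [_ _ I2 E2] := increment_moments s0 st tT.
have [] := indep_expectation I2 Ixi; last by rewrite E2.
move=> A B mA mB; rewrite setIC muleC.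
apply: (filtration_indep (B := (fun x : R => x ^+ 2) @^-1` A)) => //.
  exact: FmeasP.
rewrite -[X in measurable X]setTI.
exact: (measurable_funX _ (@measurable_id _ _ _)).
Qed.

Lemma sqint_increment s t xi : 0 <= s -> s <= t -> t <= T ->
  Fmeas s xi -> sqint P xi -> sqint P (fun w => increment W s t w * xi w).
Proof.
move=> s0 st tT fxi [mxi Ixi]; split.
  by apply: measurable_funM => //; exact: increment_meas.
under [X in rint _ X]eq_fun do rewrite exprMn.
apply: (expectation_increment_sqr s0 st tT _ Ixi).1.
exact: measurable_funX.
Qed.

End wiener_increments.

(** * Integrals over time *)

Section time_integrals.
Context {dO : measure_display} {Omega : measurableType dO} {R : realType}.
Variable P : probability Omega R.
Notation leb1 := (@lebesgue_measure R).
Notation M := (P \x leb1)%E.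
Implicit Types (f : Omega * measurableTypeR R -> R) (xi : Omega -> R) (a b : R).

(** The process equal to the random variable xi on [a, b] and to 0 outside. *)
Definition tensor xi a b : Omega * measurableTypeR R -> R :=
  fun q => xi q.1 * \1_(`[a, b]%classic : set (measurableTypeR R)) q.2.

Lemma rint_prodP f : measurable_fun setT f ->
  rint M f <-> (\int[P]_w \int[leb1]_t `|f (w, t)|%:E < +oo)%E.
Proof.
move=> mf; rewrite /rint integrable12ltyP//; exact/measurable_EFinP.
Qed.

Lemma tensor_meas xi a b : measurable_fun setT xi -> measurable_fun setT (tensor xi a b).
Proof.
move=> mxi; apply: measurable_funM.
  exact: measurableT_comp mxi (@measurable_fst _ _ _ _).
by apply: measurableT_comp; [exact: measurable_indic|exact: measurable_snd].
Qed.

Lemma int_indic_itv a b : a <= b ->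
  (\int[leb1]_t (\1_`[a, b] t)%:E = (b - a)%:E)%E.
Proof.
move=> ab; rewrite integral_indic//= setIT lebesgue_measure_itv/= lte_fin.
by move: ab; rewrite le_eqVlt => /predU1P[->|->//]; rewrite ltxx subrr.
Qed.

Lemma indic_sqr (A : set R) (t : R) : \1_A t ^+ 2 = \1_A t :> R.
Proof. by rewrite indicE; case: (_ \in _); rewrite ?expr0n ?expr1n. Qed.

Lemma sqint_tensor xi a b : a <= b -> sqint P xi -> sqint M (tensor xi a b).
Proof.
move=> ab [mxi Ixi]; split; first exact: tensor_meas.
apply/rint_prodP.
  by apply: measurable_funX; exact: tensor_meas.
have mi : measurable_fun setT (fun t : R => (\1_(`[a, b]%classic : set R) t)%:E : \bar R).
  by apply/measurable_EFinP; exact: measurable_indic.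
under eq_integral => w _.
  under eq_integral => t _.
    rewrite /tensor /= ger0_norm ?sqr_ge0// exprMn indic_sqr EFinM.
    over.
  rewrite ge0_integralZl// ?lee_fin ?sqr_ge0// int_indic_itv//.
  over.
have mx2 : measurable_fun setT (fun w => (xi w ^+ 2)%:E).
  by apply/measurable_EFinP; exact: measurable_funX.
have ba : (0 <= (b - a)%:E)%E by rewrite lee_fin subr_ge0.
rewrite ge0_integralZr//; last by move=> w _; rewrite lee_fin sqr_ge0.
by rewrite ltey_eq fin_numM// (integrable_fin_num _ Ixi).
Qed.

Lemma tensorE f xi a b w t :
  (f (w, t) * tensor xi a b (w, t))%:E =
  ((xi w)%:E * (f (w, t) * \1_`[a, b] t)%:E)%E.
Proof. by rewrite /tensor/= -EFinM; congr EFin; rewrite mulrCA. Qed.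

(** The random variable obtained by integrating a process over [a, b]. *)
Definition time_integral a b f (w : Omega) : R := \int[leb1]_(t in `[a, b]) f (w, t).

(** Integrating a square integrable process over a time interval: the integral
    is a square integrable random variable, and the pairing with it is the
    pairing of the process with a tensor product. *)
Lemma time_integralP a b f : a <= b -> sqint M f ->
  [/\ sqint P (time_integral a b f),
      {ae P, forall w, leb1.-integrable `[a, b] (fun t => (f (w, t))%:E)} &
      forall xi, sqint P xi ->
        inner P (time_integral a b f) xi = inner M f (tensor xi a b)].
Proof.
move=> ab sf; have [mf If] := sf.
have s1 : sqint M (tensor (fun=> 1) a b).
  apply: sqint_tensor => //; split; first exact: measurable_cst.
  by under eq_fun do rewrite expr1n; exact: finite_measure_integrable_cst.
have If1 := sqint_mul sf s1.
have mfw w : measurable_fun setT (fun t : R => f (w, t)).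
  exact: measurableT_comp mf (@measurable_pair1 _ _ _ _ w).
have FE w : (\int[leb1]_t (f (w, t) * tensor (fun=> 1) a b (w, t))%:E =
    \int[leb1]_(t in `[a, b]) (f (w, t))%:E)%E.
  rewrite [RHS]integral_mkcond; apply: eq_integral => t _.
  rewrite /tensor/= mul1r indicE patchE; case: ifPn => _; first by rewrite mulr1.
  by rewrite mulr0.
have mF : measurable_fun setT (time_integral a b f).
  rewrite /time_integral /Rintegral.
  under eq_fun do rewrite -FE.
  apply: measurableT_comp => //.
  exact: (measurable_fubini_F If1).
have ae1 : {ae P, forall w, leb1.-integrable `[a, b] (fun t => (f (w, t))%:E)}.
  apply: filterS (ae_integrable1 If1) => w Iw.
  apply/integrable_mkcond => //; apply: eq_integrable Iw => // t _.
  rewrite /tensor/= mul1r indicE patchE; case: ifPn => _; first by rewrite mulr1.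
  by rewrite mulr0.
have F2 : {ae P, forall w, (`|(time_integral a b f w ^+ 2)%:E| <=
    \int[leb1]_t `|(f (w, t) ^+ 2)%:E| * (b - a)%:E)%E}.
  apply: filterS (ae_integrable1 If) => w Iw.
  have sfw : sqint leb1 (fun t => f (w, t)) by split; [exact: mfw|exact: Iw].
  have s1w : sqint leb1 (\1_`[a, b] : R -> R).
    split; first exact: measurable_indic.
    by under eq_fun do rewrite indic_sqr; exact: integrable_indic_itv.
  have -> : time_integral a b f w = inner leb1 (fun t => f (w, t)) (\1_`[a, b]).
    rewrite /time_integral Rintegral_mkcond; apply: eq_Rintegral => t _.
    by rewrite indicE patchE; case: ifPn => _; rewrite ?mulr1 ?mulr0.
  have -> : (\int[leb1]_t `|(f (w, t) ^+ 2)%:E| =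
      (inner leb1 (fun t => f (w, t)) (fun t => f (w, t)))%:E)%E.
    rewrite /inner /Rintegral fineK; last exact: integrable_fin_num.
    by apply: eq_integral => t _; rewrite gee0_abs ?lee_fin ?sqr_ge0// expr2.
  have -> : b - a = inner leb1 (\1_`[a, b]) (\1_`[a, b]).
    rewrite /inner; under eq_Rintegral do rewrite -expr2 indic_sqr.
    by rewrite /Rintegral int_indic_itv.
  rewrite -EFinM abse_EFin lee_fin ger0_norm ?sqr_ge0//.
  exact: cauchy_schwarz.
have sF : sqint P (time_integral a b f).
  split=> //; apply/integrableP; split.
    by apply/measurable_EFinP; exact: measurable_funX.
  have mG : measurable_fun setT (fun w => \int[leb1]_t `|(f (w, t) ^+ 2)%:E|)%E.
    apply: (measurable_fun_fubini_tonelli_F (fun q => `|(f q ^+ 2)%:E|%E)) => //.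
    by apply: measurableT_comp => //; apply/measurable_EFinP; exact: measurable_funX.
  apply: (@le_lt_trans _ _
      (\int[P]_w (\int[leb1]_t `|(f (w, t) ^+ 2)%:E| * (b - a)%:E))%E).
    apply: ae_ge0_le_integral => //.
    - by apply: measurableT_comp => //; apply/measurable_EFinP; exact: measurable_funX.
    - by move=> w _; rewrite mule_ge0 ?integral_ge0// lee_fin subr_ge0.
    - by apply: emeasurable_funM.
    - by apply: filterS F2 => w + _.
  rewrite ge0_integralZr//; last 2 first.
    by move=> w _; exact: integral_ge0.
    by rewrite lee_fin subr_ge0.
  rewrite muleC lte_mul_pinfty ?lee_fin ?subr_ge0//.
  exact: ((rint_prodP (measurable_funX 2 mf)).1 If).
split=> // xi sxi.
have Ifx := sqint_mul sf (sqint_tensor ab sxi).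
rewrite /inner /Rintegral -(integral12_prod_meas1 Ifx) /fubini_F.
congr fine; apply: ae_eq_integral => //.
- apply/measurable_EFinP; apply: measurable_funM => //.
  by case: sxi.
- exact: measurable_fubini_F Ifx.
apply: filterS ae1 => w Iw _ /=.
under [in RHS]eq_integral do rewrite tensorE.
have hE : (fun t : R => (f (w, t) * \1_(`[a, b]%classic : set R) t)%:E) =
    ((fun t => (f (w, t))%:E) \_ `[a, b]%classic : R -> \bar R).
  apply/funext => t; rewrite indicE patchE; case: ifPn => _; rewrite ?mulr1//.
  by rewrite mulr0.
have Iw' : leb1.-integrable setT (fun t : R => (f (w, t) * \1_(`[a, b]%classic : set R) t)%:E).
  by rewrite hE; exact: ((@integrable_mkcond _ _ _ leb1 `[a, b]%classic _ (measurable_itv _)).1 Iw).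
rewrite integralZl// hE -integral_mkcond /time_integral /Rintegral EFinM muleC.
by rewrite fineK//; exact: integrable_fin_num.
Qed.

End time_integrals.

(** * The Ito integral of scalar processes *)

Section ito_integral_of_simple_processes.
Context {dO : measure_display} {Omega : measurableType dO} {R : realType}.
Variables (P : probability Omega R) (T : R) (W : R -> Omega -> R).
Hypothesis hP : measure_is_complete P.
Hypothesis hW : wiener_process P T W.
Notation leb1 := (@lebesgue_measure R).
Notation M := (P \x leb1)%E.
Implicit Types (m : nat) (s : nat -> R) (x : nat -> Omega -> R) (xi : Omega -> R) (a b t u v : R).

(** The value at time t of the scalar simple process with nodes s and
    coefficients x. *)
Definition simple_value m s x t w : R := \sum_(i < m | s i < t <= s i.+1) x i w.

(** The Ito integral up to time t of this simple process. *)
Definition simple_ito m s x t w : R :=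
  \sum_(i < m) increment W (Num.min (s i) t) (Num.min (s i.+1) t) w * x i w.

(** Bounded adapted simple processes. *)
Definition scalar_simple m s x :=
  [/\ forall i, (i <= m)%N -> 0 <= s i <= T,
      forall i, (i < m)%N -> s i <= s i.+1,
      forall i, (i < m)%N -> Fmeas P W (s i) (x i) &
      forall i, (i < m)%N -> exists C : R, forall w, `|x i w| <= C].

(** The projection of the line onto [a, b]; it turns the part on [a, b] of a
    simple process into a simple process with nodes in [a, b]. *)
Definition clamp a b u := Num.min (Num.max u a) b.

Lemma clamp_ge a b u : a <= b -> a <= clamp a b u.
Proof. by move=> ab; rewrite /clamp le_min le_max lexx orbT. Qed.

Lemma clamp_le a b u : clamp a b u <= b.
Proof. by rewrite /clamp ge_min lexx orbT. Qed.

Lemma clamp_mono a b u v : u <= v -> clamp a b u <= clamp a b v.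
Proof.
move=> uv; rewrite /clamp le_min !ge_min ge_max !le_max uv lexx !orbT /=.
by rewrite lexx !orbT.
Qed.

Lemma clamp_lt a b u : clamp a b u < b -> u <= clamp a b u.
Proof.
rewrite /clamp minEle; case: ifPn => [_ _|_]; last by rewrite ltxx.
by rewrite le_max lexx.
Qed.

Lemma increment_clamp a b u v w : a <= b ->
  increment W (Num.min u b) (Num.min v b) w -
  increment W (Num.min u a) (Num.min v a) w =
  increment W (clamp a b u) (clamp a b v) w.
Proof.
move=> ab.
have key u' : W (Num.min u' b) w - W (Num.min u' a) w = W (clamp a b u') w - W a w.
  rewrite /clamp; have [ua|au] := leP u' a.
    by rewrite !min_l// ?subrr// (le_trans ua).
  by [].
by have := key u; have := key v; rewrite /increment; lra.
Qed.

Lemma sint_incr m s x a b w : a <= b ->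
  simple_ito m s x b w - simple_ito m s x a w =
  \sum_(i < m) increment W (clamp a b (s i)) (clamp a b (s i.+1)) w * x i w.
Proof.
move=> ab; rewrite /simple_ito -sumrB; apply: eq_bigr => i _.
by rewrite -mulrBl increment_clamp.
Qed.

Lemma sqint_bounded xi (C : R) : measurable_fun setT xi ->
  (forall w, `|xi w| <= C) -> sqint P xi.
Proof.
move=> mxi xiC; split=> //.
apply: (@rint_le _ _ _ P _ (fun=> C ^+ 2)).
- exact: measurable_funX.
- move=> w; rewrite ger0_norm ?sqr_ge0// -(real_normK (num_real (xi w))).
  by rewrite lerXn2r ?nnegrE// (le_trans _ (xiC w)).
- exact: finite_measure_integrable_cst.
Qed.

Section one_term.
Variables (a b : R) (xi : Omega -> R).
Hypotheses (a0 : 0 <= a) (ab : a <= b) (bT : b <= T).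
Hypotheses (fxi : Fmeas P W a xi) (sxi : sqint P xi).

(** One term of a simple integral over [a, b], with nodes c and d in [a, b],
    against random variables known at time a. *)
Lemma sint_term m s x i : scalar_simple m s x -> (i < m)%N ->
  let c := clamp a b (s i) in let d := clamp a b (s i.+1) in
  [/\ sqint P (fun w => increment W c d w * x i w),
      inner P (fun w => increment W c d w * x i w) xi = 0 &
      inner P (fun w => increment W c d w * x i w)
              (fun w => increment W a b w * xi w) = (d - c) * inner P (x i) xi].
Proof.
move=> [sT smono sF sB] im c d.
have ac : a <= c by exact: clamp_ge.
have db : d <= b by exact: clamp_le.
have cd : c <= d by apply: clamp_mono; exact: smono.
have c0 : 0 <= c by exact: le_trans ac.
have dT : d <= T by exact: le_trans bT.
have siT : s i <= T by case/andP : (sT i (ltnW im)).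
have [C xC] := sB i im.
have sx : sqint P (x i).
  by apply: sqint_bounded xC; apply: (Fmeas_measurable hP hW siT); exact: sF.
have [cd_eq|cd_lt] : c = d \/ c < d by move: cd; rewrite le_eqVlt => /predU1P.
  rewrite -cd_eq subrr mul0r.
  have -> : (fun w => increment W c c w * x i w) = (fun=> 0).
    by apply/funext => w; rewrite /increment subrr mul0r.
  split; first exact: sqint0.
  - by rewrite /inner; under eq_Rintegral do rewrite mul0r; exact: Rint_zero.
  - by rewrite /inner; under eq_Rintegral do rewrite mul0r; exact: Rint_zero.
have sic : s i <= c by apply: clamp_lt; exact: lt_le_trans db.
have fx : Fmeas P W c (x i) by apply: Fmeas_mono sic _; exact: sF.
have fxic : Fmeas P W c xi by exact: Fmeas_mono ac _.
have fxx : Fmeas P W c (fun w => x i w * xi w) by exact: measurable_funM.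
have Ixx := sqint_mul sx sxi.
have scd : sqint P (fun w => increment W c d w * x i w).
  exact: (sqint_increment hP hW c0 cd dT fx sx).
have [I1 E1] := expectation_increment hP hW c0 cd dT fxx Ixx.
have [I2 E2] := expectation_increment_sqr hP hW c0 cd dT fxx Ixx.
split=> //.
  by rewrite -[RHS]E1; apply: eq_Rintegral => w _; rewrite mulrA.
(* the increment over [a, b] is cut at c and d: of the three products, only the
   square of the increment over [c, d] has a nonzero expectation *)
have cT : c <= T by exact: le_trans cd dT.
have aT : a <= T by exact: le_trans ab bT.
have sac : sqint P (fun w => increment W a c w * xi w).
  exact: (sqint_increment hP hW a0 ac cT fxi sxi).
have fac : Fmeas P W c (fun w => x i w * (increment W a c w * xi w)).
  apply: measurable_funM => //; apply: measurable_funM => //.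
  exact: Fmeas_increment.
have [I3 E3] := expectation_increment hP hW c0 cd dT fac (sqint_mul sx sac).
have fdb : Fmeas P W d (fun w => (increment W c d w * x i w) * xi w).
  apply: measurable_funM; last exact: Fmeas_mono cd fxic.
  apply: measurable_funM; last exact: Fmeas_mono cd fx.
  exact: Fmeas_increment.
have d0 : 0 <= d by exact: le_trans c0 cd.
have [I4 E4] := expectation_increment hP hW d0 db bT fdb (sqint_mul scd sxi).
rewrite -[RHS]addr0 -E4 -[in RHS]E2 -[LHS]/(\int[P]_w _).
rewrite -[RHS]add0r -[in X in _ = X + _]E3.
rewrite -RintD// -RintD//; last exact: rintD.
by apply: eq_Rintegral => w _; rewrite /increment; ring.
Qed.

End one_term.

Lemma sqint_sint m s x t : scalar_simple m s x -> 0 <= t <= T ->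
  sqint P (simple_ito m s x t).
Proof.
move=> sx /andP[t0 tT].
have z0 w : simple_ito m s x 0 w = 0.
  rewrite /simple_ito big1// => i _; case: sx => sT _ _ _.
  have /andP[si0 _] := sT i (ltnW (ltn_ord i)).
  have /andP[sj0 _] := sT i.+1 (ltn_ord i).
  by rewrite !min_r// /increment subrr mul0r.
have -> : simple_ito m s x t = fun w => \sum_(i < m)
    increment W (clamp 0 t (s i)) (clamp 0 t (s i.+1)) w * x i w.
  by apply/funext => w; rewrite -sint_incr// z0 subr0.
apply: sqint_sum => i _.
have f0 : Fmeas P W 0 (fun=> 0) by exact: measurable_cst.
by have [] := sint_term (lexx 0) t0 tT f0 (sqint0 P) sx (ltn_ord i).
Qed.

Lemma sint_orthogonal m s x a b xi : scalar_simple m s x ->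
  0 <= a -> a <= b -> b <= T -> Fmeas P W a xi -> sqint P xi ->
  inner P (fun w => simple_ito m s x b w - simple_ito m s x a w) xi = 0.
Proof.
move=> sx a0 ab bT fxi sxi.
under [X in inner P X]eq_fun do rewrite sint_incr//.
rewrite inner_suml//; last first.
  by move=> i _; have [] := sint_term a0 ab bT fxi sxi sx (ltn_ord i).
by apply: big1 => i _; have [] := sint_term a0 ab bT fxi sxi sx (ltn_ord i).
Qed.

Lemma sint_isometry m s x a b xi : scalar_simple m s x ->
  0 <= a -> a <= b -> b <= T -> Fmeas P W a xi -> sqint P xi ->
  inner P (fun w => simple_ito m s x b w - simple_ito m s x a w)
          (fun w => increment W a b w * xi w) =
  \sum_(i < m) (clamp a b (s i.+1) - clamp a b (s i)) * inner P (x i) xi.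
Proof.
move=> sx a0 ab bT fxi sxi.
under [X in inner P X]eq_fun do rewrite sint_incr//.
rewrite inner_suml//.
- by apply: eq_bigr => i _; have [] := sint_term a0 ab bT fxi sxi sx (ltn_ord i).
- by move=> i _; have [] := sint_term a0 ab bT fxi sxi sx (ltn_ord i).
- exact: (sqint_increment hP hW).
Qed.

(** A simple process as a function on the product of the probability space and
    the time axis. *)
Definition svalM m s x : Omega * measurableTypeR R -> R := fun q => simple_value m s x q.2 q.1.

Let svalM_term s x i : Omega * measurableTypeR R -> R :=
  fun q => x i q.1 * \1_(`]s i, s i.+1]%classic : set (measurableTypeR R)) q.2.

Let svalME m s x : svalM m s x = fun q => \sum_(i < m) svalM_term s x i q.
Proof.
apply/funext => -[w t]; rewrite /svalM /simple_value /svalM_term/= big_mkcond/=.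
apply: eq_bigr => i _; rewrite indicE.
case: ifPn => h.
  by rewrite mem_set ?mulr1//= in_itv.
by rewrite memNset ?mulr0//= in_itv/=; exact/negP.
Qed.

Let sqint_svalM_term m s x i : scalar_simple m s x -> (i < m)%N ->
  sqint P (x i) /\ sqint M (svalM_term s x i).
Proof.
move=> [sT smono sF sB] im.
have siT : s i <= T by case/andP : (sT i (ltnW im)).
have [C xC] := sB i im.
have sx : sqint P (x i).
  by apply: sqint_bounded xC; apply: (Fmeas_measurable hP hW siT); exact: sF.
split=> //.
apply: sqint_le (sqint_tensor (smono i im) sx).
  apply: measurable_funM.
    by apply: measurableT_comp; [exact: sx.1|exact: measurable_fst].
  by apply: measurableT_comp; [exact: measurable_indic|exact: measurable_snd].
move=> [w t]; rewrite /svalM_term /tensor/= !normrM ler_wpM2l// !indicE.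
case: (boolP (t \in `]s i, s i.+1]%classic)) => [|_]; last by rewrite normr0.
rewrite inE/= in_itv/= => /andP[/ltW h1 h2].
by rewrite mem_set//= in_itv/= h1.
Qed.

Lemma sqint_svalM m s x : scalar_simple m s x -> sqint M (svalM m s x).
Proof.
move=> sx; rewrite svalME; apply: sqint_sum => i _.
by have [] := sqint_svalM_term sx (ltn_ord i).
Qed.

Let integrable_indic_seg a b (E : set (measurableTypeR R)) : measurable E ->
  leb1.-integrable `[a, b] (fun t : R => (\1_E t)%:E).
Proof.
move=> mE; apply/integrableP; split.
  by apply/measurable_EFinP; exact: measurable_indic.
under eq_integral do rewrite gee0_abs ?lee_fin//.
rewrite integral_indic//.
apply: (@le_lt_trans _ _ (leb1 `[a, b])).
  by apply: le_measure; rewrite ?inE//=; exact: measurableI.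
by rewrite lebesgue_measure_itv/=; case: ifPn => // _; rewrite -EFinB ltry.
Qed.

Let int_itvNyc a b u : a <= b ->
  \int[leb1]_(t in `[a, b]) \1_(`]-oo, u]%classic : set R) t = clamp a b u - a.
Proof.
move=> ab; rewrite /Rintegral integral_indic//=.
have [ua|au] := ltP u a.
  rewrite /clamp max_r ?ltW// min_l// subrr (_ : _ `&` _ = set0) ?measure0//.
  apply/seteqP; split=> // t [/=]; rewrite !in_itv/= => tu /andP[a_t _].
  by have := lt_le_trans (le_lt_trans tu ua) a_t; rewrite ltxx.
have -> : `]-oo, u]%classic `&` `[a, b]%classic = `[a, clamp a b u]%classic :> set R.
  rewrite /clamp max_l//.
  apply/seteqP; split=> t /=; rewrite !in_itv/= le_min.
    by move=> [-> /andP[-> ->]].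
  by move=> /and3P[-> -> ->].
rewrite lebesgue_measure_itv/= lte_fin.
have := clamp_ge u ab; rewrite le_eqVlt => /predU1P[<-|->//].
by rewrite ltxx subrr.
Qed.

Let int_itv_oc a b u v : a <= b -> u <= v ->
  \int[leb1]_(t in `[a, b]) \1_(`]u, v]%classic : set R) t = clamp a b v - clamp a b u.
Proof.
move=> ab uv.
have I r : leb1.-integrable `[a, b] (fun t : R => (\1_(`]-oo, r]%classic : set R) t)%:E).
  exact: integrable_indic_seg.
transitivity (\int[leb1]_(t in `[a, b]) (\1_(`]-oo, v]%classic : set R) t - \1_(`]-oo, u]%classic : set R) t)).
  apply: eq_Rintegral => t _; rewrite !indicE.
  have e : forall A : set R, forall B : bool, A t = B -> t \in A = B.
    by move=> A B AB; apply/idP/idP; rewrite inE AB.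
  rewrite (e `]u, v]%classic (u < t <= v)) ?(e `]-oo, u]%classic (t <= u)) ?(e `]-oo, v]%classic (t <= v)); rewrite /= ?in_itv//.
  have [tu|ut] := leP t u; last by rewrite subr0.
  by rewrite (le_trans tu uv) subrr.
have Ev := int_itvNyc v ab; have Eu := int_itvNyc u ab.
rewrite RintegralB//; [|exact: I|exact: I].
transitivity (clamp a b v - a - (clamp a b u - a)); last by lra.
by congr (_ - _).
Qed.

Lemma svalM_tensor m s x a b xi : scalar_simple m s x -> a <= b -> sqint P xi ->
  inner M (svalM m s x) (tensor xi a b) =
  \sum_(i < m) (clamp a b (s i.+1) - clamp a b (s i)) * inner P (x i) xi.
Proof.
move=> sx ab sxi; rewrite svalME inner_suml; first last.
- exact: sqint_tensor.
- by move=> i _; have [] := sqint_svalM_term sx (ltn_ord i).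
apply: eq_bigr => i _.
have [sxi_ sM] := sqint_svalM_term sx (ltn_ord i).
have [_ _ <-//] := time_integralP ab sM.
rewrite -innerZl//; apply: eq_Rintegral => w _; congr (_ * _).
rewrite /time_integral /svalM_term/= RintegralZl//.
  have sle : s i <= s i.+1 by case: sx => _ + _ _; apply.
  by rewrite [RHS]mulrC; congr (_ * _); exact: int_itv_oc ab sle.
exact: integrable_indic_seg.
Qed.

End ito_integral_of_simple_processes.

Section ito_integral.
Context {dO : measure_display} {Omega : measurableType dO} {R : realType}.
Variables (P : probability Omega R) (T : R) (W : R -> Omega -> R).
Hypothesis hP : measure_is_complete P.
Hypothesis hW : wiener_process P T W.
Notation leb1 := (@lebesgue_measure R).
Notation M := (P \x leb1)%E.
Variables (m : nat -> nat) (s : nat -> nat -> R) (x : nat -> nat -> Omega -> R).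
Variables (a b : R) (Ja Jb xi : Omega -> R).
Hypotheses (a0 : 0 <= a) (ab : a <= b) (bT : b <= T).
Hypothesis simp : forall k, scalar_simple P T W (m k) (s k) (x k).
Hypotheses (sJa : sqint P Ja) (sJb : sqint P Jb).
Hypothesis cJa : inner P (fun w => simple_ito W (m k) (s k) (x k) a w - Ja w)
  (fun w => simple_ito W (m k) (s k) (x k) a w - Ja w) @[k --> \oo] --> (0 : R).
Hypothesis cJb : inner P (fun w => simple_ito W (m k) (s k) (x k) b w - Jb w)
  (fun w => simple_ito W (m k) (s k) (x k) b w - Jb w) @[k --> \oo] --> (0 : R).
Hypotheses (fxi : Fmeas P W a xi) (sxi : sqint P xi).

Let sa k : sqint P (simple_ito W (m k) (s k) (x k) a).
Proof. by apply: (sqint_sint hP hW) => //; rewrite a0 (le_trans ab). Qed.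

Let sb k : sqint P (simple_ito W (m k) (s k) (x k) b).
Proof. by apply: (sqint_sint hP hW) => //; rewrite bT (le_trans a0). Qed.

Let limit (eta : Omega -> R) : sqint P eta ->
  inner P (fun w => simple_ito W (m k) (s k) (x k) b w - simple_ito W (m k) (s k) (x k) a w) eta
    @[k --> \oo] --> inner P (fun w => Jb w - Ja w) eta.
Proof.
move=> seta.
under eq_fun do rewrite innerBl//.
rewrite innerBl//; apply: cvgB.
  exact: inner_cvg cJb.
exact: inner_cvg cJa.
Qed.

(** The increments of the Ito integral are orthogonal to the past. *)
Lemma ito_orthogonal : inner P (fun w => Jb w - Ja w) xi = 0.
Proof.
have c := limit sxi; apply: (cvg_unique (@norm_hausdorff _ _) c).
apply: cvg_near_cst; apply: nearW => k.
exact: (sint_orthogonal hP hW).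
Qed.

(** Ito isometry, against the increment of the Wiener process. *)
Lemma ito_isometry (z : Omega * measurableTypeR R -> R) : sqint M z ->
  inner M (fun q => svalM (m k) (s k) (x k) q - z q)
    (fun q => svalM (m k) (s k) (x k) q - z q) @[k --> \oo] --> (0 : R) ->
  inner P (fun w => Jb w - Ja w) (fun w => increment W a b w * xi w) =
  inner P (time_integral a b z) xi.
Proof.
move=> sz cz.
have sWxi := sqint_increment hP hW a0 ab bT fxi sxi.
have c := limit sWxi; apply: (cvg_unique (@norm_hausdorff _ _) c).
have [_ _ ->//] := time_integralP ab sz.
have c2 := inner_cvg (fun k => sqint_svalM hP hW (simp k)) sz (sqint_tensor ab sxi) cz.
apply: cvg_trans c2; apply: near_eq_cvg; apply: nearW => k.
rewrite (svalM_tensor hP hW)//; apply/esym.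
exact: (sint_isometry hP hW).
Qed.

End ito_integral.

(** * Square integrable functions on a domain *)

Section euclidean_measurability.
Context {R : realType} {d : nat}.
Implicit Types (D O : set 'rV[R]_d) (x y c : 'rV[R]_d) (e : R).
Notation tup := (d.-tuple (measurableTypeR R)).
Local Notation row := (@row_of_tuple R d).

(** Cubes with rational center and radius, a countable basis of the topology. *)
Definition qcube (k : {ffun 'I_d -> rat} * rat) : set 'rV[R]_d :=
  [set y | forall i, `|y 0 i - ratr (k.1 i)| < ratr k.2].

Definition qcube_closed (k : {ffun 'I_d -> rat} * rat) : set 'rV[R]_d :=
  [set y | forall i, `|y 0 i - ratr (k.1 i)| <= ratr k.2].

Lemma open_qcube O x : open O -> O x ->
  exists k, [/\ 0 < ratr k.2 :> R, qcube k x & qcube_closed k `<=` O].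
Proof.
move=> oO Ox.
have /nbhs_ballP[e /= e0 xeO] : nbhs x O by exact: open_nbhs_nbhs.
have e3 : 0 < e / 3 by rewrite divr_gt0.
have [q] := rat_in_itvoo e3; rewrite in_itv/= => /andP[q0 qe].
have cP i : exists c : rat, `|x 0 i - ratr c| < ratr q.
  have : x 0 i < x 0 i + ratr q by rewrite ltrDl.
  move=> /rat_in_itvoo[r]; rewrite in_itv/= => /andP[h1 h2]; exists r.
  by rewrite ltr_distlC; apply/andP; split; lra.
pose c := [ffun i => sval (cid (cP i))] : {ffun 'I_d -> rat}.
have cP' i : `|x 0 i - ratr (c i)| < ratr q.
  by rewrite /c ffunE; case: cid.
exists (c, q); split=> // y /= yc; apply: xeO; split=> // i j.
rewrite (ord1 i) /ball/=.
have := yc j; have := cP' j; rewrite !ltr_distlC !ler_distlC.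
by move=> /andP[h1 h2] /andP[h3 h4]; apply/andP; split; lra.
Qed.

Lemma qcube_meas k : measurable (row @^-1` qcube k : set tup).
Proof.
have -> : row @^-1` qcube k = \bigcap_(i in [set: 'I_d])
    ((fun t : tup => tnth t i) @^-1` [set y : R | `|y - ratr (k.1 i)| < ratr k.2]).
  apply/seteqP; split=> t /= h i; first by move=> _; have := h i; rewrite /row_of_tuple mxE.
  by have := h i I; rewrite /row_of_tuple mxE.
apply: fin_bigcap_measurable; first exact: finite_finset.
move=> i _; rewrite -[X in measurable X]setTI; apply: measurable_tnth => //.
have -> : [set y : R | `|y - ratr (k.1 i)| < ratr k.2] =
    `]ratr (k.1 i) - ratr k.2, ratr (k.1 i) + ratr k.2[%classic.
  by apply/seteqP; split=> y /=; rewrite in_itv/= ltr_distl.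
exact: measurable_itv.
Qed.

(** Open sets are measurable: they are countable unions of rational cubes. *)
Lemma open_row_meas O : open O -> measurable (row @^-1` O : set tup).
Proof.
move=> oO.
have -> : row @^-1` O = \bigcup_(k : {ffun 'I_d -> rat} * rat)
    (if `[< qcube k `<=` O >] then row @^-1` qcube k else set0).
  apply/seteqP; split=> [t Ot|t [k _]]; last by case: asboolP => // + kt; exact.
  have [k [k0 kt kO]] := open_qcube oO Ot.
  exists k => //; case: asboolP => // h; exfalso; apply: h.
  by move=> y ky; apply: kO => i; exact/ltW/ky.
apply: countable_bigcupT_measurable; first exact: countableP.
by move=> k; case: asboolP => // _; exact: qcube_meas.
Qed.

Lemma continuous_row_meas (f : 'rV[R]_d -> R) : continuous f ->
  measurable_fun setT (fun t : tup => f (row t)).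
Proof.
move=> /continuousP cf.
apply: (measurability _ (RGenOInfty.measurableE R)) => //.
move=> _ [_ [a ->] <-]; rewrite setTI; apply: (open_row_meas (O := f @^-1` `]a, +oo[)).
exact/cf/interval_open.
Qed.

(** The extension by zero of u, transported to tuples, on which the Lebesgue
    measure is defined. *)
Definition ext D (u : 'rV[R]_d -> R) : tup -> R := (u \_ D) \o row.

Lemma extE D u t : ext D u t = if row t \in D then u (row t) else 0.
Proof. by rewrite /ext/= patchE. Qed.

Lemma extD D u v : ext D (u + v) = fun t => ext D u t + ext D v t.
Proof. by apply/funext => t; rewrite !extE; case: ifP => //; rewrite addr0. Qed.

Lemma extZ D a u : ext D (a *: u) = fun t => a * ext D u t.
Proof. by apply/funext => t; rewrite !extE; case: ifP => //; rewrite mulr0. Qed.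

Lemma ip_inner D u v : ip D u v = inner (leb d) (ext D u) (ext D v).
Proof.
rewrite /ip Rintegral_mkcond; apply: eq_Rintegral => t _; rewrite !extE patchE.
have -> : (t \in row @^-1` D) = (row t \in D) by apply/idP/idP; rewrite !inE.
by case: ifP => //; rewrite mulr0.
Qed.

End euclidean_measurability.

Section L2_of_a_domain.
Context {dT : measure_display} {T : measurableType dT} {R : realType}.
Variable mu : {measure set T -> \bar R}.

Lemma Lfun2_sqint (f : T -> R) : f \in Lfun mu 2%:E <-> sqint mu f.
Proof.
split=> [f2|[mf If]].
  split; last exact: Lfun2_integrable_sqr.
  by move: f2; rewrite inE => /andP[]; rewrite inE.
rewrite inE; apply/andP; split; rewrite inE//= /finite_norm unlock.
apply: poweR_lty; case/integrableP : If => _; apply: le_lt_trans.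
rewrite le_eqVlt; apply/orP; left; apply/eqP; apply: eq_integral => t _ /=.
by rewrite normrX powR_mulrn.
Qed.

End L2_of_a_domain.

Section inner_product.
Context {R : realType} {d : nat}.
Implicit Types (D : set 'rV[R]_d) (u v w : 'rV[R]_d -> R).

Lemma L2_sqint D u : L2 D u <-> sqint (leb d) (ext D u).
Proof. exact: Lfun2_sqint. Qed.

Lemma L2D D u v : L2 D u -> L2 D v -> L2 D (u + v).
Proof. by move=> /L2_sqint su /L2_sqint sv; apply/L2_sqint; rewrite extD; exact: sqintD. Qed.

Lemma L2Z D a u : L2 D u -> L2 D (a *: u).
Proof. by move=> /L2_sqint su; apply/L2_sqint; rewrite extZ; exact: sqintZ. Qed.

Lemma L2N D u : L2 D u -> L2 D (- u).
Proof. by rewrite -scaleN1r; exact: L2Z. Qed.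

Lemma L2B D u v : L2 D u -> L2 D v -> L2 D (u - v).
Proof. by move=> Lu Lv; apply: L2D => //; exact: L2N. Qed.

Lemma ipC D u v : ip D u v = ip D v u.
Proof. by rewrite !ip_inner innerC. Qed.

Lemma ipDl D u v w : L2 D u -> L2 D v -> L2 D w -> ip D (u + v) w = ip D u w + ip D v w.
Proof. by move=> /L2_sqint ? /L2_sqint ? /L2_sqint ?; rewrite !ip_inner extD innerDl. Qed.

Lemma ipZl D a u w : L2 D u -> L2 D w -> ip D (a *: u) w = a * ip D u w.
Proof. by move=> /L2_sqint ? /L2_sqint ?; rewrite !ip_inner extZ innerZl. Qed.

Lemma ipNl D u w : L2 D u -> L2 D w -> ip D (- u) w = - ip D u w.
Proof. by move=> Lu Lw; rewrite -scaleN1r ipZl// mulN1r. Qed.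

Lemma ipBl D u v w : L2 D u -> L2 D v -> L2 D w -> ip D (u - v) w = ip D u w - ip D v w.
Proof. by move=> Lu Lv Lw; rewrite ipDl ?ipNl//; exact: L2N. Qed.

Lemma ip_ge0 D u : 0 <= ip D u u.
Proof. by rewrite ip_inner inner_ge0. Qed.

Lemma ip_norm_le D u v : L2 D u -> L2 D v -> `|ip D u v| <= L2norm D u * L2norm D v.
Proof.
by move=> /L2_sqint ? /L2_sqint ?; rewrite /L2norm !ip_inner inner_norm_le.
Qed.

Lemma ip_ae D u u' v : measurable_fun setT (ext D u) -> measurable_fun setT (ext D u') ->
  L2 D v -> {ae leb d, forall t, ext D u t = ext D u' t} -> ip D u v = ip D u' v.
Proof.
by move=> mu mu' /L2_sqint[mv _] uu'; rewrite !ip_inner; apply: inner_ae => //; exact: aeW.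
Qed.

End inner_product.

(** * Smooth functions with compact support *)

Section flat_functions.
Context {R : realType}.
Implicit Types (x y t : R) (n : nat).

(** The functions y |-> y^-n exp(-1/y), extended by 0 to y <= 0; the family is
    closed under differentiation, up to linear combinations. *)
Definition flat n y : R := if 0 < y then y^-1 ^+ n * expR (- y^-1) else 0.

Lemma pow_expRN_le n t : 0 <= t -> t ^+ n * expR (- t) <= n%:R ^+ n.
Proof.
move=> t0; rewrite expRN -ler_pdivlMr ?invr_gt0 ?expR_gt0// invrK.
case: n => [|n]; first by rewrite !expr0 mul1r -expR0 ler_expR.
have n0 : (0 : R) < n.+1%:R by rewrite ltr0n.
have -> : expR t = expR (t / n.+1%:R) ^+ n.+1.
  by rewrite -expRM_natl mulrCA divff ?mulr1// gt_eqF.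
rewrite -exprMn lerXn2r ?nnegrE ?mulr_ge0 ?ler0n ?expR_ge0//.
rewrite mulrC -ler_pdivrMr//.
by apply: le_trans (expR_ge1Dx _); rewrite lerDr.
Qed.

Lemma flat_ge0 n y : 0 <= flat n y.
Proof. by rewrite /flat; case: ltP => // y0; rewrite mulr_ge0 ?expR_ge0 ?exprn_ge0 ?invr_ge0 ?ltW. Qed.

Lemma flat_le n y : flat n y <= n%:R ^+ n.
Proof.
rewrite /flat; case: ltP => y0; last exact: exprn_ge0.
by apply: pow_expRN_le; rewrite invr_ge0 ltW.
Qed.

Lemma flat0_lt1 y : flat 0 y <= 1.
Proof. by rewrite (le_trans (flat_le 0 y))// expr0. Qed.

Lemma flatS n y : 0 < y -> y^-1 * flat n y = flat n.+1 y.
Proof. by move=> y0; rewrite /flat y0 mulrA exprS. Qed.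

Lemma is_derive_flat n y :
  is_derive y (1 : R) (flat n) (- n%:R * flat n.+1 y + flat n.+2 y).
Proof.
have [y0|y0|->] := ltgtP y 0.
- have -> : - n%:R * flat n.+1 y + flat n.+2 y = 0.
    by rewrite /flat ltNge (ltW y0)/= mulr0 addr0.
  apply: (near_eq_is_derive (f := cst 0)).
  near=> z; rewrite /flat ltNge ltW//.
  by near: z; exact: lt_nbhsl.
- have dV : is_derive y (1 : R) (fun z : R => z^-1) (- y ^- 2).
    have := @is_deriveV R id y 1 1 _ (is_derive_id _ _).
    by rewrite /GRing.scale/= mulr1; apply; rewrite gt_eqF.
  have dE : is_derive y (1 : R) (fun z : R => expR (- z^-1)) (expR (- y^-1) * - (- y ^- 2)).
    have dN : is_derive y (1 : R) (fun z : R => - z^-1) (- - y ^- 2).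
      exact: (is_deriveN dV).
    exact: (@is_derive1_comp _ expR (fun z => - z^-1) y _ _ (is_derive_expR _) dN).
  have dX : is_derive y (1 : R) (fun z : R => z^-1 ^+ n) (n%:R * y^-1 ^+ n.-1 * - y ^- 2).
    have := @is_deriveX _ _ (fun z : R => z^-1) n y 1 _ dV.
    by rewrite /GRing.scale/= exprfctE.
  have dM := is_deriveM dX dE.
  apply: (near_eq_is_derive (f := (fun z : R => z^-1 ^+ n) * (fun z : R => expR (- z^-1)))).
    near=> z; rewrite /flat (_ : 0 < z)//.
    by near: z; exact: lt_nbhsr.
  apply: is_derive_eq.
  rewrite /flat y0 /GRing.scale/= -exprVn !exprS.
  by case: n {dX dM} => [|n] /=; rewrite ?exprS; ring.
- have -> : - n%:R * flat n.+1 0 + flat n.+2 0 = 0 :> R.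
    by rewrite /flat ltxx mulr0 addr0.
  (* for h > 0, the quotient is flat n.+1 h = h * flat n.+2 h = O(h) *)
  have c : h^-1 *: ((flat n \o shift 0) (h *: 1) - flat n 0) @[h --> (0 : R)^'] --> (0 : R).
    apply/norm_cvg0P.
    have C0 : (n.+2%:R ^+ n.+2 : R) * `|h| @[h --> (0 : R)^'] --> (0 : R).
      rewrite -[X in _ --> X](mulr0 (n.+2%:R ^+ n.+2)); apply: cvgMr.
      apply/norm_cvg0P; apply: cvg_trans (@cvg_id _ (nbhs (0 : R))).
      exact: cvg_within.
    apply: (squeeze_cvgr _ (@cvg_cst _ _ _ _ _) C0).
    near=> h; rewrite normr_ge0/= addr0.
    rewrite {2}/flat ltxx subr0 /GRing.scale/= mulr1.
    have [h0|h0] := ltP 0 h; last first.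
      by rewrite /flat ltNge h0/= mulr0 normr0 mulr_ge0 ?exprn_ge0.
    rewrite flatS// ger0_norm ?flat_ge0// gtr0_norm// -ler_pdivrMr//.
    by rewrite mulrC flatS// flat_le.
  by apply: DeriveDef; [apply/cvg_ex; exists 0|exact: cvg_lim c].
Unshelve. all: by end_near. Qed.

Lemma flat_continuous n : continuous (flat n).
Proof.
move=> y; apply/differentiable_continuous/derivable1_diffP.
by have [] := is_derive_flat n y.
Qed.

Lemma flat0_cvg1 y : 0 < y -> flat 0 (k%:R * y) @[k --> \oo] --> (1 : R).
Proof.
move=> y0.
have c : expR (- (y^-1 * k%:R^-1)) @[k --> \oo] --> (1 : R).
  rewrite -[X in _ --> X]expR0; apply: (continuous_cvg _ (@continuous_expR R 0)).
  rewrite -oppr0; apply: cvgN; rewrite -[X in _ --> X](mulr0 y^-1); apply: cvgMr.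
  by apply/gtr0_cvgV0; [near=> k; rewrite ltr0n; near: k; exact: nbhs_infty_gt|exact: cvgr_idn].
apply: cvg_trans c; apply: near_eq_cvg; near=> k.
have k0 : (0 : R) < k%:R by rewrite ltr0n; near: k; exact: nbhs_infty_gt.
by rewrite /flat mulr_gt0// expr0 mul1r invfM mulrC.
Unshelve. all: by end_near. Qed.

End flat_functions.

Section Ck_calculus.
Context {R : realType} {d : nat}.
Implicit Types (u v : 'rV[R]_d -> R) (i j : 'I_d) (k : nat).

Lemma Ck_continuous k u : Ck k u -> continuous u.
Proof. by case: k => [|k] []. Qed.

Lemma Ck_pred k u : Ck k.+1 u -> Ck k u.
Proof.
elim: k u => [|k IH] u [cu du]; first by [].
by split=> // i; have [h1 h2] := du i; split=> //; exact: IH.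
Qed.

Lemma CkD k u v : Ck k u -> Ck k v -> Ck k (u + v).
Proof.
elim: k u v => [|k IH] u v [cu du] [cv dv]; split=> //.
- by move=> x; exact: continuousD (cu x) (cv x).
- by move=> x; exact: continuousD (cu x) (cv x).
move=> i; have [du1 du2] := du i; have [dv1 dv2] := dv i; split.
  by move=> x; apply: derivableD.
have -> : partial i (u + v) = partial i u + partial i v.
  by apply/funext => x; rewrite /partial deriveD.
exact: IH.
Qed.

Lemma partialM i u v : (forall x, derivable u x (delta_mx 0 i)) ->
  (forall x, derivable v x (delta_mx 0 i)) ->
  partial i (u * v) = u * partial i v + v * partial i u.
Proof. by move=> du dv; apply/funext => x; rewrite /partial deriveM. Qed.

Lemma CkM k u v : Ck k u -> Ck k v -> Ck k (u * v).
Proof.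
elim: k u v => [|k IH] u v hu hv.
  have cu : continuous u := Ck_continuous hu; have cv : continuous v := Ck_continuous hv.
  by split=> // x; exact: continuousM (cu x) (cv x).
have pu := Ck_pred hu; have pv := Ck_pred hv.
case: hu hv => [cu du] [cv dv]; split=> //.
  by move=> x; exact: continuousM (cu x) (cv x).
move=> i; have [du1 du2] := du i; have [dv1 dv2] := dv i; split.
  by move=> x; apply: derivableM.
by rewrite partialM//; apply: CkD; exact: IH.
Qed.

Lemma Ck_cst k (c : R) : Ck k (fun _ : 'rV[R]_d => c).
Proof.
elim: k c => [|k IH] c; first by split=> //; exact: cst_continuous.
split=> [|i]; first exact: cst_continuous.
split=> [x|]; first exact: derivable_cst.
have -> : partial i (fun _ : 'rV[R]_d => c) = fun=> 0 by apply/funext => x; rewrite /partial derive_cst.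
exact: IH.
Qed.

Lemma CkZ k (c : R) u : Ck k u -> Ck k (c *: u).
Proof. by move=> hu; exact: CkM (Ck_cst k c) hu. Qed.

(** Functions of one coordinate only. *)
Lemma is_derive_coord (f : R -> R) (df : R -> R) i j (x : 'rV[R]_d) :
  (forall y, is_derive y (1 : R) f (df y)) ->
  is_derive x (delta_mx 0 i) (fun x : 'rV[R]_d => f (x 0 j)) ((i == j)%:R * df (x 0 j)).
Proof.
move=> hf.
have E h : h *: (delta_mx 0 i : 'rV[R]_d) 0 j = h * (i == j)%:R.
  by rewrite mxE eqxx/= eq_sym.
have [ij|ij] := eqVneq i j; last first.
  have c : h^-1 *: (((fun x : 'rV[R]_d => f (x 0 j)) \o shift x) (h *: (delta_mx 0 i : 'rV[R]_d)) -
      f (x 0 j)) @[h --> (0 : R)^'] --> (0 : R).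
    apply: cvg_near_cst; near=> h.
    by rewrite /= !mxE (eq_sym j) (negbTE ij) andbF mulr0 add0r subrr scaler0.
  rewrite mul0r.
  by apply: DeriveDef; [apply/cvg_ex; exists 0|exact: cvg_lim c].
rewrite mul1r; have [d1 d2] := hf (x 0 j).
have QE : (fun h : R => h^-1 *: (((fun x : 'rV[R]_d => f (x 0 j)) \o shift x)
      (h *: (delta_mx 0 i : 'rV[R]_d)) - f (x 0 j))) =
    (fun h : R => h^-1 *: ((f \o shift (x 0 j)) (h *: 1) - f (x 0 j))).
  by apply/funext => h /=; rewrite !mxE ij !eqxx.
apply: DeriveDef; first by rewrite /derivable QE.
by rewrite /derive QE.
Unshelve. all: by end_near. Qed.

Lemma Ck_coord k j : Ck k (fun x : 'rV[R]_d => x 0 j).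
Proof.
case: k => [|k].
  by split=> //; exact: coord_continuous.
split; first exact: coord_continuous.
move=> i.
have h x := @is_derive_coord id (fun=> 1) i j x (fun y => is_derive_id y 1).
split=> [x|]; first by have [] := h x.
have -> : partial i (fun x : 'rV[R]_d => x 0 j) = fun=> (i == j)%:R * 1.
  by apply/funext => x; rewrite /partial (@derive_val _ _ _ _ _ _ _ (h x)).
exact: Ck_cst.
Qed.

Lemma Ck_flat k n (c e : R) j : Ck k (fun x : 'rV[R]_d => flat n (c * x 0 j + e)).
Proof.
have cont m : continuous (fun x : 'rV[R]_d => flat m (c * x 0 j + e)).
  move=> x; apply: (@continuous_comp _ _ _ (fun x : 'rV[R]_d => c * x 0 j + e) (flat m)).
    apply: (@continuousD _ _ _ (fun x : 'rV[R]_d => c * x 0 j) (fun=> e)).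
      apply: (@continuousM _ _ (fun=> c) (fun x : 'rV[R]_d => x 0 j)).
        exact: cst_continuous.
      exact: coord_continuous.
    exact: cst_continuous.
  exact: flat_continuous.
elim: k n => [|k IH] n; first by split.
split=> // i.
have dlin y : is_derive y (1 : R) (fun y : R => c * y + e) c.
  by apply: is_derive_eq; rewrite /GRing.scale/=; ring.
have h x := @is_derive_coord (fun y => flat n (c * y + e)) _ i j x
   (fun y => @is_derive1_comp _ (flat n) (fun y => c * y + e) y _ _ (is_derive_flat n (c * y + e)) (dlin y)).
split=> [x|]; first by have [] := h x.
have -> : partial i (fun x : 'rV[R]_d => flat n (c * x 0 j + e)) =
    ((i == j)%:R * c) *: ((- n%:R) *: (fun x : 'rV[R]_d => flat n.+1 (c * x 0 j + e)) +
      (fun x : 'rV[R]_d => flat n.+2 (c * x 0 j + e))).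
  apply/funext => x; rewrite /partial (@derive_val _ _ _ _ _ _ _ (h x)).
  set y := c * x 0 j + e.
  change ((i == j)%:R * ((- n%:R * flat n.+1 y + flat n.+2 y) * c) =
    ((i == j)%:R * c) * (- n%:R * flat n.+1 y + flat n.+2 y)).
  by ring.
by apply: CkZ; apply: CkD; first exact: CkZ.
Qed.

Lemma Ck_prod (I : Type) (s : seq I) (F : I -> 'rV[R]_d -> R) k :
  (forall q, Ck k (F q)) -> Ck k (fun x => \prod_(q <- s) F q x).
Proof.
move=> h; elim: s => [|q s IH].
  by under eq_fun do rewrite big_nil; exact: Ck_cst.
under eq_fun do rewrite big_cons.
exact: (CkM (h q) IH).
Qed.

(** Smooth bumps, vanishing outside the open box with corners a and b and tending
    to its indicator function as n grows. *)
Definition smooth_bump (a b : 'I_d -> R) (n : nat) (x : 'rV[R]_d) : R :=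
  \prod_(j <- enum 'I_d) (flat 0 (n%:R * (x 0 j - a j)) * flat 0 (n%:R * (b j - x 0 j))).

Lemma Ck_bump a b n k : Ck k (smooth_bump a b n).
Proof.
apply: Ck_prod => j.
apply: (@CkM _ (fun x : 'rV[R]_d => flat 0 (n%:R * (x 0 j - a j)))
  (fun x : 'rV[R]_d => flat 0 (n%:R * (b j - x 0 j)))).
- under eq_fun do rewrite mulrBr; exact: Ck_flat.
- under eq_fun do rewrite mulrBr addrC -mulrN mulrN -mulNr; exact: Ck_flat.
Qed.

Lemma bump_ge0 a b n (x : 'rV[R]_d) : 0 <= smooth_bump a b n x.
Proof. by apply: prodr_ge0 => j _; rewrite mulr_ge0 ?flat_ge0. Qed.

Lemma bump_le1 a b n (x : 'rV[R]_d) : smooth_bump a b n x <= 1.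
Proof.
rewrite /smooth_bump; elim: (enum 'I_d) => [|j s IH]; first by rewrite big_nil.
rewrite big_cons mulr_ile1 ?mulr_ge0 ?flat_ge0//; last first.
  by rewrite mulr_ile1 ?flat_ge0 ?flat0_lt1.
by apply: prodr_ge0 => i _; rewrite mulr_ge0 ?flat_ge0.
Qed.

Lemma bump_out a b n (x : 'rV[R]_d) j : ~~ (a j < x 0 j < b j) -> smooth_bump a b n x = 0.
Proof.
move=> h; rewrite /smooth_bump (big_rem j) ?mem_enum//=.
suff -> : flat 0 (n%:R * (x 0 j - a j)) * flat 0 (n%:R * (b j - x 0 j)) = 0 by rewrite mul0r.
move: h; rewrite negb_and -!leNgt => /orP[h|h].
  by rewrite /flat ltNge mulr_ge0_le0 ?subr_le0//= mul0r.
by rewrite mulrC /flat ltNge mulr_ge0_le0 ?subr_le0//= mul0r.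
Qed.

(** Open boxes. *)
Definition obox (a b : 'I_d -> R) : set 'rV[R]_d :=
  fun x => forall j, a j < x 0 j < b j.

Lemma bump_cvg a b (x : 'rV[R]_d) :
  smooth_bump a b n x @[n --> \oo] --> (\1_(obox a b) x : R).
Proof.
rewrite indicE; case: (boolP (x \in _)) => [|].
  rewrite inE /= => h; rewrite /smooth_bump.
  have cj j : flat 0 (n%:R * (x 0 j - a j)) * flat 0 (n%:R * (b j - x 0 j))
      @[n --> \oo] --> (1 : R).
    have /andP[h1 h2] := h j.
    rewrite -subr_gt0 in h1; rewrite -subr_gt0 in h2.
    have := cvgM (flat0_cvg1 h1) (flat0_cvg1 h2); rewrite mulr1; exact.
  have : forall s : seq 'I_d, \prod_(j <- s)
      (flat 0 (n%:R * (x 0 j - a j)) * flat 0 (n%:R * (b j - x 0 j)))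
      @[n --> \oo] --> (1 : R).
    elim=> [|j s IH].
      by under eq_fun do rewrite big_nil; exact: cvg_cst.
    under eq_fun do rewrite big_cons.
    have := cvgM (cj j) IH; rewrite mulr1; exact.
  exact.
rewrite notin_setE/= => h.
have [j hj] : exists j, ~~ (a j < x 0 j < b j).
  by apply: contra_notP h => h j; apply: contrapT => /negP hj; apply: h; exists j.
by apply: cvg_near_cst; apply: nearW => n; exact: bump_out hj.
Qed.

End Ck_calculus.

(** * Functions orthogonal to the test functions *)

Section boxes.
Context {R : realType}.
Notation leb1 := (@lebesgue_measure R).

(** Products of measurable sets of the line, as sets of tuples. *)
Definition tbox (n : nat) (A : 'I_n -> set (measurableTypeR R)) :
  set (n.-tuple (measurableTypeR R)) := [set t | forall i, A i (tnth t i)].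

Lemma tbox_meas n (A : 'I_n -> set (measurableTypeR R)) :
  (forall i, measurable (A i)) -> measurable (tbox A).
Proof.
move=> mA.
have -> : tbox A = \bigcap_(i in [set: 'I_n])
    ((fun t : n.-tuple (measurableTypeR R) => tnth t i) @^-1` A i).
  by apply/seteqP; split=> t /= h i; [move=> _; exact: h|exact: h].
apply: fin_bigcap_measurable; first exact: finite_finset.
by move=> i _; rewrite -[X in measurable X]setTI; exact: measurable_tnth.
Qed.

Lemma leb_tbox n (A : 'I_n -> set (measurableTypeR R)) :
  (forall i, measurable (A i)) -> leb n (tbox A) = (\prod_(i < n) leb1 (A i))%E.
Proof.
elim: n A => [|n IH] A mA.
  rewrite big_ord0 /= diracE mem_set//.
  by case.
rewrite big_ord_recl -IH//.
transitivity ((leb1 \x leb n)%E (A ord0 `*` tbox (fun i => A (lift ord0 i)))).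
  rewrite /= /leb_step /pushforward; congr (_ _).
  apply/seteqP; split=> -[x t] /=.
    by move=> h; split=> [|i]; [exact: h ord0|have := h (lift ord0 i); rewrite tnthS].
  move=> [h0 h] i; case: (unliftP ord0 i) => [j ->|->//].
  by rewrite tnthS; exact: h.
by rewrite product_measure1E//; exact: tbox_meas.
Qed.

End boxes.

Section bounded_domain_L2.
Context {R : realType} {d : nat}.
Variable D : set 'rV[R]_d.
Hypothesis openD : open D.
Hypothesis bndD : bounded_set D.
Notation tup := (d.-tuple (measurableTypeR R)).
Local Notation row := (@row_of_tuple R d).
Notation leb1 := (@lebesgue_measure R).
Implicit Types (a b : 'I_d -> R) (u f g : 'rV[R]_d -> R).

Lemma bounded_coord (A : set 'rV[R]_d) : bounded_set A ->
  exists2 M : R, 0 < M & forall x, A x -> forall i, `|x 0 i| <= M.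
Proof.
move=> [M0 [Mreal normA]]; exists (`|M0| + 1); first by rewrite ltr_wpDl.
move=> x Ax i.
have M01 : M0 < `|M0| + 1 by rewrite (le_lt_trans (ler_norm _))// ltrDl.
apply: le_trans (normA _ M01 _ Ax).
have /mapP[j Hj ->] : `|x ord0 i| \in [seq `|x p.1 p.2| | p : 'I_1 * 'I_d].
  by apply/mapP; exists (ord0, i) => //=; rewrite mem_enum.
by rewrite [leRHS]/Num.Def.normr /= mx_normrE; apply/bigmax_geP; right => /=; exists j.
Qed.

(** Closed boxes. *)
Definition cbox a b : set 'rV[R]_d := fun x => forall j, a j <= x 0 j <= b j.

Lemma cbox_compact a b : compact (cbox a b).
Proof.
have := @rV_compact R d (fun i => `[a i, b i]%classic) (fun i => @segment_compact _ _ _).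
congr compact; apply/seteqP; split=> x /= h i; have := h i; rewrite /= in_itv//.
Qed.

Lemma domain_meas : measurable (row @^-1` D : set tup).
Proof. exact: open_row_meas. Qed.

Lemma leb_domain_fin : (leb d (row @^-1` D : set tup) < +oo)%E.
Proof.
have [M M0 DM] := bounded_coord bndD.
pose A (i : 'I_d) : set (measurableTypeR R) := `[- M, M]%classic.
apply: (@le_lt_trans _ _ (leb d (tbox A))).
  apply: le_measure; rewrite ?inE.
  - exact: domain_meas.
  - by apply: tbox_meas => i; exact: measurable_itv.
  move=> t Dt i; have := DM _ Dt i; rewrite /row_of_tuple mxE /A /= in_itv/=.
  by rewrite ler_norml.
rewrite leb_tbox; last by move=> i; exact: measurable_itv.
rewrite /A lebesgue_measure_itv/= lte_fin gtrN// -EFinB.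
by rewrite prodEFin ltry.
Qed.

Lemma sqint_domain : sqint (leb d) (\1_(row @^-1` D) : tup -> R).
Proof.
split; first exact: measurable_indic domain_meas.
have -> : (fun t : tup => \1_(row @^-1` D) t ^+ 2) = (\1_(row @^-1` D) : tup -> R).
  by apply/funext => t; rewrite indicE; case: (_ \in _); rewrite ?expr0n ?expr1n.
apply/integrableP; split.
  by apply/measurable_EFinP; exact: measurable_indic domain_meas.
under eq_integral do rewrite gee0_abs ?lee_fin//.
by rewrite integral_indic ?setIT//; [exact: leb_domain_fin|exact: domain_meas].
Qed.

Lemma ext_meas u : measurable_fun setT (fun t : tup => u (row t)) ->
  measurable_fun setT (ext D u).
Proof.
move=> mu.
have -> : ext D u = fun t => u (row t) * \1_(row @^-1` D) t.
  apply/funext => t; rewrite extE indicE.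
  have -> : (t \in row @^-1` D) = (row t \in D) by apply/idP/idP; rewrite !inE.
  by case: ifP => _; rewrite ?mulr1 ?mulr0.
by apply: measurable_funM => //; exact: measurable_indic domain_meas.
Qed.

Lemma continuous_bounded_on_domain u : continuous u ->
  exists2 C : R, 0 < C & forall x, D x -> `|u x| <= C.
Proof.
move=> cu; have [M M0 DM] := bounded_coord bndD.
have K : compact (u @` cbox (fun=> - M) (fun=> M)).
  apply: continuous_compact; last exact: cbox_compact.
  exact: continuous_subspaceT.
have [C0 [Cr normC]] := compact_bounded K.
exists (`|C0| + 1); first by rewrite ltr_wpDl.
move=> x Dx; apply: normC; first by rewrite (le_lt_trans (ler_norm _))// ltrDl.
by exists x => // j; rewrite -ler_norml; exact: DM.
Qed.

Lemma continuous_L2 u : continuous u -> L2 D u.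
Proof.
move=> cu; have [C C0 uC] := continuous_bounded_on_domain cu.
apply/L2_sqint; apply: sqint_le (sqintZ C sqint_domain).
  by apply: ext_meas; exact: continuous_row_meas.
move=> t; rewrite extE indicE.
have -> : (t \in row @^-1` D) = (row t \in D) by apply/idP/idP; rewrite !inE.
case: ifPn => [|_]; last by rewrite mulr0.
by rewrite inE mulr1 (gtr0_norm C0); exact: uC.
Qed.

(** A square integrable function orthogonal to all the test functions vanishes
    almost everywhere. *)
Section vanishing.
Variable f : 'rV[R]_d -> R.
Hypothesis Lf : L2 D f.
Hypothesis f_orth : forall phi, test_function D phi -> ip D f phi = 0.
Let G := ext D f.
Let sG : sqint (leb d) G. Proof. exact/L2_sqint. Qed.

Lemma test_bump a b n : cbox a b `<=` D -> test_function D (smooth_bump a b n).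
Proof.
move=> abD; split; first by move=> k; exact: Ck_bump.
exists (cbox a b); split=> //; first exact: cbox_compact.
move=> x nx.
have [j hj] : exists j, ~~ (a j <= x 0 j <= b j).
  by apply: contra_notP nx => h j; apply: contrapT => /negP hj; apply: h; exists j.
apply: (@bump_out _ _ _ _ _ _ j); apply: contra hj => /andP[h1 h2].
by rewrite !ltW.
Qed.

Let trow (A : set 'rV[R]_d) t : (t \in row @^-1` A) = (row t \in A).
Proof. by apply/idP/idP; rewrite !inE. Qed.

Let oboxE a b : row @^-1` (obox a b) =
  tbox (fun i => `]a i, b i[%classic : set (measurableTypeR R)).
Proof.
by apply/seteqP; split=> t h i; have := h i; rewrite /row_of_tuple /= mxE ?in_itv.
Qed.

Let obox_meas a b : measurable (row @^-1` (obox a b) : set tup).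
Proof. by rewrite oboxE; apply: tbox_meas => i; exact: measurable_itv. Qed.

(** By dominated convergence of the bumps. *)
Let int_obox a b : cbox a b `<=` D ->
  \int[leb d]_t (G t * \1_(row @^-1` (obox a b)) t) = 0.
Proof.
move=> abD.
have I1 : rint (leb d) (fun t => `|G t * \1_(row @^-1` D) t|).
  by apply: rint_norm; exact: sqint_mul sqint_domain.
have mb n : measurable_fun setT (fun t : tup => G t * smooth_bump a b n (row t)).
  apply: measurable_funM; first by case: sG.
  by apply: continuous_row_meas; exact: (Ck_continuous (Ck_bump a b n 0)).
have cb t : G t * smooth_bump a b n (row t) @[n --> \oo] -->
    G t * \1_(row @^-1` (obox a b)) t.
  apply: cvgMr; have -> : \1_(row @^-1` (obox a b)) t = \1_(obox a b) (row t) :> R.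
    by rewrite !indicE trow.
  exact: bump_cvg.
have bb n t : `|G t * smooth_bump a b n (row t)| <= `|G t * \1_(row @^-1` D) t|.
  rewrite /G extE indicE trow; case: ifPn => h.
    rewrite normrM (normrM _ true%:R) normr1 ler_wpM2l// ger0_norm ?bump_ge0//.
    exact: bump_le1.
  by rewrite mul0r normr0.
have [_ c] := Rint_dominated mb I1 cb bb.
apply: (cvg_unique (@norm_hausdorff _ _) c).
apply: cvg_near_cst; apply: nearW => n.
rewrite -(f_orth (test_bump n abD)) ip_inner; apply: eq_Rintegral => t _.
rewrite -/G [in RHS]extE; case: ifPn => // h.
by rewrite /G extE (negbTE h) !mul0r.
Qed.

(** By Dynkin's lemma, as the integral vanishes over all the smaller boxes. *)
Let zero_on_obox a b : cbox a b `<=` D ->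
  {ae leb d, forall t, G t * \1_(row @^-1` (obox a b)) t = 0}.
Proof.
move=> abD; pose G1 := (fun t : tup => G t * \1_(row @^-1` (obox a b)) t).
have sO : sqint (leb d) (\1_(row @^-1` (obox a b)) : tup -> R).
  apply: sqint_le sqint_domain; first exact: measurable_indic.
  move=> t; rewrite !indicE !trow; case: (boolP (row t \in obox a b)) => h; last by rewrite normr0.
  rewrite mem_set//; apply: abD => j; move: h; rewrite inE => /(_ j)/andP[h1 h2].
  by rewrite !ltW.
have IG1 : rint (leb d) G1 by exact: sqint_mul.
have IG1A A : measurable A -> rint (leb d) (fun t => G1 t * \1_A t).
  move=> mA; apply: rint_le (rint_norm IG1).
    by apply: measurable_funM; [exact: rint_meas IG1|exact: measurable_indic].
  move=> t; rewrite normrM indicE; case: (_ \in _); first by rewrite normr1 mulr1.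
  by rewrite normr0 mulr0.
pose H := [set A : set tup | measurable A /\ \int[leb d]_t (G1 t * \1_A t) = 0].
pose P0 := [set A : set tup | exists a' b', A = row @^-1` (obox a' b')].
have lamH : lambda_system setT H.
  split=> //.
  - split=> //; rewrite -[RHS](int_obox abD); apply: eq_Rintegral => t _.
    by rewrite indicT mulr1.
  - move=> A B BA [mA A0] [mB B0]; split; first exact: measurableD.
    have : \int[leb d]_t (G1 t * \1_A t - G1 t * \1_B t) = 0.
      by rewrite RintB ?A0 ?B0 ?subrr//; exact: IG1A.
    move=> <-; apply: eq_Rintegral => t _; rewrite -mulrBr; congr (_ * _).
    rewrite !indicE in_setD; case: (boolP (t \in B)) => tB.
      by rewrite mem_set ?subrr ?andbF//; apply: BA; move: tB; rewrite inE.
    by rewrite subr0 andbT.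
  - move=> F ndF HF; have mF n : measurable (F n) by have [] := HF n.
    have mU : measurable (\bigcup_k F k) by exact: bigcupT_measurable.
    split=> //.
    have m1 n : measurable_fun setT (fun t => G1 t * \1_(F n) t).
      exact: rint_meas (IG1A _ (mF n)).
    have c1 t : G1 t * \1_(F n) t @[n --> \oo] --> G1 t * \1_(\bigcup_k F k) t.
      apply: cvgMr; apply: cvg_near_cst.
      case: (boolP (t \in \bigcup_k F k)) => h.
        move: (h); rewrite inE => -[k _ Fkt]; exists k => // n /= kn.
        rewrite !indicE h mem_set//.
        by have /subsetPset := ndF _ _ kn; exact.
      apply: nearW => n; rewrite !indicE (negbTE h) memNset// => Fnt.
      by move/negP : h; apply; rewrite inE; exists n.
    have b1 n t : `|G1 t * \1_(F n) t| <= `|G1 t|.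
      rewrite normrM indicE; case: (_ \in _); first by rewrite normr1 mulr1.
      by rewrite normr0 mulr0.
    have [_ c] := Rint_dominated m1 (rint_norm IG1) c1 b1.
    apply: (cvg_unique (@norm_hausdorff _ _) c).
    by apply: cvg_near_cst; apply: nearW => n; have [] := HF n.
have P0I : setI_closed P0.
  move=> A B [a1 [b1 ->]] [a2 [b2 ->]].
  exists (fun i => Num.max (a1 i) (a2 i)), (fun i => Num.min (b1 i) (b2 i)).
  apply/seteqP; split=> t /=.
    move=> [h1 h2] i; have /andP[? ?] := h1 i; have /andP[? ?] := h2 i.
    by rewrite gt_max lt_min; apply/andP; split; apply/andP.
  move=> h; split=> i; have := h i; rewrite gt_max lt_min => /andP[/andP[? ?] /andP[? ?]];
  exact/andP.
have P0H : P0 `<=` H.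
  move=> A [a' [b' ->]]; split=> //.
  pose a2 i := Num.max (a i) (a' i); pose b2 i := Num.min (b i) (b' i).
  have D2 : cbox a2 b2 `<=` D.
    move=> x h; apply: abD => i; have := h i.
    by rewrite /a2 /b2 ge_max le_min => /andP[/andP[-> _] /andP[-> _]].
  rewrite -[RHS](int_obox D2); apply: eq_Rintegral => t _; rewrite /G1 -mulrA; congr (_ * _).
  rewrite !indicE -natrM mulnb -in_setI; congr (nat_of_bool (_ \in _))%:R.
  apply/seteqP; split=> s /=.
    move=> [h1 h2] i; have /andP[? ?] := h1 i; have /andP[? ?] := h2 i.
    by rewrite /a2 /b2 gt_max lt_min; apply/andP; split; apply/andP.
  by move=> h; split=> i; have := h i; rewrite /a2 /b2 gt_max lt_min => /andP[/andP[? ?] /andP[? ?]];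
  exact/andP.
have gen A : measurable A -> (<<s P0 >>) A.
  have mid : @measurable_fun _ _ (g_sigma_algebraType P0) tup setT id.
    apply/measurable_fun_tnthP => i.
    apply: (measurability _ (RGenOInfty.measurableE R)) => //.
    move=> _ [_ [x ->] <-]; rewrite setTI.
    have -> : (@tnth d (measurableTypeR R) ^~ i \o id) @^-1` `]x, +oo[%classic =
        \bigcup_(n : nat) (row @^-1` (obox (fun j => if j == i then x else - n%:R)
                                          (fun=> n%:R))).
      apply/seteqP; split=> t /=; rewrite in_itv/= andbT.
        move=> xt.
        have [M M0 hM] := @bounded_coord [set row t] (@compact_bounded _ _ _ (@compact_set1 _ _)).
        exists (Num.trunc M).+1 => // j.
        have := hM _ erefl j; have := truncnS_gt M; rewrite /row_of_tuple mxE ler_norml.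
        set n := (Num.trunc M).+1 => nM /andP[h1 h2].
        case: eqP => [->|_]; apply/andP; split=> //; first by have := hM _ erefl i;
          rewrite /row_of_tuple mxE ler_norml => /andP[_ h3]; exact: le_lt_trans nM.
          by apply: lt_le_trans h1; rewrite ltrN2.
        exact: le_lt_trans nM.
      by move=> [n _ /(_ i)]; rewrite /row_of_tuple mxE eqxx => /andP[].
    apply: bigcupT_measurable => n; apply: sub_sigma_algebra.
    by exists (fun j => if j == i then x else - n%:R), (fun=> n%:R).
  by move=> mA; have := mid measurableT A mA; rewrite setTI.
have HT A : measurable A -> \int[leb d]_t (G1 t * \1_A t) = 0.
  move=> mA; have [] // : H A.
  by apply: (lambda_system_subset P0I lamH P0H) (gen _ mA) => X _ x.
have mG1 := rint_meas IG1.
have ae := @integral_ae_eq _ _ R (leb d) setT measurableT (cst 0%E) (EFin \o G1) IG1.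
have {ae} : ae_eq (leb d) setT (EFin \o G1) (cst 0%E).
  apply: ae; first exact: measurable_cst.
  move=> A _ mA; rewrite integral0 integral_mkcond.
  rewrite -[RHS]/(0%:E) -(HT A mA) /Rintegral fineK; last exact: integrable_fin_num (IG1A A mA).
  apply: eq_integral => t _; rewrite patchE indicE.
  by case: (t \in A); rewrite ?mulr1 ?mulr0.
by apply: filterS => t /(_ Logic.I) /= [].
Qed.

Lemma orthogonal_to_tests_ae0 : {ae leb d, forall t, ext D f t = 0}.
Proof.
(* D is covered by countably many rational boxes *)
pose I := ({ffun 'I_d -> rat} * rat)%type.
pose a (k : I) i : R := ratr (k.1 i) - ratr k.2.
pose b (k : I) i : R := ratr (k.1 i) + ratr k.2.
have aebox k : cbox (a k) (b k) `<=` D ->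
    (leb d).-negligible [set t | G t * \1_(row @^-1` (obox (a k) (b k))) t <> 0].
  by move=> /zero_on_obox; congr (negligible _ _); apply/seteqP; split.
pose N n := if unpickle n is Some k then
    (if `[< cbox (a k) (b k) `<=` D >] then
      [set t | G t * \1_(row @^-1` (obox (a k) (b k))) t <> 0] else set0) else set0.
have nN n : (leb d).-negligible (N n).
  rewrite /N; case: unpickle => [k|]; last exact: negligible_set0.
  by case: asboolP => [|_]; [exact: aebox|exact: negligible_set0].
apply: negligibleS (negligible_bigcup nN) => t /= Gt0.
have Dt : D (row t).
  by apply: contrapT => nD; apply: Gt0; rewrite extE memNset.
have [k [k0 kt kD]] := open_qcube openD Dt.
exists (pickle k) => //; rewrite /N pickleK; case: asboolP => [_|abs]; last first.
  exfalso; apply: abs => x h; apply: kD => i; have := h i.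
  by rewrite /a /b ler_distl.
rewrite /= indicE trow mem_set ?mulr1//.
by move=> i; have := kt i; rewrite /a /b ltr_distl.
Qed.

End vanishing.
End bounded_domain_L2.

(** * Integration of partial derivatives *)

Section compactly_supported.
Context {R : realType}.
Notation leb1 := (@lebesgue_measure R).
Notation tup n := (n.-tuple (measurableTypeR R)).

(** The support lies in the cube of half-side M. *)
Definition supported_in_cube (n : nat) (M : R) (u : 'rV[R]_n -> R) :=
  forall (x : 'rV[R]_n) (j : 'I_n), M < `|x 0 j| -> u x = 0.

Lemma row_continuous (X : topologicalType) (n : nat) (f : X -> 'rV[R]_n) :
  (forall j, continuous (fun x => f x 0 j)) -> continuous f.
Proof.
move=> cf x A [B Bx BA].
have : \forall z \near x, forall j, B 0 j (f z 0 j).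
  by apply: filter_forall => j; exact: (cf j x _ (Bx 0 j)).
by apply: filterS => z h; apply: BA => i j; rewrite (ord1 i).
Qed.

(** The row vector with first coordinate y, followed by x. *)
Definition consrow (n : nat) (y : R) (x : 'rV[R]_n) : 'rV[R]_n.+1 :=
  \row_i oapp (fun j => x 0 j) y (unlift ord0 i).

Lemma consrow0 n y (x : 'rV[R]_n) : consrow y x 0 ord0 = y.
Proof. by rewrite mxE unlift_none. Qed.

Lemma consrowS n y (x : 'rV[R]_n) j : consrow y x 0 (lift ord0 j) = x 0 j.
Proof. by rewrite mxE liftK. Qed.

Lemma row_of_tuple_cons n (y : R) (t : tup n) :
  row_of_tuple [tuple of y :: t] = consrow y (row_of_tuple t).
Proof.
apply/rowP => i; case: (unliftP ord0 i) => [j ->|->].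
  by rewrite consrowS !mxE tnthS.
by rewrite consrow0 mxE.
Qed.

Lemma consrow_continuousr n y : continuous (@consrow n y).
Proof.
apply: row_continuous => i; case: (unliftP ord0 i) => [j ->|->].
  by under eq_fun do rewrite consrowS; exact: coord_continuous.
by under eq_fun do rewrite consrow0; exact: cst_continuous.
Qed.

Lemma consrow_continuousl n (x : 'rV[R]_n) : continuous (fun y => consrow y x).
Proof.
apply: row_continuous => i; case: (unliftP ord0 i) => [j ->|->].
  by under eq_fun do rewrite consrowS; exact: cst_continuous.
have -> : (fun y : R => consrow y x 0 ord0) = id by apply/funext => y; rewrite consrow0.
by move=> y; exact: cvg_id.
Qed.

Lemma consrow_shiftS n y (x : 'rV[R]_n) (h : R) j :
  h *: delta_mx 0 (lift ord0 j) + consrow y x = consrow y (h *: delta_mx 0 j + x).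
Proof.
apply/rowP => i; case: (unliftP ord0 i) => [k ->|->].
  by rewrite consrowS !mxE liftK /= (inj_eq lift_inj).
by rewrite consrow0 !mxE unlift_none/= mulr0 add0r.
Qed.

Lemma consrow_shift0 n y (x : 'rV[R]_n) (h : R) :
  h *: delta_mx 0 ord0 + consrow y x = consrow (h *: (1 : R) + y) x.
Proof.
apply/rowP => i; case: (unliftP ord0 i) => [k ->|->].
  by rewrite consrowS !mxE liftK /= mulr0 add0r.
by rewrite consrow0 !mxE unlift_none/= .
Qed.

Section slices.
Variables (n : nat) (u : 'rV[R]_n.+1 -> R).

Let quotS y j (x : 'rV[R]_n) :
  (fun h : R => h^-1 *: ((u \o shift (consrow y x)) (h *: delta_mx 0 (lift ord0 j)) - u (consrow y x))) =
  (fun h : R => h^-1 *: (((fun x => u (consrow y x)) \o shift x) (h *: delta_mx 0 j) - u (consrow y x))).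
Proof. by apply/funext => h /=; rewrite consrow_shiftS. Qed.

Let quot0 y (x : 'rV[R]_n) :
  (fun h : R => h^-1 *: ((u \o shift (consrow y x)) (h *: delta_mx 0 ord0) - u (consrow y x))) =
  (fun h : R => h^-1 *: (((fun y => u (consrow y x)) \o shift y) (h *: (1 : R)) - u (consrow y x))).
Proof. by apply/funext => h /=; rewrite consrow_shift0. Qed.

Lemma partial_sliceS y j x :
  partial (lift ord0 j) u (consrow y x) = partial j (fun x => u (consrow y x)) x.
Proof. by rewrite /partial /derive quotS. Qed.

Lemma derivable_sliceS y j x : derivable u (consrow y x) (delta_mx 0 (lift ord0 j)) ->
  derivable (fun x => u (consrow y x)) x (delta_mx 0 j).
Proof. by rewrite /derivable quotS. Qed.

Lemma is_derive_slice0 y (x : 'rV[R]_n) : derivable u (consrow y x) (delta_mx 0 ord0) ->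
  is_derive y (1 : R) (fun y => u (consrow y x)) (partial ord0 u (consrow y x)).
Proof.
rewrite /derivable quot0 => du; apply: DeriveDef => //.
by rewrite /partial /derive quot0.
Qed.

End slices.

Lemma supported_partial n M (u : 'rV[R]_n -> R) i :
  supported_in_cube M u -> supported_in_cube M (partial i u).
Proof.
move=> su x j Mx; rewrite /partial /derive.
have c : h^-1 *: ((u \o shift x) (h *: delta_mx 0 i) - u x) @[h --> (0 : R)^'] --> (0 : R).
  apply: cvg_near_cst.
  pose e : R := ((0 == 0 :> 'I_1) && (j == i))%:R.
  have cc : continuous (fun h : R => `|h * e + x 0 j|).
    move=> h; apply: (@continuous_comp _ _ _ (fun h : R => h * e + x 0 j) (@Num.Def.normr _ R)).
      apply: (@continuousD _ _ _ (fun h : R => h * e) (fun=> x 0 j)); last exact: cst_continuous.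
      apply: (@continuousM _ _ (fun h : R => h) (fun=> e)); last exact: cst_continuous.
      exact: cvg_id.
    exact: norm_continuous.
  have Mx0 : M < `|0 * e + x 0 j| by rewrite mul0r add0r.
  have near0 := cvgr_gt _ (cc 0) _ Mx0.
  have near1 : \forall h \near (0 : R)^', M < `|h * e + x 0 j|.
    by rewrite /dnbhs; apply: cvg_within; exact: near0.
  apply: filterS near1 => h hM.
  have {}hM : M < `|(h *: delta_mx 0 i + x) 0 j| by rewrite !mxE.
  by rewrite (su x j Mx) /= (su _ j hM) subrr scaler0.
exact: (cvg_lim _ c).
Qed.

(** The cube of half-side M, as a set of tuples. *)
Definition cube n (M : R) : set (tup n) := tbox (fun _ : 'I_n => `[- M, M]%classic).

Lemma cube_meas n M : measurable (@cube n M).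
Proof. by apply: tbox_meas => i; exact: measurable_itv. Qed.

Lemma rint_cube n M : rint (leb n) (\1_(@cube n M) : tup n -> R).
Proof.
apply/integrableP; split.
  by apply/measurable_EFinP; exact: measurable_indic (@cube_meas n M).
under eq_integral do rewrite gee0_abs ?lee_fin//.
rewrite integral_indic ?setIT//; last exact: cube_meas.
suff : (leb n (tbox (fun _ : 'I_n => (`[(- M)%R, M]%classic : set R))) < +oo)%E by [].
rewrite leb_tbox; last by move=> i; exact: measurable_itv.
have -> : lebesgue_measure (`[- M, M]%classic : set R) = (if - M < M then M - - M else 0)%:E.
  by rewrite lebesgue_measure_itv/= lte_fin; case: ifP => // _; rewrite EFinB.
by rewrite prodEFin ltry.
Qed.

Lemma rint_compact n M (u : 'rV[R]_n -> R) : continuous u -> supported_in_cube M u ->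
  rint (leb n) (fun t => u (row_of_tuple t)).
Proof.
move=> cu su.
have K : compact (u @` cbox (fun=> - M) (fun=> M)).
  apply: continuous_compact; last exact: cbox_compact.
  exact: continuous_subspaceT.
have [C0 [Cr normC]] := compact_bounded K.
have C0lt : C0 < `|C0| + 1 by rewrite (le_lt_trans (ler_norm _))// ltrDl.
apply: rint_le (rintZ (`|C0| + 1) (rint_cube n M)).
  exact: continuous_row_meas.
move=> t; rewrite indicE; case: (boolP (t \in cube M)) => h.
  rewrite mulr1; apply: (normC _ C0lt); exists (row_of_tuple t) => // j.
  by move: h; rewrite inE => /(_ j); rewrite /= in_itv/= /row_of_tuple mxE.
have [j hj] : exists j, ~~ (`|row_of_tuple t 0 j| <= M).
  apply: contrapT => h'; move/negP : h; apply; rewrite inE => j.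
  rewrite /= in_itv/= -ler_norml.
  by apply: contrapT => /negP hj; apply: h'; exists j; rewrite /row_of_tuple mxE.
by rewrite mulr0 (su _ j) ?normr0// ltNge.
Qed.

(** The Lebesgue measure is a product measure. *)
Lemma leb_consE n (H : tup n.+1 -> R) : rint (leb n.+1) H ->
  rint (leb1 \x leb n)%E (fun q => H [tuple of q.1 :: q.2]) /\
  \int[leb n.+1]_t H t = \int[(leb1 \x leb n)%E]_q H [tuple of q.1 :: q.2].
Proof.
move=> IH; have mH := rint_meas IH.
have mc : measurable_fun setT (fun q : measurableTypeR R * tup n => [the tup n.+1 of q.1 :: q.2]).
  exact: measurable_cons.
have mHc : measurable_fun setT (fun q : measurableTypeR R * tup n => H [tuple of q.1 :: q.2]).
  exact: (measurableT_comp mH mc).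
have I2 : rint (leb1 \x leb n)%E (fun q => H [tuple of q.1 :: q.2]).
  apply/integrableP; split; first exact/measurable_EFinP.
  case/integrableP : IH => _.
  rewrite (ge0_integral_pushforward mc)//.
  by apply: measurableT_comp => //; exact/measurable_EFinP.
split=> //; rewrite /Rintegral (integral_pushforward mc)//; exact/measurable_EFinP.
Qed.

(** The integral of a partial derivative of a compactly supported function
    vanishes. *)
Lemma int_partial0 n (i : 'I_n) M (u : 'rV[R]_n -> R) : 0 < M ->
  (forall x, derivable u x (delta_mx 0 i)) -> continuous (partial i u) ->
  supported_in_cube M u ->
  \int[leb n]_t partial i u (row_of_tuple t) = 0.
Proof.
move=> M0; elim: n i u => [[]//|n IH] i u du cu su.
have sp : supported_in_cube M (partial i u) by exact: supported_partial.
have [I1 ->] := leb_consE (rint_compact cu sp).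
(* a derivative in a direction other than the first one is a derivative of the
   slices with fixed first coordinate; otherwise integrate along the first
   direction *)
case: (unliftP ord0 i) => [j ij|i0].
  rewrite /Rintegral -(integral12_prod_meas1 I1) /fubini_F.
  rewrite (eq_integral (cst 0%E)) ?integral0// => y _.
  pose uy x := u (consrow y x).
  have puy : partial j uy = (partial i u) \o (consrow y).
    by apply/funext => x; rewrite /= ij partial_sliceS.
  have cuy : continuous (partial j uy).
    rewrite puy => x; apply: continuous_comp; first exact: consrow_continuousr.
    exact: cu.
  have suy : supported_in_cube M uy.
    by move=> x k Mx; apply: (su _ (lift ord0 k)); rewrite consrowS.
  have duy x : derivable uy x (delta_mx 0 j) by apply: derivable_sliceS; rewrite -ij.
  have spy : supported_in_cube M (partial j uy) by exact: supported_partial.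
  have Iy := rint_compact cuy spy.
  transitivity ((\int[leb n]_t partial j uy (row_of_tuple t))%:E); last by rewrite IH.
  rewrite /Rintegral fineK; last exact: integrable_fin_num Iy.
  by apply: eq_integral => t _; rewrite /= row_of_tuple_cons puy.
rewrite /Rintegral -(integral21_prod_meas1 I1) /fubini_G.
rewrite (eq_integral (cst 0%E)) ?integral0// => t _.
pose x := row_of_tuple t.
pose f y := partial i u (consrow y x).
have cf : continuous f.
  move=> y; apply: continuous_comp; first exact: consrow_continuousl.
  exact: cu.
have dF y : is_derive y (1 : R) (fun y => u (consrow y x)) (f y).
  by rewrite /f i0; apply: is_derive_slice0; rewrite -i0.
have M2 : - (M + 1) < M + 1 by rewrite gtrN// addr_gt0.
have z y : M < `|y| -> u (consrow y x) = 0.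
  by move=> My; apply: (su _ ord0); rewrite consrow0.
have fz y : M < `|y| -> f y = 0.
  by move=> My; apply: (sp _ ord0); rewrite consrow0.
have := FTC_itv M2 cf dF.
have M1 : M < M + 1 by rewrite ltrDl.
have M10 : 0 <= M + 1 by rewrite addr_ge0// ltW.
rewrite !z ?normrN ?(ger0_norm M10)// subrr => E.
have If : leb1.-integrable `[- (M + 1), M + 1] (EFin \o f).
  apply: continuous_compact_integrable; first exact: segment_compact.
  exact: continuous_subspaceT.
transitivity ((\int[leb1]_(y in `[- (M + 1), M + 1]) f y)%:E); last by rewrite E.
rewrite /Rintegral fineK; last exact: integrable_fin_num If.
rewrite [RHS]integral_mkcond; apply: eq_integral => y _.
rewrite /= row_of_tuple_cons patchE; case: ifPn => //.
rewrite notin_setE/= in_itv/= -ler_norml => /negP; rewrite -ltNge => My.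
by rewrite -/x -/(f y) fz// (lt_trans M1).
Qed.

End compactly_supported.

(** * Sobolev spaces *)

Section sobolev.
Context {R : realType} {d : nat}.
Variable D : set 'rV[R]_d.
Hypothesis openD : open D.
Hypothesis bndD : bounded_set D.
Notation tup := (d.-tuple (measurableTypeR R)).
Local Notation row := (@row_of_tuple R d).
Implicit Types (u v w phi psi : 'rV[R]_d -> R) (i : 'I_d)
  (g : 'I_d -> 'rV[R]_d -> R).

Lemma test_continuous phi : test_function D phi -> continuous phi.
Proof. by move=> [/(_ 0) h _]; exact: Ck_continuous h. Qed.

Lemma test_derivable phi i x : test_function D phi -> derivable phi x (delta_mx 0 i).
Proof. by move=> [/(_ 1) [_ /(_ i)[h _]] _]; exact: h. Qed.

Lemma test_partial_continuous phi i : test_function D phi -> continuous (partial i phi).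
Proof. by move=> [/(_ 1) [_ /(_ i)[_ h]] _]; exact: (@Ck_continuous _ _ 0 _ h). Qed.

Lemma test_L2 phi : test_function D phi -> L2 D phi.
Proof. by move=> /test_continuous; exact: continuous_L2. Qed.

Lemma test_partial_L2 phi i : test_function D phi -> L2 D (partial i phi).
Proof. by move=> /test_partial_continuous - /(_ i); exact: continuous_L2. Qed.

Lemma test_out phi x : test_function D phi -> ~ D x -> phi x = 0.
Proof. by move=> [_ [K [_ KD phi0]]] nDx; apply: phi0 => /KD. Qed.

Lemma testD phi psi : test_function D phi -> test_function D psi ->
  test_function D (phi + psi).
Proof.
move=> [C1 [K1 [c1 KD1 z1]]] [C2 [K2 [c2 KD2 z2]]]; split.
  by move=> k; apply: CkD.
exists (K1 `|` K2); split; first exact: compactU.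
  by move=> x [|]; [exact: KD1|exact: KD2].
move=> x nK; change (phi x + psi x = 0); rewrite z1 ?z2 ?addr0// => h; apply: nK.
  by right.
by left.
Qed.

Lemma testM u phi : (forall k, Ck k u) -> test_function D phi ->
  test_function D (u * phi).
Proof.
move=> Cu [C1 [K1 [c1 KD1 z1]]]; split; first by move=> k; apply: CkM.
exists K1; split=> // x nK; change (u x * phi x = 0).
by rewrite z1 ?mulr0.
Qed.

Lemma testZ a phi : test_function D phi -> test_function D (a *: phi).
Proof. by move=> tphi; apply: (testM (fun k => Ck_cst k a) tphi). Qed.

Lemma test_supported phi : test_function D phi ->
  exists2 M : R, 0 < M & supported_in_cube M phi.
Proof.
move=> [_ [K [cK KD phi0]]]; have [M M0 KM] := bounded_coord (compact_bounded cK).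
by exists M => // x j Mx; apply: phi0 => /KM/(_ j); rewrite leNgt Mx.
Qed.

Lemma ip_test u phi : test_function D phi ->
  ip D u phi = \int[leb d]_t (u (row t) * phi (row t)).
Proof.
move=> tphi; rewrite ip_inner; apply: eq_Rintegral => t _; rewrite !extE.
case: ifPn => // nD; rewrite (test_out (x := row t) tphi) ?mulr0//.
by move: nD; rewrite notin_setE.
Qed.

(** Integration by parts between test functions. *)
Lemma test_ibp phi psi i : test_function D phi -> test_function D psi ->
  ip D phi (partial i psi) = - ip D (partial i phi) psi.
Proof.
move=> tphi tpsi.
have [M M0 sphi] := test_supported tphi.
have cphi := test_continuous tphi; have cpsi := test_continuous tpsi.
have cdphi := test_partial_continuous (i := i) tphi.
have cdpsi := test_partial_continuous (i := i) tpsi.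
have d1 x : derivable phi x (delta_mx 0 i) by exact: test_derivable.
have d2 x : derivable psi x (delta_mx 0 i) by exact: test_derivable.
have pE := partialM d1 d2.
have c1 : continuous (phi * partial i psi).
  by move=> x; exact: continuousM (cphi x) (cdpsi x).
have c2 : continuous (psi * partial i phi).
  by move=> x; exact: continuousM (cpsi x) (cdphi x).
have s1 : supported_in_cube M (phi * partial i psi).
  by move=> x j Mx; change (phi x * partial i psi x = 0); rewrite (sphi x j)// mul0r.
have s2 : supported_in_cube M (psi * partial i phi).
  by move=> x j Mx; change (psi x * partial i phi x = 0);
    rewrite (supported_partial i sphi Mx)// mulr0.
have sM : supported_in_cube M (phi * psi).
  by move=> x j Mx; change (phi x * psi x = 0); rewrite (sphi x j)// mul0r.
have cM : continuous (partial i (phi * psi)).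
  by rewrite pE => x; exact: continuousD (c1 x) (c2 x).
have dM x : derivable (phi * psi) x (delta_mx 0 i) by exact: derivableM.
have := int_partial0 M0 dM cM sM; rewrite pE.
have -> : (fun t => (phi * partial i psi + psi * partial i phi) (row t)) =
    fun t => phi (row t) * partial i psi (row t) + psi (row t) * partial i phi (row t) by [].
rewrite RintD; [|exact: (rint_compact c1 s1)|exact: (rint_compact c2 s2)].
rewrite [ip D (partial i phi) psi]ip_test// ipC.
have -> : ip D (partial i psi) phi = \int[leb d]_t (phi (row t) * partial i psi (row t)).
  by rewrite ip_test//; apply: eq_Rintegral => t _; rewrite mulrC.
move/eqP; rewrite addr_eq0 => /eqP ->; congr (- _).
by apply: eq_Rintegral => t _; rewrite mulrC.
Qed.

Lemma test_H1 phi : test_function D phi -> H1 D phi.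
Proof.
move=> tphi; split; first exact: test_L2.
exists (fun i => partial i phi) => i; split; first exact: test_partial_L2.
by move=> psi tpsi; exact: test_ibp.
Qed.

Lemma weak_gradD u v g g' : L2 D u -> L2 D v -> is_weak_grad D u g -> is_weak_grad D v g' ->
  is_weak_grad D (u + v) (fun i => g i + g' i).
Proof.
move=> Lu Lv hg hg' i; have [Lg gE] := hg i; have [Lg' gE'] := hg' i.
split; first exact: L2D.
move=> phi tphi; have Lphi := test_L2 tphi; have Ldphi := test_partial_L2 i tphi.
by rewrite !ipDl// gE// gE'// opprD.
Qed.

Lemma weak_gradZ a u g : L2 D u -> is_weak_grad D u g ->
  is_weak_grad D (a *: u) (fun i => a *: g i).
Proof.
move=> Lu hg i; have [Lg gE] := hg i; split; first exact: L2Z.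
move=> phi tphi; have Lphi := test_L2 tphi; have Ldphi := test_partial_L2 i tphi.
by rewrite !ipZl// gE// mulrN.
Qed.

Lemma ext_L2_meas u : L2 D u -> measurable_fun setT (ext D u).
Proof. by move=> /L2_sqint[]. Qed.

(** Weak gradients are unique almost everywhere. *)
Lemma weak_grad_unique u g g' i : is_weak_grad D u g -> is_weak_grad D u g' ->
  {ae leb d, forall t, ext D (g i) t = ext D (g' i) t}.
Proof.
move=> hg hg'; have [Lg gE] := hg i; have [Lg' gE'] := hg' i.
have L : L2 D (g i - g' i) by exact: L2B.
have := orthogonal_to_tests_ae0 openD bndD L.
have orth phi : test_function D phi -> ip D (g i - g' i) phi = 0.
  move=> tphi; have Lphi := test_L2 tphi; rewrite ipBl//.
  by apply/eqP; rewrite subr_eq0 -eqr_opp -gE// -gE'.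
move=> /(_ orth); apply: filterS => t.
rewrite !extE; case: ifP => // _ /eqP h; apply/eqP.
by rewrite -subr_eq0.
Qed.

Lemma grad_weak u : H1 D u -> is_weak_grad D u (grad D u).
Proof. by move=> [_ [g hg]]; apply: (@getPex _ [set g | is_weak_grad D u g]); exists g. Qed.

Lemma grad_L2 u i : H1 D u -> L2 D (grad D u i).
Proof. by move=> /grad_weak /(_ i)[]. Qed.

Lemma H1_L2 u : H1 D u -> L2 D u. Proof. by case. Qed.

Lemma H1D u v : H1 D u -> H1 D v -> H1 D (u + v).
Proof.
move=> Hu Hv; split; first by apply: L2D; exact: H1_L2.
exists (fun i => grad D u i + grad D v i).
by apply: weak_gradD; [exact: H1_L2|exact: H1_L2|exact: grad_weak|exact: grad_weak].
Qed.

Lemma H1Z a u : H1 D u -> H1 D (a *: u).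
Proof.
move=> Hu; split; first by apply: L2Z; exact: H1_L2.
by exists (fun i => a *: grad D u i); apply: weak_gradZ; [exact: H1_L2|exact: grad_weak].
Qed.

Lemma H1B u v : H1 D u -> H1 D v -> H1 D (u - v).
Proof. by move=> Hu Hv; apply: H1D => //; rewrite -scaleN1r; exact: H1Z. Qed.

Lemma ip_gradC u v : ip_grad D u v = ip_grad D v u.
Proof. by apply: eq_bigr => i _; rewrite ipC. Qed.

Lemma ip_gradDl u v w : H1 D u -> H1 D v -> H1 D w ->
  ip_grad D (u + v) w = ip_grad D u w + ip_grad D v w.
Proof.
move=> Hu Hv Hw; rewrite /ip_grad -big_split/=; apply: eq_bigr => i _.
have Lw := grad_L2 i Hw; have Lu := grad_L2 i Hu; have Lv := grad_L2 i Hv.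
rewrite -ipDl//; apply: ip_ae => //.
- by apply: ext_L2_meas; apply: grad_L2; exact: H1D.
- by apply: ext_L2_meas; exact: L2D.
apply: (weak_grad_unique (u := u + v) (g' := fun i => grad D u i + grad D v i)).
  by apply: grad_weak; exact: H1D.
by apply: weak_gradD; [exact: H1_L2|exact: H1_L2|exact: grad_weak|exact: grad_weak].
Qed.

Lemma ip_gradZl a u w : H1 D u -> H1 D w -> ip_grad D (a *: u) w = a * ip_grad D u w.
Proof.
move=> Hu Hw; rewrite /ip_grad mulr_sumr; apply: eq_bigr => i _.
have Lw := grad_L2 i Hw; have Lu := grad_L2 i Hu.
rewrite -ipZl//; apply: ip_ae => //.
- by apply: ext_L2_meas; apply: grad_L2; exact: H1Z.
- by apply: ext_L2_meas; exact: L2Z.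
apply: (weak_grad_unique (u := a *: u) (g' := fun i => a *: grad D u i)).
  by apply: grad_weak; exact: H1Z.
by apply: weak_gradZ; [exact: H1_L2|exact: grad_weak].
Qed.

Lemma ip_gradBl u v w : H1 D u -> H1 D v -> H1 D w ->
  ip_grad D (u - v) w = ip_grad D u w - ip_grad D v w.
Proof.
move=> Hu Hv Hw; rewrite ip_gradDl//; last by rewrite -scaleN1r; exact: H1Z.
by rewrite -[- v]scaleN1r ip_gradZl// mulN1r.
Qed.

Lemma ip_grad_ge0 u : 0 <= ip_grad D u u.
Proof. by apply: sumr_ge0 => i _; exact: ip_ge0. Qed.

Lemma ip_partial_le u i : ip D (grad D u i) (grad D u i) <= ip_grad D u u.
Proof. by rewrite /ip_grad (bigD1 i)//= lerDl sumr_ge0// => j _; exact: ip_ge0. Qed.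

Lemma ip_paral_le u v : L2 D u -> L2 D v ->
  ip D (u + v) (u + v) <= 2 * ip D u u + 2 * ip D v v.
Proof.
move=> Lu Lv; have := ip_ge0 D (u - v).
have Lp : L2 D (u + v) by exact: L2D.
have Lm : L2 D (u - v) by exact: L2B.
have -> : ip D (u - v) (u - v) = ip D u u - 2 * ip D u v + ip D v v.
  rewrite ipBl// (ipC D u (u - v)) (ipC D v (u - v)) (ipBl Lu Lv Lu) (ipBl Lu Lv Lv).
  by rewrite (ipC D v u); ring.
have -> : ip D (u + v) (u + v) = ip D u u + 2 * ip D u v + ip D v v.
  rewrite ipDl// (ipC D u (u + v)) (ipC D v (u + v)) (ipDl Lu Lv Lu) (ipDl Lu Lv Lv).
  by rewrite (ipC D v u); ring.
by lra.
Qed.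

Lemma ip_grad_sqrB u v : H1 D u -> H1 D v ->
  ip_grad D (u - v) (u - v) = ip_grad D u u - 2 * ip_grad D u v + ip_grad D v v.
Proof.
move=> Hu Hv; have Hm : H1 D (u - v) by exact: H1B.
rewrite ip_gradBl// (ip_gradC u (u - v)) (ip_gradC v (u - v)).
rewrite (ip_gradBl Hu Hv Hu) (ip_gradBl Hu Hv Hv) (ip_gradC v u).
by move: (ip_grad D u u) (ip_grad D u v) (ip_grad D v v) => a b c; ring.
Qed.

Lemma ip_grad_paral_le u v : H1 D u -> H1 D v ->
  ip_grad D (u + v) (u + v) <= 2 * ip_grad D u u + 2 * ip_grad D v v.
Proof.
move=> Hu Hv; have := ip_grad_ge0 (u - v).
have Hp : H1 D (u + v) by exact: H1D.
rewrite ip_grad_sqrB//.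
have -> : ip_grad D (u + v) (u + v) = ip_grad D u u + 2 * ip_grad D u v + ip_grad D v v.
  rewrite (ip_gradDl Hu Hv Hp) (ip_gradC u (u + v)) (ip_gradC v (u + v)).
  rewrite (ip_gradDl Hu Hv Hu).
  rewrite (ip_gradDl Hu Hv Hv).
 rewrite (ip_gradC v u).
  by move: (ip_grad D u u) (ip_grad D u v) (ip_grad D v v) => a b c; ring.
by move: (ip_grad D u u) (ip_grad D u v) (ip_grad D v v) => a b c; lra.
Qed.

(** The square of the norm of H^1. *)
Definition H1sqr u := ip D u u + ip_grad D u u.

Lemma H1sqr_ge0 u : 0 <= H1sqr u.
Proof. by rewrite addr_ge0 ?ip_ge0 ?ip_grad_ge0. Qed.

Lemma H1norm_lt u (e : R) : 0 < e -> H1norm D u < e <-> H1sqr u < e ^+ 2.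
Proof.
move=> e0; rewrite /H1norm -/(H1sqr u); split => h.
  rewrite -(@sqr_sqrtr _ (H1sqr u)) ?H1sqr_ge0// ltr_pXn2r ?nnegrE ?sqrtr_ge0 ?(ltW e0)//.
by rewrite -[ltRHS]ger0_norm ?ltW// -sqrtr_sqr ltr_sqrt// exprn_gt0.
Qed.

Lemma H10_H1 u : H10 D u -> H1 D u. Proof. by case. Qed.

Lemma H10D u v : H10 D u -> H10 D v -> H10 D (u + v).
Proof.
move=> [Hu au] [Hv av]; split; first exact: H1D.
move=> e e0; have e2 : 0 < e / 2 by rewrite divr_gt0.
have [phi [tphi hphi]] := au _ e2; have [psi [tpsi hpsi]] := av _ e2.
exists (phi + psi); split; first exact: testD.
have -> : u + v - (phi + psi) = (u - phi) + (v - psi) by rewrite opprD addrACA.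
have Hup : H1 D (u - phi) by apply: H1B => //; exact: test_H1.
have Hvp : H1 D (v - psi) by apply: H1B => //; exact: test_H1.
move/(H1norm_lt _ e2) : hphi => hphi; move/(H1norm_lt _ e2) : hpsi => hpsi.
apply/H1norm_lt => //; apply: le_lt_trans (_ : 2 * H1sqr (u - phi) + 2 * H1sqr (v - psi) < _).
  have h1 := ip_paral_le (H1_L2 Hup) (H1_L2 Hvp).
  have h2 := ip_grad_paral_le Hup Hvp.
  rewrite /H1sqr; clear hphi hpsi; move: h1 h2.
  set a := ip D (u - phi) (u - phi); set b := ip D (v - psi) (v - psi).
  set c := ip_grad D (u - phi) (u - phi); set c' := ip_grad D (v - psi) (v - psi).
  set q1 := ip D _ _; set q2 := ip_grad D _ _.
  by move: a b c c' q1 q2 => a b c c' q1 q2; lra.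
rewrite expr_div_n in hphi hpsi; move: hphi hpsi.
clear -e0.
by move: (H1sqr _) (H1sqr _) => a b; lra.
Qed.

Lemma H10Z a u : H10 D u -> H10 D (a *: u).
Proof.
move=> [Hu au]; split; first exact: H1Z.
move=> e e0; have a1 : 0 < `|a| + 1 by rewrite ltr_wpDl.
have e2 : 0 < e / (`|a| + 1) by rewrite divr_gt0.
have [phi [tphi hphi]] := au _ e2.
exists (a *: phi); split; first exact: testZ.
have Hup : H1 D (u - phi) by apply: H1B => //; exact: test_H1.
have Lup := H1_L2 Hup.
rewrite -scalerBr; apply/H1norm_lt => //; move/(H1norm_lt _ e2) : hphi.
rewrite /H1sqr ipZl//; last exact: L2Z.
rewrite ipC ipZl// ip_gradZl//; last exact: H1Z.
rewrite ip_gradC ip_gradZl//.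
rewrite expr_div_n ltr_pdivlMr ?exprn_gt0// => h.
have h0 := H1sqr_ge0 (u - phi).
apply: le_lt_trans h; rewrite -/(H1sqr _).
have : a ^+ 2 <= (`|a| + 1) ^+ 2.
  by rewrite -(real_normK (num_real a)) lerXn2r ?nnegrE ?addr_ge0// lerDl.
rewrite /H1sqr in h0 *; move: h0.
by move: (ip D _ _) (ip_grad D _ _) => b c; nra.
Qed.

Let poincare_arith (m e a1 a2 a3 b1 b2 b3 : R) :
  (a3 + b3) * (2 + 16 * m) < e -> a1 <= 2 * a3 + 2 * a2 -> a2 <= 4 * m * b2 ->
  0 <= a3 -> 0 <= b3 -> 0 <= m -> m * b2 <= m * (2 * b3 + 2 * b1) -> 0 <= m * a3 ->
  a1 <= 16 * m * b1 + e.
Proof. by lra. Qed.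

(** Poincare's inequality, obtained from the derivative in one direction. *)
Lemma poincare (i0 : 'I_d) :
  exists2 C : R, 0 <= C & forall u, H10 D u -> ip D u u <= C * ip_grad D u u.
Proof.
have [M M0 DM] := bounded_coord bndD.
have test_case phi : test_function D phi -> ip D phi phi <= 4 * M ^+ 2 * ip_grad D phi phi.
  move=> tphi; pose x0 (x : 'rV[R]_d) := x 0 i0.
  have Lphi := test_L2 tphi.
  have tx : test_function D (x0 * phi) by apply: testM => // k; exact: Ck_coord.
  have Lx := test_L2 tx.
  have Lg := grad_L2 i0 (test_H1 tphi).
  have Ldphi := test_partial_L2 i0 tphi.
  have dx0 x : derivable x0 x (delta_mx 0 i0).
    by have [] := @is_derive_coord R d id (fun=> 1) i0 i0 x (fun y => is_derive_id y 1).
  have px0 : partial i0 x0 = fun=> 1.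
    apply/funext => x; have h := @is_derive_coord R d id (fun=> 1) i0 i0 x (fun y => is_derive_id y 1).
    by rewrite /partial (@derive_val _ _ _ _ _ _ _ h) eqxx mulr1.
  have dphi x : derivable phi x (delta_mx 0 i0) by exact: test_derivable.
  (* integration by parts of phi^2 * d x_i, where the coordinate x_i is bounded by
     M on D *)
  have key : ip D phi phi = - 2 * ip D (grad D phi i0) (x0 * phi).
    have [_ gE] := grad_weak (test_H1 tphi) i0.
    have h1 := gE _ tx; have h2 := test_ibp i0 tphi tx.
    move: h2; rewrite h1 => /eqP; rewrite eqr_opp => /eqP h2.
    have Lp : L2 D (x0 * partial i0 phi).
      apply: continuous_L2 => // x; apply: continuousM; first exact: coord_continuous.
      exact: test_partial_continuous.
    move: h1; rewrite (partialM dx0 dphi) px0 ipC ipDl//; last first.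
      have -> : phi * (fun=> 1) = phi by apply/funext => x; change (phi x * 1 = phi x); rewrite mulr1.
      by [].
    have -> : phi * (fun=> 1) = phi by apply/funext => x; change (phi x * 1 = phi x); rewrite mulr1.
    have -> : ip D (x0 * partial i0 phi) phi = ip D (partial i0 phi) (x0 * phi).
      apply: eq_Rintegral => t _; change (x0 (row t) * partial i0 phi (row t) * phi (row t) =
        partial i0 phi (row t) * (x0 (row t) * phi (row t))); ring.
    by rewrite -h2; lra.
  have xle : ip D (x0 * phi) (x0 * phi) <= M ^+ 2 * ip D phi phi.
    rewrite -ipZl//.
    have sx := (L2_sqint _ _).1 Lx; have sp := (L2_sqint _ _).1 Lphi.
    have sMp := (L2_sqint _ _).1 (L2Z (M ^+ 2) Lphi).
    rewrite !ip_inner; apply: le_Rintegral => //; try exact: sqint_mul.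
    move=> t _; rewrite !extE; case: ifPn => [|_]; last by rewrite !mul0r.
    rewrite inE => /DM/(_ i0) h.
    change (x0 (row t) * phi (row t) * (x0 (row t) * phi (row t)) <=
      M ^+ 2 * phi (row t) * phi (row t)).
    rewrite -[leRHS]mulrA mulrACA -!expr2 ler_wpM2r ?sqr_ge0//.
    rewrite -(real_normK (num_real (x0 _))) lerXn2r ?nnegrE//.
    exact: ltW.
  have gle := ip_partial_le phi i0.
  have cs : ip D (grad D phi i0) (x0 * phi) ^+ 2 <= ip_grad D phi phi * (M ^+ 2 * ip D phi phi).
    have sx := (L2_sqint _ _).1 Lx; have sg := (L2_sqint _ _).1 Lg.
    rewrite ip_inner (le_trans (cauchy_schwarz sg sx))// -!ip_inner.
    by rewrite ler_pM ?ip_ge0.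
  have := ip_ge0 D phi; rewrite le_eqVlt => /predU1P[<-|p0].
    by rewrite mulr_ge0 ?ip_grad_ge0 ?mulr_ge0 ?(ltW M0).
  have : ip D phi phi ^+ 2 <= (4 * M ^+ 2 * ip_grad D phi phi) * ip D phi phi.
    rewrite {1}key exprMn; move: cs.
    move: (ip D (grad D phi i0) (x0 * phi)) (ip_grad D phi phi) (ip D phi phi) => a b c.
    rewrite -(ler_pM2l (x := 4))// => cs'.
    rewrite (_ : (- 2 : R) ^+ 2 = 4); last by ring.
    by apply: le_trans cs' _; rewrite le_eqVlt; apply/orP; left; apply/eqP; ring.
  by rewrite expr2 ler_pM2r.
(* twice 4 * M^2 * 2: u and its gradient are each compared with those of an
   approximating test function by |a + b|^2 <= 2 |a|^2 + 2 |b|^2 *)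
exists (16 * M ^+ 2); first by rewrite mulr_ge0 ?sqr_ge0.
move=> u [Hu au]; apply/ler_addgt0Pr => e e0.
pose c := 2 + 16 * M ^+ 2.
have c0 : 0 < c by rewrite /c -[ltLHS]addr0; apply: ltr_leD => //; exact: mulr_ge0 _ (sqr_ge0 M).
have ec : 0 < Num.sqrt (e / c) by rewrite sqrtr_gt0; exact: divr_gt0 e0 c0.
have [phi [tphi hphi]] := au _ ec.
have Hup : H1 D (u - phi) by apply: H1B => //; exact: test_H1.
have Hphi := test_H1 tphi.
move/(H1norm_lt _ ec) : hphi; rewrite sqr_sqrtr; last exact: ltW (divr_gt0 e0 c0).
move=> hphi.
rewrite (ltr_pdivlMr _ _ c0) in hphi.
have uE : u = (u - phi) + phi by rewrite subrK.
have phiE : phi = (- 1) *: (u - phi) + u by rewrite scaleN1r opprB subrK.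
have Hm : H1 D ((- 1) *: (u - phi)) by exact: H1Z.
have h1 := ip_paral_le (H1_L2 Hup) (H1_L2 Hphi); rewrite -uE in h1.
have h2 := ip_grad_paral_le Hm Hu; rewrite -phiE in h2.
rewrite ip_gradZl// ip_gradC ip_gradZl// in h2.
have h3 := test_case _ tphi.
have p1 := ip_ge0 D (u - phi); have p2 := ip_grad_ge0 (u - phi).
have M2 : 0 <= M ^+ 2 by exact: sqr_ge0.
have h4 : M ^+ 2 * ip_grad D phi phi <=
    M ^+ 2 * (2 * ip_grad D (u - phi) (u - phi) + 2 * ip_grad D u u).
  by apply: (ler_wpM2l M2); move: h2; rewrite !mulN1r opprK.
have h5 : 0 <= M ^+ 2 * ip D (u - phi) (u - phi) by exact: mulr_ge0.
exact: poincare_arith hphi h1 h3 p1 p2 M2 h4 h5.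
Qed.

End sobolev.

(** * The finite element space *)

Section finite_elements.
Context {R : realType} {d : nat}.
Variable D : set 'rV[R]_d.
Hypothesis openD : open D.
Hypothesis bndD : bounded_set D.
Variables (m : nat) (p : 'I_m -> 'I_d.+1 -> 'rV[R]_d).
Hypothesis coveredD : covered p `<=` closure D.
Notation tup := (d.-tuple (measurableTypeR R)).
Local Notation row := (@row_of_tuple R d).
Local Notation V := (Vh D p).
Implicit Types (u v w : 'rV[R]_d -> R).

Lemma Vh_H10 v : V v -> H10 D v. Proof. by case. Qed.

Lemma Vh_H1 v : V v -> H1 D v. Proof. by move=> /Vh_H10/H10_H1. Qed.

Lemma Vh_L2 v : V v -> L2 D v. Proof. by move=> /Vh_H1/H1_L2. Qed.

Lemma VhD u v : V u -> V v -> V (u + v).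
Proof.
move=> [hu cu au zu] [hv cv av zv]; split.
- exact: H10D.
- by move=> x; exact: continuousD (cu x) (cv x).
- move=> j; have [a [b h]] := au j; have [a' [b' h']] := av j.
  exists (a + a'), (b + b') => x xj.
  change (u x + v x = \sum_i (a + a') 0 i * x 0 i + (b + b')).
  rewrite h// h'// addrACA -big_split/=; congr (_ + _).
  by apply: eq_bigr => i _; rewrite mxE mulrDl.
- by move=> x nx; change (u x + v x = 0); rewrite zu// zv// addr0.
Qed.

Lemma VhZ (a : R) u : V u -> V (a *: u).
Proof.
move=> [hu cu au zu]; split.
- exact: H10Z.
- by move=> x; apply: (continuousM _ (cu x)); exact: cst_continuous.
- move=> j; have [b [c h]] := au j.
  exists (a *: b), (a * c) => x xj.
  change (a * u x = \sum_i (a *: b) 0 i * x 0 i + a * c).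
  rewrite h// mulrDr mulr_sumr; congr (_ + _).
  by apply: eq_bigr => i _; rewrite mxE mulrA.
- by move=> x nx; change (a * u x = 0); rewrite zu// mulr0.
Qed.

Lemma VhB u v : V u -> V v -> V (u - v).
Proof. by move=> hu hv; apply: VhD => //; rewrite -scaleN1r; exact: VhZ. Qed.

Hypothesis V0 : V 0.

Lemma Vh_sum (I : Type) (s : seq I) (q : pred I) (F : I -> 'rV[R]_d -> R) :
  (forall i, q i -> V (F i)) -> V (\sum_(i <- s | q i) F i).
Proof. by move=> h; elim/big_ind : _ => // u v; exact: VhD. Qed.

Lemma leb_qcube_gt0 k : 0 < ratr k.2 :> R ->
  (0 < leb d (row @^-1` (@qcube R d k) : set tup))%E.
Proof.
move=> k0.
have -> : row @^-1` (@qcube R d k) = tbox (fun i => (`]ratr (k.1 i) - ratr k.2,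
    ratr (k.1 i) + ratr k.2[%classic : set (measurableTypeR R))).
  apply/seteqP; split=> t h i; have := h i; rewrite /= /row_of_tuple mxE in_itv/= ltr_distl//.
rewrite leb_tbox; last by move=> i; exact: measurable_itv.
elim/big_ind : _ => // [x y x0 y0|i _]; first exact: mule_gt0.
rewrite lebesgue_measure_itv/= lte_fin ifT; last by lra.
by rewrite -EFinB lte_fin; lra.
Qed.

(** The inner product of L^2(D) separates the finite element functions: these are
    continuous, and vanish out of the closure of D. *)
Lemma Vh_definite v : V v -> ip D v v = 0 -> v = 0.
Proof.
move=> Vv vv0; have [hv cv _ zv] := Vv.
have [_ sv] := L2_sqint D v; have {sv}sv := (L2_sqint D v).1 (Vh_L2 Vv).
have ae0 : {ae leb d, forall t, ext D v t = 0}.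
  by apply: inner_eq0 => //; rewrite -ip_inner.
have vD x : D x -> v x = 0.
  move=> Dx; apply: contrapT => /eqP vx0.
  pose O := D `&` (v @^-1` [set y | y != 0]).
  have oO : open O.
    apply: openI => //; move/continuousP : cv; apply.
    exact: open_neq.
  have [k [k0 kx kO]] := open_qcube oO (conj Dx vx0).
  have := leb_qcube_gt0 k0; case: ae0 => N [mN N0 subN].
  have -> : leb d (row @^-1` (qcube k)) = 0%E.
    apply/eqP; rewrite -measure_le0 -N0; apply: le_measure; rewrite ?inE//.
      exact: qcube_meas.
    move=> t kt; apply: subN => /= e0.
    have [Dt /eqP vt] : O (row t) by apply: kO => i; exact/ltW/kt.
    by apply: vt; move: e0; rewrite extE mem_set.
  by rewrite ltxx.
have vcl x : closure D x -> v x = 0.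
  have cl : closed (v @^-1` [set 0]).
    by apply: (continuous_closedP _).1 cv _ _; exact: closed_eq.
  move=> clx; have : closure (v @^-1` [set 0]) x.
    by apply: closure_subset clx => y Dy; exact: vD.
  by rewrite -(closure_id _).1.
apply/funext => x; have [cx|ncx] := pselect (covered p x); last exact: zv.
by apply: vcl; exact: coveredD.
Qed.

(** A finite element function is determined by its values at the vertices. *)
Lemma Vh_vertices v : V v -> (forall j i, v (p j i) = 0) -> v = 0.
Proof.
move=> [_ _ av zv] vp0; apply/funext => x.
have [[j xj]|ncx] := pselect (covered p x); last exact: zv.
have [a [b vab]] := av j; rewrite vab//.
have psimp i : simplex (p j) (p j i).
  exists (fun k => (k == i)%:R); split.
  - by move=> k; exact: ler0n.
  - by move=> k; rewrite inE.
  - by rewrite (bigD1 i)//= eqxx big1 ?addr0// => k /negbTE ->.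
  - rewrite (bigD1 i)//= eqxx scale1r big1 ?addr0// => k /negbTE ->.
    by rewrite scale0r.
case: xj => c [_ _ c1 ->].
transitivity (\sum_i c i * (\sum_k a 0 k * p j i 0 k + b)).
  rewrite (eq_bigr (fun i => c i * (\sum_k a 0 k * p j i 0 k) + c i * b)); last first.
    by move=> i _; rewrite mulrDr.
  rewrite big_split/= -mulr_suml c1 mul1r; congr (_ + _).
  rewrite (eq_bigr (fun k => \sum_i c i * (a 0 k * p j i 0 k))); last first.
    move=> k _; rewrite summxE mulr_sumr; apply: eq_bigr => i _.
    by rewrite mxE mulrCA.
  by rewrite exchange_big/=; apply: eq_bigr => i _; rewrite mulr_sumr.
apply: big1 => i _; rewrite -vab; last exact: psimp.
by rewrite vp0 mulr0.
Qed.

Lemma ip_suml (I : Type) (s : seq I) (F : I -> 'rV[R]_d -> R) w :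
  (forall i, V (F i)) -> V w ->
  ip D (\sum_(i <- s) F i) w = \sum_(i <- s) ip D (F i) w.
Proof.
move=> VF Vw; elim: s => [|i s IH].
  rewrite !big_nil; have -> : (0 : 'rV[R]_d -> R) = 0 *: w by rewrite scale0r.
  by rewrite ipZl ?mul0r//; exact: Vh_L2.
rewrite !big_cons ipDl ?IH//; try exact: Vh_L2.
by apply: Vh_L2; apply: Vh_sum.
Qed.

Lemma ip_lin n (c : 'I_n -> R) (e : 'I_n -> 'rV[R]_d -> R) w :
  (forall i, V (e i)) -> V w ->
  ip D (\sum_i c i *: e i) w = \sum_i c i * ip D (e i) w.
Proof.
move=> Ve Vw; rewrite ip_suml//; last by move=> i; exact: VhZ.
by apply: eq_bigr => i _; rewrite ipZl//; exact: Vh_L2.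
Qed.

(** Families orthonormal in L^2(D). *)
Definition orthonormal_family n (e : 'I_n -> 'rV[R]_d -> R) :=
  (forall i, V (e i)) /\ forall i j, ip D (e i) (e j) = (i == j)%:R.

Lemma orthonormal_family_size n (e : 'I_n -> 'rV[R]_d -> R) : orthonormal_family e ->
  (n <= #|{: 'I_m * 'I_d.+1}|)%N.
Proof.
move=> [Ve oe].
pose E : 'M[R]_(n, #|{: 'I_m * 'I_d.+1}|) :=
  \matrix_(i, k) e i (p (enum_val k).1 (enum_val k).2).
suff : row_free E by rewrite -row_leq_rank => /leq_trans; apply; exact: rank_leq_col.
rewrite -kermx_eq0; apply/rowV0P => a /sub_kermxP aE.
have z : \sum_i a 0 i *: e i = 0.
  apply: Vh_vertices; first by apply: Vh_sum => i _; exact: VhZ.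
  move=> j i; have /rowP/(_ (enum_rank (j, i))) := aE.
  rewrite !mxE => h; rewrite -[RHS]h fct_sumE; apply: eq_bigr => k _.
  by rewrite mxE enum_rankK.
apply/rowP => k; rewrite mxE.
have : ip D (\sum_i a 0 i *: e i) (e k) = a 0 k.
  rewrite ip_lin// (bigD1 k)//= oe eqxx mulr1 big1 ?addr0// => i /negbTE ik.
  by rewrite oe ik mulr0.
rewrite z => <-; have -> : (0 : 'rV[R]_d -> R) = 0 *: e k by rewrite scale0r.
by rewrite ipZl ?mul0r//; exact: Vh_L2.
Qed.

(** The finite element space has an orthonormal basis: an orthonormal family of
    maximal size. *)
Lemma Vh_orthonormal_basis : exists n (e : 'I_n -> 'rV[R]_d -> R),
  orthonormal_family e /\ forall v, V v -> v = \sum_i ip D v (e i) *: e i.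
Proof.
pose P n := `[< exists e : 'I_n -> 'rV[R]_d -> R, orthonormal_family e >].
have P0 : exists n, P n.
  exists 0%N; apply/asboolP; exists (fun _ => 0); split; first by case.
  by case.
have PK n : P n -> (n <= #|{: 'I_m * 'I_d.+1}|)%N.
  by move=> /asboolP[e]; exact: orthonormal_family_size.
case: (ex_maxnP P0 PK) => n /asboolP[e [Ve oe]] nmax.
exists n, e; split=> // v Vv.
(* a nonzero remainder could be normalized and added to the family *)
pose w := v - \sum_i ip D v (e i) *: e i.
have Vs : V (\sum_i ip D v (e i) *: e i) by apply: Vh_sum => i _; exact: VhZ.
have Vw : V w by exact: VhB.
have we k : ip D w (e k) = 0.
  rewrite ipBl; [|exact: Vh_L2..].
  rewrite ip_lin// (bigD1 k)//= oe eqxx mulr1 big1 ?addr0 ?subrr// => i /negbTE ik.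
  by rewrite oe ik mulr0.
suff w0 : w = 0 by apply/eqP; rewrite -subr_eq0; apply/eqP.
apply: Vh_definite => //; apply: contrapT => /eqP ww.
have ww0 : 0 < ip D w w by rewrite lt_neqAle eq_sym ww ip_ge0.
pose c := (Num.sqrt (ip D w w))^-1.
suff : (n.+1 <= n)%N by rewrite ltnn.
apply: nmax; apply/asboolP.
exists (fun i => oapp e (c *: w) (unlift ord0 i)); split.
  by move=> i; case: unliftP => [k _|_] /=; [exact: Ve|exact: VhZ].
move=> i j; case: (unliftP ord0 i) => [k ->|->]; case: (unliftP ord0 j) => [l ->|->].
- by rewrite /= oe (inj_eq lift_inj).
- rewrite /= ipC ipZl ?we ?mulr0; [|exact: Vh_L2..].
  by [].
- rewrite /= ipZl ?we ?mulr0; [|exact: Vh_L2..].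
  by [].
- rewrite /= ipZl; [|exact: Vh_L2|apply: Vh_L2; exact: VhZ].
  rewrite ipC ipZl; [|exact: Vh_L2..].
  rewrite /c mulrA -invfM -expr2 sqr_sqrtr ?ltW// mulVf//.
Qed.

Section basis.
Variables (n : nat) (e : 'I_n -> 'rV[R]_d -> R).
Hypothesis oe : orthonormal_family e.
Hypothesis basis : forall v, V v -> v = \sum_i ip D v (e i) *: e i.
Let Ve := oe.1.

(** Coordinates in an orthonormal basis. *)
Definition basis_coord (i : 'I_n) v : R := ip D v (e i).

Lemma coordD i u v : V u -> V v -> basis_coord i (u + v) = basis_coord i u + basis_coord i v.
Proof. by move=> Vu Vv; rewrite /basis_coord ipDl//; exact: Vh_L2. Qed.

Lemma coordB i u v : V u -> V v -> basis_coord i (u - v) = basis_coord i u - basis_coord i v.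
Proof. by move=> Vu Vv; rewrite /basis_coord ipBl//; exact: Vh_L2. Qed.

Lemma coordZ i a v : V v -> basis_coord i (a *: v) = a * basis_coord i v.
Proof. by move=> Vv; rewrite /basis_coord ipZl//; exact: Vh_L2. Qed.

Lemma ip_coord u v : V u -> V v -> ip D u v = \sum_i basis_coord i u * basis_coord i v.
Proof.
move=> Vu Vv; rewrite {1}(basis Vu) ip_lin//.
by apply: eq_bigr => i _; rewrite /basis_coord (ipC D v).
Qed.

Lemma coord_lin (c : 'I_n -> R) k : basis_coord k (\sum_i c i *: e i) = c k.
Proof.
rewrite /basis_coord ip_lin// (bigD1 k)//= oe.2 eqxx mulr1 big1 ?addr0// => i /negbTE ik.
by rewrite oe.2 ik mulr0.
Qed.

Lemma coord_le i v : V v -> `|basis_coord i v| <= L2norm D v.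
Proof.
move=> Vv; have := ip_norm_le (Vh_L2 Vv) (Vh_L2 (Ve i)).
by rewrite [X in _ * X]/L2norm (oe.2 i i) eqxx sqrtr1 mulr1.
Qed.

(** The stiffness matrix. *)
Definition stiff : 'M[R]_n := \matrix_(i, j) ip_grad D (e i) (e j).

Lemma ip_grad_lin (c : 'I_n -> R) w : V w ->
  ip_grad D (\sum_i c i *: e i) w = \sum_i c i * ip_grad D (e i) w.
Proof.
move=> Vw; have VZ i : V (c i *: e i) by exact: VhZ.
elim: (index_enum _) => [|i s IH].
  rewrite !big_nil; have -> : (0 : 'rV[R]_d -> R) = 0 *: w by rewrite scale0r.
  by rewrite ip_gradZl ?mul0r//; exact: Vh_H1.
rewrite !big_cons ip_gradDl ?IH ?ip_gradZl//; try exact: Vh_H1.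
by apply: Vh_H1; apply: Vh_sum.
Qed.

Lemma ip_grad_coord u v : V u -> V v ->
  ip_grad D u v = \sum_i \sum_j basis_coord i u * stiff i j * basis_coord j v.
Proof.
move=> Vu Vv; rewrite {1}(basis Vu) ip_grad_lin//.
apply: eq_bigr => i _; rewrite ip_gradC {1}(basis Vv) ip_grad_lin// mulr_sumr.
apply: eq_bigr => j _; rewrite mxE ip_gradC /basis_coord.
by rewrite -[RHS]mulrA; congr (_ * _); rewrite mulrC.
Qed.

Lemma stiff_sym i j : stiff i j = stiff j i.
Proof. by rewrite !mxE ip_gradC. Qed.

Lemma stiff_psd (c : 'I_n -> R) : 0 <= \sum_i \sum_j c i * stiff i j * c j.
Proof.
have Vc : V (\sum_i c i *: e i) by apply: Vh_sum => i _; exact: VhZ.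
have := ip_grad_ge0 D (\sum_i c i *: e i); rewrite ip_grad_coord//.
by under eq_bigr do under eq_bigr do rewrite !coord_lin.
Qed.

Lemma coord_laplacian Dh i v : is_discrete_laplacian D V Dh -> V v ->
  basis_coord i (Dh v) = - \sum_j stiff i j * basis_coord j v.
Proof.
move=> hDh Vv; have [_ h] := hDh v Vv.
rewrite /basis_coord (h _ (Ve i)) ip_grad_coord//; congr (- _).
rewrite exchange_big/= (bigD1 i)//= [X in _ + X]big1 ?addr0; last first.
  move=> j /negbTE ji; apply: big1 => k _.
  by rewrite /basis_coord oe.2 eq_sym ji mulr0.
by apply: eq_bigr => j _; rewrite /basis_coord oe.2 eqxx mulr1 stiff_sym mulrC.
Qed.

Lemma sqrt_scale_le (a b c f C : R) : 0 <= C -> 0 <= c -> 0 <= f -> b <= f ->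
  a <= C * b -> Num.sqrt a <= Num.sqrt C * Num.sqrt (c + f).
Proof.
move=> C0 c0 f0 bf ab; rewrite -sqrtrM// ler_sqrt ?mulr_ge0 ?addr_ge0//.
apply: le_trans ab _; apply: ler_wpM2l => //.
by rewrite -[leLHS]add0r lerD.
Qed.

(** The Ritz projection is a contraction for the norm of the gradient, and
    Poincare's inequality bounds the L^2 norm by the latter. *)
Lemma ritz_lipschitz Rh (i0 : 'I_d) : is_ritz_projection D V Rh ->
  exists2 C : R, 0 <= C & forall u v i, H10 D u -> H10 D v ->
    `|basis_coord i (Rh u) - basis_coord i (Rh v)| <= C * H1norm D (u - v).
Proof.
move=> hRh; have [C C0 hC] := poincare openD bndD i0.
exists (Num.sqrt C); first exact: sqrtr_ge0.
move=> u v i Hu Hv; have [Vu ou] := hRh u Hu; have [Vv ov] := hRh v Hv.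
pose w := Rh u - Rh v; have Vw : V w by exact: VhB.
have gw : ip_grad D w w = ip_grad D (u - v) w.
  have H1u := H10_H1 Hu; have H1v := H10_H1 Hv.
  have H1w := Vh_H1 Vw; have H1Ru := Vh_H1 Vu; have H1Rv := Vh_H1 Vv.
  have := ou w Vw; have := ov w Vw.
  rewrite (ip_gradBl openD bndD H1Ru H1u H1w) (ip_gradBl openD bndD H1Rv H1v H1w).
  rewrite (ip_gradBl openD bndD H1u H1v H1w) => ev eu.
  have -> : ip_grad D w w = ip_grad D (Rh u) w - ip_grad D (Rh v) w.
    exact: (ip_gradBl openD bndD H1Ru H1Rv H1w).
  move: (ip_grad D (Rh u) w) (ip_grad D (Rh v) w) (ip_grad D u w) (ip_grad D v w) ev eu.
  by move=> a b c e' /subr0_eq -> /subr0_eq ->.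

have Huv : H1 D (u - v) by apply: (H1B openD bndD); exact: H10_H1.
have gle : ip_grad D w w <= ip_grad D (u - v) (u - v).
  have := ip_grad_ge0 D (u - v - w); have H1w := Vh_H1 Vw.
  rewrite (ip_grad_sqrB openD bndD Huv H1w) -gw; move: (ip_grad D w w) (ip_grad D (u - v) (u - v)).
  move=> a b; rewrite (_ : _ + _ = b - a); last by ring.
  by rewrite subr_ge0.
have -> : basis_coord i (Rh u) - basis_coord i (Rh v) = basis_coord i w by rewrite (coordB i Vu Vv).
apply: le_trans (coord_le i Vw) _.
exact: sqrt_scale_le C0 (ip_ge0 D _) (ip_grad_ge0 D _) gle (hC _ (Vh_H10 Vw)).
Qed.

End basis.
End finite_elements.

(** * Measurability of processes *)

Section measurability_free.
Context {dT : measure_display} {T : measurableType dT} {R : realType}.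
Variable mu : {measure set T -> \bar R}.

(** Monotonicity of the integral of nonnegative functions holds without any
    measurability, as this integral is a supremum over simple functions. *)
Lemma ge0_le_integral_sup (D : set T) (f g : T -> \bar R) :
  (forall x, D x -> 0 <= f x)%E -> (forall x, D x -> f x <= g x)%E ->
  (\int[mu]_(x in D) f x <= \int[mu]_(x in D) g x)%E.
Proof.
move=> f0 fg; have g0 x : D x -> (0 <= g x)%E.
  by move=> Dx; rewrite (le_trans (f0 x Dx)) ?fg.
rewrite !ge0_integralE//; apply: ge_ereal_sup => _ [h hf <-].
apply: ereal_sup_ubound; exists h => // x; apply: le_trans (hf x) _.
exact: lee_restrict.
Qed.

Lemma measurable_fun_rays (D : set T) (f : T -> R) : measurable D ->
  (forall a : R, measurable (D `&` [set x | a < f x])) -> measurable_fun D f.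
Proof.
move=> mD h; apply: (measurability _ (RGenOInfty.measurableE R)) => _ [_ [a ->] <-].
rewrite (_ : _ `&` _ = D `&` [set x | a < f x]); first exact: h.
by apply/seteqP; split=> x /= [Dx]; rewrite in_itv/= andbT.
Qed.

(** On a complete space, integrals do not see a.e. modifications. *)
Lemma Rint_ae_complete (f g : T -> R) : measure_is_complete mu ->
  measurable_fun setT g -> {ae mu, forall x, f x = g x} ->
  \int[mu]_x f x = \int[mu]_x g x.
Proof.
move=> cmu mg fg.
have mf : measurable_fun setT f.
  apply/measurable_EFinP; apply: (@ae_measurable_fun _ _ _ mu cmu setT (EFin \o g)).
    by apply: filterS fg => x /= ->.
  exact/measurable_EFinP.
exact: Rint_ae.
Qed.

Lemma inner_EFin (f : T -> R) : sqint mu f ->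
  ((inner mu f f)%:E = \int[mu]_x (f x ^+ 2)%:E)%E.
Proof.
move=> [_ If]; rewrite /inner /Rintegral; under eq_integral do rewrite -expr2.
by rewrite fineK//; exact: integrable_fin_num.
Qed.

Lemma sqint_lty (f : T -> R) : measurable_fun setT f ->
  (\int[mu]_x (f x ^+ 2)%:E < +oo)%E -> sqint mu f.
Proof.
move=> mf foo; split=> //; apply/integrableP; split.
  by apply/measurable_EFinP; exact: measurable_funX.
by under eq_integral do rewrite /= ger0_norm ?sqr_ge0//.
Qed.

End measurability_free.

Section cutoff.
Context {dO : measure_display} {Omega : measurableType dO} {R : realType}.
Variables (P : probability Omega R) (T : R).
Hypothesis T0 : 0 < T.
Notation leb1 := (@lebesgue_measure R).
Notation M := (P \x leb1)%E.
Implicit Types (f : R -> Omega -> R).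

(** A process on [0, T], extended by zero to the whole time axis. *)
Definition cutoff f : Omega * measurableTypeR R -> R :=
  fun q => if 0 <= q.2 <= T then f q.2 q.1 else 0.

Lemma cutoff_in f w (t : R) : 0 <= t <= T -> cutoff f (w, t) = f t w.
Proof. by rewrite /cutoff/= => ->. Qed.

Lemma grid_le (k j : nat) : (j <= k.+1)%N -> 0 <= j%:R * (T / k.+1%:R) <= T.
Proof.
move=> jk; have k0 : (0 : R) < k.+1%:R by rewrite ltr0n.
rewrite (mulr_ge0 (ler0n _ _) (divr_ge0 (ltW T0) (ltW k0)))/=.
by rewrite mulrCA ger_pMr// ler_pdivrMr// mul1r ler_nat.
Qed.

Lemma grid_point (k : nat) (t : R) : 0 <= t < T -> exists2 j : 'I_k.+1,
  j%:R * (T / k.+1%:R) <= t < j.+1%:R * (T / k.+1%:R) &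
  forall i : 'I_k.+1, i != j ->
    ~~ (i%:R * (T / k.+1%:R) <= t < i.+1%:R * (T / k.+1%:R)).
Proof.
move=> /andP[t0 tT]; set dl := T / k.+1%:R.
have d0 : 0 < dl by rewrite divr_gt0.
have td0 : 0 <= t / dl by exact: divr_ge0 t0 (ltW d0).
have /andP[jt tj] := truncn_itv td0; set j := Num.truncn (t / dl) in jt tj.
have jk : (j < k.+1)%N.
  rewrite -(ltr_nat R); apply: le_lt_trans jt _.
  by rewrite ltr_pdivrMr// /dl mulrCA divff ?mulr1// pnatr_eq0.
exists (Ordinal jk).
  by rewrite -ler_pdivlMr// jt -ltr_pdivrMr.
move=> i; apply: contra => /andP[it ti]; apply/eqP/val_inj => /=.
have h1 : (i < j.+1)%N.
  by rewrite -(ltr_nat R) (le_lt_trans _ tj)// ler_pdivlMr.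
have h2 : (j < i.+1)%N.
  by rewrite -(ltr_nat R) (le_lt_trans jt)// ltr_pdivrMr.
by apply/eqP; rewrite eqn_leq -ltnS h1 -ltnS h2.
Qed.

(** Processes with continuous paths are jointly measurable. *)
Lemma cutoff_meas_paths f : (forall t, 0 <= t <= T -> measurable_fun setT (f t)) ->
  (forall w t, 0 <= t <= T -> forall e : R, 0 < e -> exists2 dl : R, 0 < dl &
    forall s, 0 <= s <= T -> `|s - t| < dl -> `|f s w - f t w| < e) ->
  measurable_fun setT (cutoff f).
Proof.
move=> mf cf.
(* the process is the limit of its step interpolations on regular grids; the
   time T, which belongs to no half-open step, is treated apart *)
pose I (k : nat) (j : 'I_k.+1) : set (measurableTypeR R) :=
  `[j%:R * (T / k.+1%:R), j.+1%:R * (T / k.+1%:R)[%classic.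
pose h (k : nat) (q : Omega * measurableTypeR R) : R :=
  \sum_(j < k.+1) f (j%:R * (T / k.+1%:R)) q.1 * \1_(I k j) q.2 +
  f T q.1 * \1_(`[T, T]%classic : set (measurableTypeR R)) q.2.
have jT (k : nat) (j : 'I_k.+1) : 0 <= j%:R * (T / k.+1%:R) <= T.
  by apply: grid_le; exact: ltnW.
have mterm (t : R) (A : set (measurableTypeR R)) : 0 <= t <= T -> measurable A ->
    measurable_fun setT (fun q : Omega * measurableTypeR R => f t q.1 * \1_A q.2).
  move=> tT mA; apply: measurable_funM.
    by apply: measurableT_comp; [exact: mf|exact: measurable_fst].
  by apply: measurableT_comp; [exact: measurable_indic|exact: measurable_snd].
apply: (@measurable_fun_cvg _ _ _ setT h).
  move=> k; apply: measurable_funD; last by apply: mterm; rewrite ?lexx ?ltW.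
  apply: measurable_sum => j; apply: mterm; last exact: measurable_itv.
  exact: jT.
case=> w; change (forall t : R, setT (w, t) -> h ^~ (w, t) @ \oo --> cutoff f (w, t)).
move=> t _; rewrite /cutoff/=.
have indE (A : set R) (b : bool) : (A t <-> b) -> \1_A t = b%:R :> R.
  move=> Ab; rewrite indicE; congr (nat_of_bool _)%:R.
  by apply/idP/idP; rewrite inE => /Ab.
have IE (k : nat) (j : 'I_k.+1) :
    \1_(I k j) t = ((j%:R * (T / k.+1%:R) <= (t : R)) && ((t : R) < j.+1%:R * (T / k.+1%:R)))%:R :> R.
  by apply: indE; rewrite /I /= in_itv/=.
have TE : \1_(`[T, T]%classic : set R) t = (t == T)%:R :> R.
  by apply: indE; rewrite /= in_itv/= eq_le andbC.
have [/andP[t0]|tn] := boolP (0 <= t <= T); last first.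
  apply: cvg_near_cst; apply: nearW => k; rewrite /h/= TE.
  rewrite (_ : (t == T) = false) ?mulr0 ?addr0; last first.
    by apply: contraNF tn => /eqP ->; rewrite lexx ltW.
  apply: big1 => j _; rewrite IE (_ : (_ <= t < _) = false) ?mulr0//.
  apply: contraNF tn => /andP[jt tj]; have /andP[j0 _] := jT k j.
  rewrite (le_trans j0)//=; apply: le_trans (ltW tj) _.
  by have /andP[] := grid_le (ltn_ord j).
rewrite le_eqVlt => /predU1P[->|tT].
  apply: cvg_near_cst; apply: nearW => k; rewrite /h/= -[RHS]add0r; congr (_ + _).
    apply: big1 => j _; rewrite indicE memNset ?mulr0// /I/= in_itv/= => /andP[_].
    rewrite ltNge => /negP; apply.
    by have /andP[] := grid_le (ltn_ord j).
  by rewrite indicE mem_set ?mulr1//= in_itv/= lexx.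
apply/cvgrPdist_lt => e e0.
have tTT : 0 <= t <= T by rewrite t0 ltW.
have [dl d0 hd] := cf w t tTT e e0.
have : \forall k \near \oo, T / k.+1%:R < dl.
  have /cvgrPdist_lt/(_ (dl / T)) := @cvg_harmonic R.
  rewrite divr_gt0// => /(_ isT); apply: filterS => k.
  rewrite /harmonic/= sub0r normrN ger0_norm ?invr_ge0// => hk.
  by rewrite mulrC -ltr_pdivlMr.
apply: filterS => k hk; have [j jt jn] := grid_point k (introT andP (conj t0 tT)).
have -> : h k (w, t) = f (j%:R * (T / k.+1%:R)) w.
  rewrite /h/= TE lt_eqF// mulr0 addr0 (bigD1 j)//= IE jt mulr1.
  rewrite big1 ?addr0// => i ij; rewrite IE; move: (jn i ij) => /negbTE ->.
  by rewrite mulr0.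
rewrite distrC; apply: hd; first exact: jT.
case/andP : jt => jt tj; rewrite ler0_norm ?subr_le0// opprB.
apply: le_lt_trans hk; rewrite lerBlDl; apply: ltW.
by move: tj; rewrite -natr1 mulrDl mul1r.
Qed.

(** Square integrability on the product space, from a bound G on the squares that
    need not be measurable. *)
Lemma sqint_cutoff f (G : R -> Omega -> R) : measurable_fun setT (cutoff f) ->
  (forall t w, 0 <= t <= T -> f t w ^+ 2 <= G t w) ->
  (\int[P]_w \int[leb1]_(t in `[0%R, T]) (G t w)%:E < +oo)%E ->
  sqint M (cutoff f) /\ ((inner M (cutoff f) (cutoff f))%:E <=
    \int[P]_w \int[leb1]_(t in `[0%R, T]) (G t w)%:E)%E.
Proof.
move=> mf fG Goo.
have le : (\int[M]_q (cutoff f q ^+ 2)%:E <=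
    \int[P]_w \int[leb1]_(t in `[0%R, T]) (G t w)%:E)%E.
  rewrite fubini_tonelli1//; first last.
  - by move=> q; rewrite lee_fin sqr_ge0.
  - by apply/measurable_EFinP; exact: measurable_funX.
  apply: ge0_le_integral_sup => w _.
    by apply: integral_ge0 => t _; rewrite lee_fin sqr_ge0.
  rewrite /fubini_F [leRHS]integral_mkcond; apply: ge0_le_integral_sup => t _.
    by rewrite lee_fin sqr_ge0.
  rewrite patchE /cutoff/=; case: ifPn => tT.
    by rewrite mem_set ?lee_fin ?fG//= in_itv.
  by rewrite memNset ?expr0n//= in_itv/=; exact/negP.
have s : sqint M (cutoff f) by apply: sqint_lty => //; exact: le_lt_trans Goo.
by split=> //; rewrite inner_EFin.
Qed.

(** Processes with continuous paths and square integrable supremum. *)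
Lemma sqint_paths f (S : Omega -> \bar R) :
  (forall t, 0 <= t <= T -> measurable_fun setT (f t)) ->
  (forall w t, 0 <= t <= T -> forall e : R, 0 < e -> exists2 dl : R, 0 < dl &
    forall s, 0 <= s <= T -> `|s - t| < dl -> `|f s w - f t w| < e) ->
  (forall t w, 0 <= t <= T -> ((f t w ^+ 2)%:E <= S w)%E) ->
  (\int[P]_w S w < +oo)%E ->
  sqint M (cutoff f) /\ forall t, 0 <= t <= T -> sqint P (f t).
Proof.
move=> mf cf fS Soo; have mc := cutoff_meas_paths mf cf; split; last first.
  move=> t tT; apply: sqint_lty; first exact: mf.
  apply: le_lt_trans Soo; apply: ge0_le_integral_sup => w _; last exact: fS.
  by rewrite lee_fin sqr_ge0.
have mc2 : measurable_fun setT (fun q => (cutoff f q ^+ 2)%:E).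
  by apply/measurable_EFinP; exact: measurable_funX.
apply: sqint_lty => //; rewrite fubini_tonelli1//; last first.
  by move=> q; rewrite lee_fin sqr_ge0.
set H := fubini_F _ _.
have H0 w : (0 <= H w)%E by apply: integral_ge0 => t _; rewrite lee_fin sqr_ge0.
have mH : measurable_fun setT H.
  by apply: measurable_fun_fubini_tonelli_F => // q; rewrite lee_fin sqr_ge0.
(* S may fail to be measurable: the factor T is kept on the measurable side *)
have HS w : ((T^-1)%:E * H w <= S w)%E.
  rewrite /H /fubini_F.
  have S0 : (0 <= S w)%E.
    apply: le_trans (fS 0 w _); first by rewrite lee_fin sqr_ge0.
    by rewrite lexx (ltW T0).
  move: S0; case SE : (S w) => [r| |]; rewrite ?leey// => r0.
  have : (\int[leb1]_t (cutoff f (w, t) ^+ 2)%:E <=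
      \int[leb1]_(t in `[0%R, T]) r%:E)%E.
    rewrite [leRHS]integral_mkcond; apply: ge0_le_integral_sup => t _.
      by rewrite lee_fin sqr_ge0.
    rewrite patchE /cutoff/=; case: ifPn => tT.
      by rewrite mem_set ?in_itv//= -SE; exact: fS.
    by rewrite memNset ?expr0n//= in_itv/=; exact/negP.
  rewrite integral_cst//= lebesgue_measure_itv/= lte_fin T0 oppr0 adde0 -EFinM => le.
  apply: le_trans (lee_wpmul2l _ le) _; first by rewrite lee_fin invr_ge0 (ltW T0).
  by rewrite -EFinM lee_fin mulrCA mulVf ?mulr1// gt_eqF.
have : (\int[P]_w ((T^-1)%:E * H w) < +oo)%E.
  apply: le_lt_trans Soo; apply: ge0_le_integral_sup => w _; last exact: HS.
  by rewrite mule_ge0// lee_fin invr_ge0 (ltW T0).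
rewrite ge0_integralZl//; last by rewrite lee_fin invr_ge0 (ltW T0).
case: (\int[P]_w H w)%E => [r _| |_]; [exact: ltry| |by rewrite ltNye].
by rewrite gt0_muley// lte_fin invr_gt0.
Qed.

End cutoff.

(** * Processes in coordinates *)

(** A finite-dimensional function space, described by a basis [e], the
    coordinates [c] in this basis, and a norm that dominates them. *)
Record coordinates (R : realType) d (K : fspace R d) n
    (e : 'I_n -> 'rV[R]_d -> R) (c : 'I_n -> ('rV[R]_d -> R) -> R) : Prop :=
  Coordinates {
    crd_0 : K 0 ;
    crd_mem : forall i, K (e i) ;
    crd_closedD : forall u v, K u -> K v -> K (u + v) ;
    crd_closedZ : forall a u, K u -> K (a *: u) ;
    crd_add : forall i u v, K u -> K v -> c i (u + v) = c i u + c i v ;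
    crd_scale : forall i a u, K u -> c i (a *: u) = a * c i u ;
    crd_expand : forall v, K v -> v = \sum_i c i v *: e i ;
    crd_lin : forall (a : 'I_n -> R) i, c i (\sum_j a j *: e j) = a i ;
    crd_norm : forall i v, K v -> `|c i v| <= fnorm K v }.

Section coordinate_algebra.
Context {R : realType} {d : nat} (K : fspace R d) (n : nat).
Variables (e : 'I_n -> 'rV[R]_d -> R) (c : 'I_n -> ('rV[R]_d -> R) -> R).
Hypothesis hc : coordinates K e c.
Implicit Types (u v : 'rV[R]_d -> R).

Lemma crd_closedB u v : K u -> K v -> K (u - v).
Proof.
move=> Ku Kv; rewrite -scaleN1r; apply: (crd_closedD hc Ku).
exact: (crd_closedZ hc).
Qed.

Lemma crd_sub i u v : K u -> K v -> c i (u - v) = c i u - c i v.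
Proof.
move=> Ku Kv; rewrite -scaleN1r (crd_add hc)//; last exact: (crd_closedZ hc).
by rewrite (crd_scale hc)// mulN1r.
Qed.

Lemma crd_zero i : c i 0 = 0.
Proof. by rewrite -(scale0r (0 : 'rV[R]_d -> R)) (crd_scale hc) ?mul0r//; exact: (crd_0 hc). Qed.

Lemma crd_sum (I : Type) (s : seq I) (q : pred I) (F : I -> 'rV[R]_d -> R) :
  (forall j, q j -> K (F j)) ->
  K (\sum_(j <- s | q j) F j) /\
  forall i, c i (\sum_(j <- s | q j) F j) = \sum_(j <- s | q j) c i (F j).
Proof.
move=> KF; elim: s => [|j s [K1 c1]].
  by rewrite big_nil; split=> [|i]; [exact: (crd_0 hc)|rewrite big_nil crd_zero].
rewrite big_cons; case: ifPn => qj; last first.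
  by split=> // i; rewrite big_cons (negbTE qj).
split; first exact: (crd_closedD hc (KF _ qj)).
by move=> i; rewrite big_cons qj (crd_add hc)// ?c1//; exact: KF.
Qed.

Lemma Rint_sum_on (D : set R) (I : Type) (s : seq I) (F : I -> R -> R) :
  measurable D ->
  (forall i, (@lebesgue_measure R).-integrable D (EFin \o F i)) ->
  (@lebesgue_measure R).-integrable D (EFin \o (fun t => \sum_(i <- s) F i t)) /\
  \int[@lebesgue_measure R]_(t in D) (\sum_(i <- s) F i t) =
  \sum_(i <- s) \int[@lebesgue_measure R]_(t in D) F i t.
Proof.
move=> mD IF; elim: s => [|i s [I1 E1]].
  split.
    rewrite (_ : _ \o _ = cst 0%E); first exact: integrable0.
    by apply/funext => t /=; rewrite big_nil.
  by rewrite big_nil; under eq_Rintegral do rewrite big_nil; rewrite /Rintegral integral0.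
have E : (fun t => \sum_(j <- i :: s) F j t) = (fun t => F i t + \sum_(j <- s) F j t).
  by apply/funext => t; rewrite big_cons.
rewrite E big_cons -E1; split; last exact: RintegralD.
rewrite (_ : _ \o _ = ((EFin \o F i) \+ (EFin \o (fun t => \sum_(j <- s) F j t)%R))%E); last by [].
exact: (@integrableD _ (measurableTypeR R) R (@lebesgue_measure R) D mD _ _ (IF i) I1).
Qed.

(** The pointwise integral of a process with values in a finite-dimensional
    space belongs to that space. *)
Lemma crd_tint (a b : R) (f : R -> 'rV[R]_d -> R) :
  (forall s, a <= s <= b -> K (f s)) ->
  (forall i, (@lebesgue_measure R).-integrable `[a, b] (fun s => (c i (f s))%:E)) ->
  K (tint a b f) /\
  forall i, c i (tint a b f) = \int[@lebesgue_measure R]_(s in `[a, b]) c i (f s).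
Proof.
move=> Kf If.
have E : tint a b f =
    \sum_i (\int[@lebesgue_measure R]_(s in `[a, b]) c i (f s)) *: e i.
  apply/funext => x; rewrite /tint fct_sumE.
  transitivity (\int[@lebesgue_measure R]_(s in `[a, b]) \sum_i e i x * c i (f s)).
    apply: eq_Rintegral => s; rewrite inE/= in_itv/= => /Kf/(crd_expand hc) {1}->.
    by rewrite fct_sumE; apply: eq_bigr => i _; rewrite mulrC.
  have [|_ ->] := @Rint_sum_on `[a, b]%classic _ (index_enum _)
    (fun i s => e i x * c i (f s)) (measurable_itv _).
    by move=> i; exact: (@integrableZl _ (measurableTypeR R) R (@lebesgue_measure R) _ (measurable_itv _) (e i x) _ (If i)).
  apply: eq_bigr => i _; rewrite RintegralZl; [by rewrite mulrC|exact: measurable_itv|exact: If].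
rewrite E; split; last by move=> i; rewrite (crd_lin hc).
by have [] := @crd_sum _ (index_enum _) xpredT (fun i =>
  (\int[@lebesgue_measure R]_(s in `[a, b]) c i (f s)) *: e i)
  (fun i _ => crd_closedZ hc _ (crd_mem hc i)).
Qed.

End coordinate_algebra.

Section coordinates_of_processes.
Context {dO : measure_display} {Omega : measurableType dO} {R : realType}.
Variables (P : probability Omega R) (T : R) (W : R -> Omega -> R).
Hypothesis hP : measure_is_complete P.
Hypothesis hW : wiener_process P T W.
Hypothesis T0 : 0 < T.
Context {d : nat} (K : fspace R d) (n : nat).
Variables (e : 'I_n -> 'rV[R]_d -> R) (c : 'I_n -> ('rV[R]_d -> R) -> R).
Hypothesis hc : coordinates K e c.
Notation leb1 := (@lebesgue_measure R).
Notation M := (P \x leb1)%E.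
Notation F := (filtration P W).
Implicit Types (X Z J : R -> Omega -> 'rV[R]_d -> R).

(** The coordinates of a process. *)
Definition crd_process (i : 'I_n) X : R -> Omega -> R := fun t w => c i (X t w).

(** Conditions on a coordinate are open, so that coordinates inherit the
    measurability properties, which are stated through open sets. *)
Lemma fopen_crd_ray i (a : R) : fopen K [set v | a < c i v].
Proof.
move=> u Ku au; exists (c i u - a); split; first by rewrite subr_gt0.
move=> v Kv vu; rewrite /mkset in au *.
have h := crd_norm hc i (crd_closedB hc Kv Ku).
rewrite (crd_sub hc)// in h; have := lerNnormlW (le_refl `|c i v - c i u|).
move: (le_lt_trans h vu); move: (c i u) (c i v) => x y; clear.
move=> h; have := ler_norm (x - y); rewrite distrC => h'.
by move: (le_lt_trans h' h); rewrite ltrD2l ltrN2.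
Qed.

Lemma crd_sqr_le i v : K v -> c i v ^+ 2 <= fnorm K v ^+ 2.
Proof.
move=> Kv; rewrite -(real_normK (num_real (c i v))) lerXn2r ?nnegrE//.
  exact: le_trans (crd_norm hc i Kv).
exact: (crd_norm hc).
Qed.

Lemma crd_fmeas s xi i : fmeasurable K (F s) xi -> Fmeas P W s (fun w => c i (xi w)).
Proof.
move=> [Kxi mxi]; apply: (@measurable_fun_rays _ (Fspace P W s) R setT) => // a; rewrite setTI.
change (filtration P W s (xi @^-1` [set v | a < c i v])). apply: mxi. exact: fopen_crd_ray.
Qed.

Lemma crd_joint X i : jointly_measurable K T X ->
  measurable_fun setT (cutoff T (crd_process i X)).
Proof.
move=> jX; apply: measurable_fun_rays => // a; rewrite setTI.
have mS := jX _ (@fopen_crd_ray i a).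
have mC : measurable (setT `*` ~` `[0, T]%classic : set (Omega * measurableTypeR R)).
  by apply: measurableX => //; apply: measurableC; exact: measurable_itv.
have mS' : measurable ([set q | 0 <= q.2 <= T /\ a < c i (X q.2 q.1)] :
    set (Omega * measurableTypeR R)).
  have := @measurable_swap _ _ Omega (measurableTypeR R) measurableT _ mS.
  by rewrite setTI.
rewrite (_ : [set _ | _] = [set q | 0 <= q.2 <= T /\ a < c i (X q.2 q.1)] `|`
    (if a < 0 then (setT `*` ~` `[0, T]%classic) else set0)).
  by apply: measurableU => //; case: ifP.
apply/seteqP; split=> -[w t]; rewrite /= /cutoff/=.
  case: ifPn => tT at_; first by left.
  by right; rewrite at_; split=> //=; rewrite in_itv/=; exact/negP.
move=> [[-> //]|]; case: ifPn => // a0 [_ /=]; rewrite in_itv/= => /negP/negbTE ->.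
exact: a0.
Qed.

Lemma crd_norm2_le X i : (forall t w, 0 <= t <= T -> K (X t w)) ->
  measurable_fun setT (cutoff T (crd_process i X)) -> (norm2_L2L2 P K T X < +oo)%E ->
  sqint M (cutoff T (crd_process i X)) /\
  ((inner M (cutoff T (crd_process i X)) (cutoff T (crd_process i X)))%:E <=
    norm2_L2L2 P K T X)%E.
Proof.
move=> KX mX Xoo; apply: sqint_cutoff => // t w tT.
by apply: crd_sqr_le; exact: KX.
Qed.

Lemma crd_L2L2 X i : L2F_L2t P K F T X -> sqint M (cutoff T (crd_process i X)).
Proof.
move=> [aX jX oX]; apply: (crd_norm2_le _ (crd_joint i jX) oX).1.
by move=> t w /aX[].
Qed.

Lemma crd_continuous X i : (forall t w, 0 <= t <= T -> K (X t w)) ->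
  (forall w, path_continuous K T (X ^~ w)) ->
  forall w t, 0 <= t <= T -> forall eps : R, 0 < eps -> exists2 dl : R, 0 < dl &
    forall s, 0 <= s <= T -> `|s - t| < dl ->
      `|crd_process i X s w - crd_process i X t w| < eps.
Proof.
move=> KX cX w t tT eps e0; have [dl d0 hd] := cX w t tT eps e0.
exists dl => // s sT st; apply: le_lt_trans (hd s sT st).
have Ks := KX s w sT; have Kt := KX t w tT.
by rewrite /crd_process -(crd_sub hc)//; apply: (crd_norm hc); exact: (crd_closedB hc).
Qed.

Lemma crd_Ct X i : L2F_Ct P K F T X ->
  sqint M (cutoff T (crd_process i X)) /\
  forall t, 0 <= t <= T -> sqint P (crd_process i X t).
Proof.
move=> [aX cX oX]; have KX t w : 0 <= t <= T -> K (X t w) by move=> /aX[].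
apply: (sqint_paths T0 _ _ _ oX).
- move=> t tT; apply: (Fmeas_measurable hP hW) (crd_fmeas i (aX t tT)).
  by case/andP : tT.
- exact: crd_continuous.
- move=> t w tT; apply: (@le_trans _ _ ((fnorm K (X t w)) ^+ 2)%:E).
    by rewrite lee_fin; apply: crd_sqr_le; exact: KX.
  by apply: ereal_sup_ubound; exists t => //=; rewrite in_itv.
Qed.

End coordinates_of_processes.

Section coordinates_of_ito_integrals.
Context {dO : measure_display} {Omega : measurableType dO} {R : realType}.
Variables (P : probability Omega R) (T : R) (W : R -> Omega -> R).
Hypothesis hP : measure_is_complete P.
Hypothesis hW : wiener_process P T W.
Hypothesis T0 : 0 < T.
Context {d : nat} (K : fspace R d) (n : nat).
Variables (e : 'I_n -> 'rV[R]_d -> R) (c : 'I_n -> ('rV[R]_d -> R) -> R).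
Hypothesis hc : coordinates K e c.
Notation leb1 := (@lebesgue_measure R).
Notation M := (P \x leb1)%E.
Notation F := (filtration P W).
Variables (Z J : R -> Omega -> 'rV[R]_d -> R).
Hypothesis hZ : L2F_L2t P K F T Z.
Hypothesis hJ : is_ito_integral P K F T W Z J.
Variable i : 'I_n.

Lemma squeeze_fine (u : nat -> R) (v : nat -> \bar R) :
  (forall k, 0 <= u k) -> (forall k, (v k < +oo)%E -> ((u k)%:E <= v k)%E) ->
  v @ \oo --> 0%E -> u @ \oo --> (0 : R).
Proof.
move=> u0 uv v0; have [vfin vc] := (fine_cvgP v 0).1 v0.
apply: (squeeze_cvgr _ (@cvg_cst _ _ _ _ _) vc).
near=> k; rewrite u0/= -lee_fin fineK; last by near: k.
apply: uv; have : v k \is a fin_num by near: k.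
by rewrite fin_numElt => /andP[].
Unshelve. all: by end_near. Qed.

(** The two properties of the Ito integral used below, in coordinates: its
    increments are orthogonal to the past, and the isometry against the increment
    of the Wiener process. *)
Lemma crd_ito :
  (forall t, 0 <= t <= T -> sqint P (crd_process c i J t)) /\
  forall (a b : R) (xi : Omega -> R), 0 <= a -> a <= b -> b <= T ->
    Fmeas P W a xi -> sqint P xi ->
    inner P (fun w => crd_process c i J b w - crd_process c i J a w) xi = 0 /\
    inner P (fun w => crd_process c i J b w - crd_process c i J a w)
      (fun w => increment W a b w * xi w) =
    inner P (time_integral a b (cutoff T (crd_process c i Z))) xi.
Proof.
case: hJ => aJ [m [s [xs [simp cZ cJ]]]].
have [aZ jZ oZ] := hZ.
have KZ t w : 0 <= t <= T -> K (Z t w) by move=> /aZ[].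
have KJ t w : 0 <= t <= T -> K (J t w) by move=> /aJ[].
have Kx k j w : (j < m k)%N -> K (xs k j w).
  by move=> jm; have [_ _ /(_ j jm)[]] := simp k.
pose x k j w := c i (xs k j w).
have ssimp k : scalar_simple P T W (m k) (s k) (x k).
  have [h1 h2 h3 h4] := simp k; split=> //.
    by move=> j jm; apply: (crd_fmeas hc); exact: h3.
  move=> j jm; have [C hC] := h4 j jm; exists C => w.
  by apply: le_trans (hC w); apply: (crd_norm hc); exact: Kx.
have Ksv k t w : K (simple_val (m k) (s k) (xs k) t w) /\
    c i (simple_val (m k) (s k) (xs k) t w) = simple_value (m k) (s k) (x k) t w.
  have [h1 h2] := @crd_sum R d K n e c hc 'I_(m k) (index_enum _)
    (fun j : 'I_(m k) => s k j < t <= s k j.+1) (fun j => xs k j w)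
    (fun j _ => Kx k j w (ltn_ord j)).
  by split=> //; exact: h2.
have Ksi k t w : K (simple_int W (m k) (s k) (xs k) t w) /\
    c i (simple_int W (m k) (s k) (xs k) t w) = simple_ito W (m k) (s k) (x k) t w.
  have [|h1 h2] := @crd_sum R d K n e c hc 'I_(m k) (index_enum _) xpredT
    (fun j : 'I_(m k) =>
      increment W (Num.min (s k j) t) (Num.min (s k j.+1) t) w *: xs k j w).
    by move=> j _; apply: (crd_closedZ hc); exact: Kx.
  split=> //; rewrite [LHS]h2; apply: eq_bigr => j _.
  by rewrite (crd_scale hc)//; exact: Kx.
have ssi k t : 0 <= t <= T -> sqint P (simple_ito W (m k) (s k) (x k) t).
  exact: (sqint_sint hP hW).
have mJ t : 0 <= t <= T -> measurable_fun setT (crd_process c i J t).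
  move=> tT; apply: (Fmeas_measurable hP hW) (crd_fmeas hc i (aJ t tT)).
  by case/andP : tT.
pose v t k := (\int[P]_w
  ((fnorm K (J t w - simple_int W (m k) (s k) (xs k) t w)) ^+ 2)%:E)%E.
have vle t k : 0 <= t <= T -> (v t k < +oo)%E ->
    sqint P (fun w => simple_ito W (m k) (s k) (x k) t w - crd_process c i J t w) /\
    ((inner P (fun w => simple_ito W (m k) (s k) (x k) t w - crd_process c i J t w)
      (fun w => simple_ito W (m k) (s k) (x k) t w - crd_process c i J t w))%:E <= v t k)%E.
  move=> tT voo.
  have le : (\int[P]_w ((simple_ito W (m k) (s k) (x k) t w - crd_process c i J t w) ^+ 2)%:E
      <= v t k)%E.
    apply: ge0_le_integral_sup => w _; rewrite lee_fin ?sqr_ge0//.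
    have [K1 c1] := Ksi k t w; have K2 := KJ t w tT.
    rewrite -c1 /crd_process -sqrrN opprB -(crd_sub hc)//.
    by apply: (crd_sqr_le hc); exact: (crd_closedB hc).
  have sq : sqint P (fun w => simple_ito W (m k) (s k) (x k) t w - crd_process c i J t w).
    apply: sqint_lty; last exact: le_lt_trans voo.
    by apply: measurable_funB; [exact: (ssi k t tT).1|exact: mJ].
  by split=> //; rewrite inner_EFin.
have sJ t : 0 <= t <= T -> sqint P (crd_process c i J t).
  move=> tT; have [vfin _] := (fine_cvgP (v t) 0).1 (cJ t tT).
  have [k hk] := filter_ex vfin.
  have [|sq _] := vle t k tT; first by move: hk; rewrite fin_numElt => /andP[].
  have := sqintB (ssi k t tT) sq.
  by under [X in sqint _ X]eq_fun do rewrite opprB addrCA subrr addr0.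
have cvJ t : 0 <= t <= T ->
    inner P (fun w => simple_ito W (m k) (s k) (x k) t w - crd_process c i J t w)
      (fun w => simple_ito W (m k) (s k) (x k) t w - crd_process c i J t w)
    @[k --> \oo] --> (0 : R).
  move=> tT; apply: (squeeze_fine _ _ (cJ t tT)) => k; first exact: inner_ge0.
  by move=> voo; exact: (vle t k tT voo).2.
have sz := crd_L2L2 hc i hZ.
have Esv k : (fun q => svalM (m k) (s k) (x k) q - cutoff T (crd_process c i Z) q) =
    (fun q => - cutoff T (crd_process c i
      (Z - simple_val (m k) (s k) (xs k))) q).
  apply/funext => -[w t]; rewrite /cutoff /svalM/= /crd_process.
  have [K1 c1] := Ksv k t w.
  case: ifPn => tT; last first.
    rewrite !oppr0 addr0 /simple_value big1// => j /andP[jt tj]; exfalso.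
    have [sT _ _ _] := simp k; move/negP : tT; apply.
    have /andP[j0 _] := sT j (ltnW (ltn_ord j)).
    have /andP[_ jT] := sT j.+1 (ltn_ord j).
    by rewrite (le_trans j0 (ltW jt)) (le_trans tj jT).
  change (simple_value (m k) (s k) (x k) t w - c i (Z t w) =
    - c i (Z t w - simple_val (m k) (s k) (xs k) t w)).
  by rewrite (crd_sub hc i (KZ t w tT) K1) c1 opprB.
have cvZ : inner M
    (fun q => svalM (m k) (s k) (x k) q - cutoff T (crd_process c i Z) q)
    (fun q => svalM (m k) (s k) (x k) q - cutoff T (crd_process c i Z) q)
    @[k --> \oo] --> (0 : R).
  apply: (squeeze_fine _ _ cZ) => k; first exact: inner_ge0.
  move=> voo; rewrite Esv.
  have sd : sqint M (cutoff T (crd_process c i (Z - simple_val (m k) (s k) (xs k)))).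
    have := sqintB (sqint_svalM hP hW (ssimp k)) sz; rewrite Esv => /sqintN.
    by under [X in sqint _ X]eq_fun do rewrite opprK.
  rewrite (_ : inner M _ _ = inner M
      (cutoff T (crd_process c i (Z - simple_val (m k) (s k) (xs k))))
      (cutoff T (crd_process c i (Z - simple_val (m k) (s k) (xs k))))); last first.
    by apply: eq_Rintegral => q _; rewrite mulrNN.
  apply: (crd_norm2_le hc _ sd.1 voo).2 => t w tT.
  by apply: (crd_closedB hc); [exact: KZ|exact: (Ksv k t w).1].
split=> // a b xi a0 ab bT fxi sxi.
have aT : 0 <= a <= T by rewrite a0 (le_trans ab bT).
have bTT : 0 <= b <= T by rewrite bT (le_trans a0 ab).
split.
  exact: (ito_orthogonal hP hW a0 ab bT ssimp (sJ a aT) (sJ b bTT)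
    (cvJ a aT) (cvJ b bTT) fxi sxi).
exact: (ito_isometry hP hW a0 ab bT ssimp (sJ a aT) (sJ b bTT)
    (cvJ a aT) (cvJ b bTT) fxi sxi sz cvZ).
Qed.

End coordinates_of_ito_integrals.

(** * One step of the scheme *)

Section one_step.
Context {dT : measure_display} {T : measurableType dT} {R : realType}.
Variable mu : {measure set T -> \bar R}.
Variables (tau gamma : R).
Variables x1 x1' x2 x2' u b y1 y1' y2 y2' a iz ig i1 dj1 dj2 wx : T -> R.
Hypotheses (sx1 : sqint mu x1) (sx1' : sqint mu x1').
Hypotheses (sx2 : sqint mu x2) (sx2' : sqint mu x2').
Hypotheses (su : sqint mu u) (sb : sqint mu b).
Hypotheses (sy1 : sqint mu y1) (sy1' : sqint mu y1').
Hypotheses (sy2 : sqint mu y2) (sy2' : sqint mu y2').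
Hypotheses (sa : sqint mu a) (siz : sqint mu iz) (sig : sqint mu ig).
Hypotheses (si1 : sqint mu i1) (sdj1 : sqint mu dj1) (sdj2 : sqint mu dj2).
Hypothesis swx : sqint mu wx.
Hypothesis ex1 : {ae mu, forall w, x1' w - x1 w = tau / 2 * (x2' w + x2 w)}.
Hypothesis ex2 : {ae mu, forall w,
  x2' w - x2 w = tau / 2 * - b w + tau * u w + gamma * wx w}.
Hypothesis ey1 : {ae mu, forall w,
  y1' w - y1 w = a w - gamma * iz w - ig w + dj1 w}.
Hypothesis ey2 : {ae mu, forall w, y2' w - y2 w = dj2 w - i1 w}.
Hypotheses (oj1 : inner mu dj1 x1 = 0) (oj2 : inner mu dj2 x2 = 0).
Hypotheses (oy2 : inner mu y2 wx = 0).
Hypothesis iso : inner mu dj2 wx = inner mu iz x1.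

(** One step of the discrete integration by parts. The primed variables are the
    values at the end of the step. The term [gamma * iz] of the backward equation
    cancels against the covariation of the two noises. *)
Lemma one_step_identity :
  inner mu y1' x1' - inner mu y1 x1 + (inner mu y2' x2' - inner mu y2 x2) =
  tau / 2 * inner mu (fun w => x2' w + x2 w) y1' - inner mu i1 x2 +
  (inner mu a x1 - tau / 2 * inner mu b y2') + tau * inner mu u y2' -
  gamma * inner mu i1 wx - inner mu ig x1.
Proof.
have cong f g h : sqint mu f -> sqint mu g -> sqint mu h ->
    {ae mu, forall w, f w = g w} -> inner mu f h = inner mu g h.
  move=> sf sg sh fg; apply: inner_ae; try exact: sf.1; try exact: sg.1; try exact: sh.1.
    exact: fg.
  by apply: aeW.
have sx22 := sqintD sx2' sx2.
have s1 := sqintZ (tau / 2) sx22.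
have A1 := cong _ _ _ (sqintB sx1' sx1) s1 sy1' ex1.
rewrite (innerBl sx1' sx1 sy1') (innerZl _ sx22 sy1') in A1.
have sg := sqintZ gamma siz.
have A2 := cong _ _ _ (sqintB sy1' sy1) (sqintD (sqintB (sqintB sa sg) sig) sdj1) sx1 ey1.
rewrite (innerBl sy1' sy1 sx1) (innerDl (sqintB (sqintB sa sg) sig) sdj1 sx1) in A2.
rewrite (innerBl (sqintB sa sg) sig sx1) (innerBl sa sg sx1) (innerZl _ siz sx1) oj1 in A2.
have snb := sqintZ (tau / 2) (sqintN sb).
have stu := sqintZ tau su.
have sgw := sqintZ gamma swx.
have A3 := cong _ _ _ (sqintB sx2' sx2) (sqintD (sqintD snb stu) sgw) sy2' ex2.
rewrite (innerBl sx2' sx2 sy2') (innerDl (sqintD snb stu) sgw sy2') in A3.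
rewrite (innerDl snb stu sy2') (innerZl _ (sqintN sb) sy2') (innerNl sb sy2') in A3.
rewrite (innerZl _ su sy2') (innerZl _ swx sy2') in A3.
have A4 := cong _ _ _ (sqintB sy2' sy2) (sqintB sdj2 si1) sx2 ey2.
rewrite (innerBl sy2' sy2 sx2) (innerBl sdj2 si1 sx2) oj2 in A4.
have A5 := cong _ _ _ (sqintB sy2' sy2) (sqintB sdj2 si1) swx ey2.
rewrite (innerBl sy2' sy2 swx) (innerBl sdj2 si1 swx) iso oy2 in A5.
rewrite (innerC _ x1' y1') (innerC _ x1 y1') in A1.
rewrite (innerC _ x2' y2') (innerC _ x2 y2') (innerC _ wx y2') in A3.
have {}A5 := congr1 ( *%R gamma) A5.
move: A1 A2 A3 A4 A5.
move: (inner mu y1' x1') (inner mu y1' x1) (inner mu y1 x1) => q1 q2 q3.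
move: (inner mu y2' x2') (inner mu y2' x2) (inner mu y2 x2) => q4 q5 q6.
move: (inner mu (fun w => x2' w + x2 w) y1') (inner mu a x1) (inner mu ig x1) => q7 q8 q9.
move: (inner mu iz x1) (inner mu b y2') (inner mu u y2') (inner mu y2' wx) => q10 q11 q12 q13.
move: (inner mu i1 x2) (inner mu i1 wx) => q14 q15.
move=> A1 A2 A3 A4 A5.
have E : q1 - q3 + (q4 - q6) = (q1 - q2) + (q2 - q3) + (q4 - q5) + (q5 - q6) by ring.
rewrite E A1 A2 A3 A4 (_ : gamma * q13 = gamma * (q10 - q15)); first by ring.
by rewrite -A5 subr0.
Qed.

End one_step.

(** The implicit part of a step of the scheme can be inverted. *)
Lemma psd_shift_inverse (R : realType) n (A : 'M[R]_n) (a : R) : 0 <= a ->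
  (forall x : 'I_n -> R, 0 <= \sum_i \sum_j x i * A i j * x j) ->
  exists B : 'M[R]_n, forall x k : 'I_n -> R,
    (forall i, x i + a * \sum_j A i j * x j = k i) ->
    forall i, x i = \sum_j B i j * k j.
Proof.
move=> a0 psd; pose S : 'M[R]_n := 1%:M + a *: A.
have Sx (x : 'I_n -> R) i : (S *m (\col_j x j)) i 0 = x i + a * \sum_j A i j * x j.
  rewrite mulmxDl mul1mx -scalemxAl !mxE; congr (_ + a * _).
  by apply: eq_bigr => j _; rewrite mxE.
have uS : S \in unitmx.
  rewrite -unitmx_tr -row_free_unit -kermx_eq0; apply/rowV0P => v /sub_kermxP vS.
  have Sv : S *m v^T = 0 by rewrite -[S *m _]trmxK trmx_mul trmxK vS trmx0.
  have vE : v^T = \col_j v 0 j by apply/matrixP => i j; rewrite !mxE ord1.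
  (* the quadratic form of S is at least the sum of squares *)
  have : \sum_i v 0 i * (v 0 i + a * \sum_j A i j * v 0 j) = 0.
    apply: big1 => i _; rewrite -(Sx (fun j => v 0 j)) -vE Sv.
    by rewrite mxE mulr0.
  rewrite (eq_bigr (fun i => v 0 i ^+ 2 + a * \sum_j v 0 i * A i j * v 0 j)); last first.
    move=> i _; rewrite mulrDr -expr2 mulrCA mulr_sumr; congr (_ + a * _).
    by apply: eq_bigr => j _; rewrite mulrA.
  rewrite big_split/= -mulr_sumr => /eqP.
  have p1 : 0 <= \sum_i v 0 i ^+ 2 by apply: sumr_ge0 => i _; exact: sqr_ge0.
  rewrite paddr_eq0//; last exact: mulr_ge0.
  rewrite psumr_eq0 => [|i _]; last exact: sqr_ge0.
  move=> /andP[/allP h _]; apply/rowP => i; rewrite mxE.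
  by have := h i (mem_index_enum _); rewrite sqrf_eq0 => /eqP.
exists (invmx S) => x k xk i.
have -> : x i = (invmx S *m (S *m (\col_j x j))) i 0.
  by rewrite mulmxA mulVmx// mul1mx mxE.
rewrite mxE; apply: eq_bigr => j _; congr (_ * _).
by rewrite Sx xk.
Qed.

(** * Integrals over intervals *)

Section interval_integrals.
Context {R : realType}.
Notation leb1 := (@lebesgue_measure R).
Implicit Types (a b x : R) (f g : R -> R).

(** Integrability over a closed interval of times. *)
Definition integrable_on a b f := leb1.-integrable `[a, b] (EFin \o f).

Lemma integrable_onS a b a' b' f : a <= a' -> b' <= b ->
  integrable_on a b f -> integrable_on a' b' f.
Proof.
move=> aa bb; apply: integrableS => //; try exact: measurable_itv.
by apply: subset_itv; rewrite bnd_simp.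
Qed.

Lemma integrable_onD a b f g : integrable_on a b f -> integrable_on a b g ->
  integrable_on a b (fun t => f t + g t).
Proof.
exact: (@integrableD _ (measurableTypeR R) R leb1 _ (measurable_itv `[a, b])
  (EFin \o f) (EFin \o g)).
Qed.

Lemma integrable_onZ a b (k : R) f : integrable_on a b f ->
  integrable_on a b (fun t => k * f t).
Proof.
exact: (@integrableZl _ (measurableTypeR R) R leb1 _ (measurable_itv `[a, b]) k
  (EFin \o f)).
Qed.

Lemma eq_integrable_on a b f g : (forall t, a <= t <= b -> f t = g t) ->
  integrable_on a b f -> integrable_on a b g.
Proof.
move=> fg; apply: eq_integrable; first exact: measurable_itv.
by move=> t; rewrite inE/= in_itv/= => /fg /= ->.
Qed.

Lemma Rint_onD a b f g : integrable_on a b f -> integrable_on a b g ->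
  \int[leb1]_(t in `[a, b]) (f t + g t) =
  \int[leb1]_(t in `[a, b]) f t + \int[leb1]_(t in `[a, b]) g t.
Proof. by move=> If Ig; apply: RintegralD => //; exact: measurable_itv. Qed.

Lemma Rint_onZ a b (k : R) f : integrable_on a b f ->
  \int[leb1]_(t in `[a, b]) (k * f t) = k * \int[leb1]_(t in `[a, b]) f t.
Proof. by move=> If; rewrite RintegralZl//; exact: measurable_itv. Qed.

Lemma eq_Rint_on a b f g : (forall t, a <= t <= b -> f t = g t) ->
  \int[leb1]_(t in `[a, b]) f t = \int[leb1]_(t in `[a, b]) g t.
Proof.
by move=> fg; apply: eq_Rintegral => t; rewrite inE/= in_itv/=; exact: fg.
Qed.

Lemma Rint_on_split a x b f : a <= x -> x <= b -> integrable_on a b f ->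
  \int[leb1]_(t in `[a, b]) f t =
  \int[leb1]_(t in `[a, x]) f t + \int[leb1]_(t in `[x, b]) f t.
Proof.
move=> ax xb If.
have := @Rintegral_itvB R f (BLeft a) (BRight b) x If.
rewrite !bnd_simp => /(_ ax xb) => E.
have E2 := @Rintegral_itv_obnd_cbnd R x (BRight b) f.
rewrite -E2; last first.
  apply: integrableS If; try exact: measurable_itv.
  by apply: subset_itv; rewrite bnd_simp.
by rewrite -E addrC subrK.
Qed.

(** The value at the right end point is irrelevant. *)
Lemma eq_Rint_on_co a b f g : integrable_on a b f ->
  (forall t, a <= t < b -> f t = g t) ->
  integrable_on a b g /\
  \int[leb1]_(t in `[a, b]) f t = \int[leb1]_(t in `[a, b]) g t.
Proof.
move=> If fg.
have Ifo : leb1.-integrable `[a, b[ (EFin \o f).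
  apply: integrableS If; try exact: measurable_itv.
  by apply: subset_itv; rewrite bnd_simp.
have Igo : leb1.-integrable `[a, b[ (EFin \o g).
  apply: eq_integrable Ifo; first exact: measurable_itv.
  by move=> t; rewrite inE/= in_itv/= => /fg /= ->.
have mgo : measurable_fun `[a, b[%classic (EFin \o g) := measurable_int leb1 Igo.
split.
  apply/integrableP; split.
    exact/(emeasurable_fun_itv_bndo_bndcP (BLeft a) b (EFin \o g)).
  rewrite -integral_itv_bndo_bndc; last exact: measurableT_comp.
  by case/integrableP : Igo.
rewrite -(@Rintegral_itv_bndo_bndc R (BLeft a) b f Ifo).
rewrite -(@Rintegral_itv_bndo_bndc R (BLeft a) b g Igo).
by apply: eq_Rintegral => t; rewrite inE/= in_itv/=; exact: fg.
Qed.

Lemma integrable_on_join a x b f : a <= x -> x <= b ->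
  integrable_on a x f -> integrable_on x b f -> integrable_on a b f.
Proof.
move=> ax xb I1 I2.
have I2' : leb1.-integrable `]x, b] (EFin \o f).
  apply: integrableS I2; try exact: measurable_itv.
  by apply: subset_itv; rewrite bnd_simp.
have K (i : interval R) (h : R -> \bar R) :
    leb1.-integrable [set` i] h <-> leb1.-integrable setT (h \_ [set` i]).
  exact: (@integrable_mkcond _ (measurableTypeR R) R leb1 _ _ (measurable_itv i)).
apply/K.
rewrite (_ : _ \_ _ = ((EFin \o f) \_ `[a, x]%classic \+ (EFin \o f) \_ `]x, b]%classic)%E).
  apply: (@integrableD _ (measurableTypeR R) R leb1 _ measurableT).
    exact/K.
  exact/K.
have mE (D : set R) (B : bool) t : (D t <-> B) -> (t \in D) = B.
  by move=> DB; apply/idP/idP; rewrite inE => /DB.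
apply/funext => t /=; rewrite !patchE.
rewrite (mE _ (a <= t <= b)) ?(mE `[a, x]%classic (a <= t <= x))
  ?(mE `]x, b]%classic (x < t <= b)); rewrite /= ?in_itv//.
have [tx|xt] /= := leP t x.
  by rewrite (le_trans tx xb) andbT adde0.
by rewrite (le_trans ax (ltW xt)) andbF add0e.
Qed.

End interval_integrals.

(** * The backward equation *)

Section adjoint_equation.
Context {dO : measure_display} {Omega : measurableType dO} {R : realType}.
Variables (P : probability Omega R) (T beta gamma : R) (W : R -> Omega -> R).
Hypothesis hP : measure_is_complete P.
Hypothesis hW : wiener_process P T W.
Hypothesis T0 : 0 < T.
Context {d : nat} (K : fspace R d) (n : nat).
Variables (e : 'I_n -> 'rV[R]_d -> R) (c : 'I_n -> ('rV[R]_d -> R) -> R).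
Hypothesis hc : coordinates K e c.
Notation leb1 := (@lebesgue_measure R).
Notation M := (P \x leb1)%E.
Notation F := (filtration P W).
Variables (A : 'M[R]_n) (Rh Dh : ('rV[R]_d -> R) -> 'rV[R]_d -> R).
Variable Xt : R -> 'rV[R]_d -> R.
Variables X1s Y1 Y2 Z1 Z2 J1 J2 : R -> Omega -> 'rV[R]_d -> R.
Hypothesis hDh : forall v, K v -> K (Dh v) /\
  forall i, c i (Dh v) = - \sum_j A i j * c j v.
Hypothesis hRh : forall t, 0 <= t <= T -> K (Rh (Xt t)).
Hypothesis hRc : forall i t, 0 <= t <= T -> forall eps : R, 0 < eps ->
  exists2 dl : R, 0 < dl & forall s, 0 <= s <= T -> `|s - t| < dl ->
    `|c i (Rh (Xt s)) - c i (Rh (Xt t))| < eps.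
Hypothesis hX1s : L2F_Ct P K F T X1s.
Hypothesis hY1 : L2F_Ct P K F T Y1.
Hypothesis hY2 : L2F_Ct P K F T Y2.
Hypothesis hZ2 : L2F_L2t P K F T Z2.
Hypothesis hYZ : forall t, 0 <= t <= T -> {ae P, forall w,
  Y1 t w = beta *: (X1s T w - Rh (Xt T))
    + tint t T (fun s => Dh (Y2 s w) + gamma *: Z2 s w + X1s s w - Rh (Xt s))
    - (J1 T w - J1 t w) /\
  Y2 t w = tint t T (Y1 ^~ w) - (J2 T w - J2 t w)}.
Hypothesis KJ1 : forall t w, 0 <= t <= T -> K (J1 t w).
Hypothesis KJ2 : forall t w, 0 <= t <= T -> K (J2 t w).

(** The deviation from the projected target. *)
Definition deviation : R -> Omega -> 'rV[R]_d -> R :=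
  fun t w => X1s t w - Rh (Xt t).

Notation cp := (crd_process c).

Let KX t w : 0 <= t <= T -> K (X1s t w). Proof. by case: hX1s => h _ _ /h[]. Qed.
Let KY1 t w : 0 <= t <= T -> K (Y1 t w). Proof. by case: hY1 => h _ _ /h[]. Qed.
Let KY2 t w : 0 <= t <= T -> K (Y2 t w). Proof. by case: hY2 => h _ _ /h[]. Qed.
Let KZ2 t w : 0 <= t <= T -> K (Z2 t w). Proof. by case: hZ2 => h _ _ /h[]. Qed.

(** The target, as a deterministic process: it is bounded, being continuous. *)
Lemma target_sqint i :
  sqint M (cutoff T (fun t (w : Omega) => c i (Rh (Xt t)))) /\
  forall t, 0 <= t <= T -> sqint P (fun w : Omega => c i (Rh (Xt t))).
Proof.
pose f (t : R) : R := c i (Rh (Xt t)).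
have cf : {within `[0, T], continuous f}.
  apply/subspace_continuousP => t; rewrite /= in_itv/= => tT.
  apply/cvgrPdist_lt => eps e0; have [dl d0 hd] := hRc i tT e0.
  rewrite near_withinE; apply/nbhs_ballP; exists dl => //= s.
  rewrite /ball/= => st; rewrite in_itv/= => sT; rewrite distrC; apply: hd => //.
  by rewrite distrC.
have [u _ fu] := EVT_max (ltW T0) cf; have [v _ fv] := EVT_min (ltW T0) cf.
pose C := Num.max `|f u| `|f v|.
have fC t : 0 <= t <= T -> f t ^+ 2 <= C ^+ 2.
  move=> tT; have tI : t \in `[0, T] by rewrite in_itv.
  rewrite -(real_normK (num_real (f t))) lerXn2r ?nnegrE//.
    by rewrite le_max normr_ge0.
  rewrite ler_norml; apply/andP; split.
    apply: le_trans (fv t tI); rewrite lerNl.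
    by apply: le_trans (ler_norm _) _; rewrite normrN le_max lexx orbT.
  by apply: le_trans (fu t tI) _; apply: le_trans (ler_norm _) _; rewrite le_max lexx.
apply: (@sqint_paths _ _ _ _ _ T0 _ (fun=> (C ^+ 2)%:E)).
- by move=> t tT; exact: measurable_cst.
- by move=> w t tT eps e0; exact: hRc.
- by move=> t w tT; rewrite lee_fin; exact: fC.
- rewrite integral_cst; last exact: measurableT.
  by apply: lte_mul_pinfty; rewrite ?lee_fin ?sqr_ge0 ?ltry//; exact: (le_lt_trans (probability_le1 P measurableT)) (ltry 1).
Qed.

Lemma deviation_sqint i : sqint M (cutoff T (cp i deviation)) /\
  forall t, 0 <= t <= T -> sqint P (cp i deviation t).
Proof.
have [s1 s2] := target_sqint i; have [s3 s4] := crd_Ct hP hW T0 hc i hX1s.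
have E t w : 0 <= t <= T -> cp i deviation t w = cp i X1s t w - c i (Rh (Xt t)).
  by move=> tT; rewrite /crd_process /deviation (crd_sub hc)//; [exact: KX|exact: hRh].
split; last first.
  move=> t tT; rewrite (_ : cp i deviation t = fun w => cp i X1s t w - c i (Rh (Xt t))).
    exact: (sqintB (s4 t tT) (s2 t tT)).
  by apply/funext => w; rewrite E.
rewrite (_ : cutoff T _ = fun q => cutoff T (cp i X1s) q -
    cutoff T (fun t (w : Omega) => c i (Rh (Xt t))) q); first exact: sqintB.
apply/funext => -[w t]; rewrite /cutoff/=; case: ifPn => tT; last by rewrite subr0.
exact: E.
Qed.

Let ae_int f : sqint M f -> {ae P, forall w, integrable_on 0 T (fun t => f (w, t))}.
Proof. by move=> sf; have [_ + _] := time_integralP (ltW T0) sf. Qed.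

(** The backward equation between two times, in coordinates. *)
Lemma adjoint_increment (s t : R) i : 0 <= s -> s <= t -> t <= T ->
  {ae P, forall w,
    cp i Y1 t w - cp i Y1 s w =
      \sum_j A i j * time_integral s t (cutoff T (cp j Y2)) w
      - gamma * time_integral s t (cutoff T (cp i Z2)) w
      - time_integral s t (cutoff T (cp i deviation)) w
      + (cp i J1 t w - cp i J1 s w)} /\
  {ae P, forall w,
    cp i Y2 t w - cp i Y2 s w =
      (cp i J2 t w - cp i J2 s w) - time_integral s t (cutoff T (cp i Y1)) w}.
Proof.
move=> s0 st tT; have sT : s <= T by exact: le_trans tT.
have t0 : 0 <= t by exact: le_trans st.
have sTT : 0 <= s <= T by rewrite s0.
have tTT : 0 <= t <= T by rewrite t0.
have TTT : 0 <= T <= T by rewrite lexx ltW.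
have iY1 : {ae P, forall w, forall j, integrable_on 0 T (fun r => cutoff T (cp j Y1) (w, r))}.
  by apply: filter_forall => j; exact: (ae_int (crd_Ct hP hW T0 hc j hY1).1).
have iY2 : {ae P, forall w, forall j, integrable_on 0 T (fun r => cutoff T (cp j Y2) (w, r))}.
  by apply: filter_forall => j; exact: (ae_int (crd_Ct hP hW T0 hc j hY2).1).
have iZ2 : {ae P, forall w, forall j, integrable_on 0 T (fun r => cutoff T (cp j Z2) (w, r))}.
  by apply: filter_forall => j; exact: (ae_int (crd_L2L2 hc j hZ2)).
have iG : {ae P, forall w, forall j, integrable_on 0 T (fun r => cutoff T (cp j deviation) (w, r))}.
  by apply: filter_forall => j; exact: (ae_int (deviation_sqint j).1).
have key : {ae P, forall w,
    [/\ forall j, integrable_on 0 T (fun r => cutoff T (cp j Y1) (w, r)),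
        forall j, integrable_on 0 T (fun r => cutoff T (cp j Y2) (w, r)),
        forall j, integrable_on 0 T (fun r => cutoff T (cp j Z2) (w, r)) &
        forall j, integrable_on 0 T (fun r => cutoff T (cp j deviation) (w, r))]}.
  by apply: filterS2 (filterI iY1 iY2) (filterI iZ2 iG) => w [h1 h2] [h3 h4]; split.
split.
  apply: filterS3 key (hYZ sTT) (hYZ tTT).
  move=> w [I1 I2 I3 I4] [E1 _] [E2 _].
  (* the coordinates of the drift *)
  pose phi j (r : R) : R := - (\sum_k A j k * cutoff T (cp k Y2) (w, r)) +
    gamma * cutoff T (cp j Z2) (w, r) + cutoff T (cp j deviation) (w, r).
  pose f (r : R) := Dh (Y2 r w) + gamma *: Z2 r w + X1s r w - Rh (Xt r).
  have fE r : 0 <= r <= T -> K (f r) /\ forall j, c j (f r) = phi j r.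
    move=> rT; have [K1 c1] := hDh (KY2 w rT).
    have K2 := crd_closedZ hc gamma (KZ2 w rT).
    have K12 := crd_closedD hc K1 K2.
    have K3 := crd_closedB hc (KX w rT) (hRh rT).
    rewrite /f -addrA; split; first exact: (crd_closedD hc).
    move=> j; rewrite (crd_add hc)// (crd_add hc)// c1 (crd_scale hc); last exact: KZ2.
    rewrite /phi !cutoff_in//; congr (- _ + _ + _).
    by apply: eq_bigr => k _; rewrite cutoff_in.
  have Isum j : integrable_on 0 T (fun r => \sum_k A j k * cutoff T (cp k Y2) (w, r)) /\
      forall a b : R, 0 <= a -> b <= T ->
      \int[leb1]_(r in `[a, b]) (\sum_k A j k * cutoff T (cp k Y2) (w, r)) =
      \sum_k A j k * time_integral a b (cutoff T (cp k Y2)) w.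
    have I5 k : integrable_on 0 T (fun r => A j k * cutoff T (cp k Y2) (w, r)).
      exact: integrable_onZ.
    split; first by have [] := Rint_sum_on (index_enum _) (measurable_itv `[0, T]) I5.
    move=> a b a0 bT.
    have I6 k : integrable_on a b (fun r => A j k * cutoff T (cp k Y2) (w, r)).
      exact: (integrable_onS a0 bT (I5 k)).
    have [_ ->] := Rint_sum_on (index_enum _) (measurable_itv `[a, b]) I6.
    apply: eq_bigr => k _; apply: Rint_onZ; exact: (integrable_onS a0 bT (I2 k)).
  have Iphi j : integrable_on 0 T (phi j).
    apply: integrable_onD (I4 j); apply: integrable_onD; last exact: integrable_onZ (I3 j).
    have := integrable_onZ (- 1) (Isum j).1.
    by apply: eq_integrable_on => r _; rewrite mulN1r.
  have phiE (a b : R) : 0 <= a -> b <= T -> \int[leb1]_(r in `[a, b]) phi i r =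
      - (\sum_k A i k * time_integral a b (cutoff T (cp k Y2)) w) +
      gamma * time_integral a b (cutoff T (cp i Z2)) w +
      time_integral a b (cutoff T (cp i deviation)) w.
    move=> a0 bT; have J4 := integrable_onS a0 bT (I4 i).
    have J3 := integrable_onS a0 bT (I3 i).
    have J5 := integrable_onS a0 bT (Isum i).1.
    have J6 := integrable_onZ (- 1) J5.
    rewrite -((Isum i).2 a b a0 bT) -mulN1r -(Rint_onZ _ J5) -(Rint_onZ _ J3).
    rewrite -(Rint_onD J6 (integrable_onZ gamma J3)) -(Rint_onD _ J4).
      by apply: eq_Rintegral => r _; rewrite /phi mulN1r.
    exact: integrable_onD J6 (integrable_onZ gamma J3).
  have tintE (r : R) : 0 <= r <= T -> K (tint r T f) /\
      c i (tint r T f) = \int[leb1]_(q in `[r, T]) phi i q.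
    move=> /andP[r0 rT].
    have [||K1 c1] := @crd_tint _ _ _ _ _ _ hc r T f.
    - by move=> q /andP[rq qT]; apply: (fE q _).1; rewrite (le_trans r0 rq).
    - move=> j; apply: (@eq_integrable_on _ r T (phi j)).
        move=> q /andP[rq qT]; rewrite (fE q _).2//.
        by rewrite (le_trans r0 rq).
      exact: (integrable_onS r0 (lexx T) (Iphi j)).
    - split=> //; rewrite c1; apply: eq_Rint_on => q /andP[rq qT].
      by rewrite (fE q _).2// (le_trans r0 rq).
  have Yc (r : R) : 0 <= r <= T ->
      Y1 r w = beta *: (X1s T w - Rh (Xt T)) + tint r T f - (J1 T w - J1 r w) ->
      cp i Y1 r w = beta * cp i deviation T w + \int[leb1]_(q in `[r, T]) phi i q
        - (cp i J1 T w - cp i J1 r w).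
    move=> rT Er; rewrite [LHS]/crd_process Er.
    have [K1 c1] := tintE r rT.
    have K2 := crd_closedB hc (KX w TTT) (hRh TTT).
    have K3 := crd_closedZ hc beta K2.
    have K4 := crd_closedB hc (KJ1 w TTT) (KJ1 w rT).
    rewrite (crd_sub hc i (crd_closedD hc K3 K1) K4) (crd_add hc i K3 K1) c1.
    by rewrite (crd_scale hc i _ K2) (crd_sub hc i (KJ1 w TTT) (KJ1 w rT)).
  rewrite (Yc s sTT E1) (Yc t tTT E2).
  rewrite (Rint_on_split st tT (integrable_onS s0 (lexx T) (Iphi i))) (phiE s t s0 tT).
  by ring.
apply: filterS3 key (hYZ sTT) (hYZ tTT).
move=> w [I1 _ _ _] [_ E1] [_ E2].
have Yc (r : R) : 0 <= r <= T -> Y2 r w = tint r T (Y1 ^~ w) - (J2 T w - J2 r w) ->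
    cp i Y2 r w = \int[leb1]_(q in `[r, T]) cutoff T (cp i Y1) (w, q)
      - (cp i J2 T w - cp i J2 r w).
  move=> rT Er; rewrite [LHS]/crd_process Er; have /andP[r0 _] := rT.
  have [||K1 c1] := @crd_tint _ _ _ _ _ _ hc r T (Y1 ^~ w).
  - by move=> q /andP[rq qT]; apply: KY1; rewrite (le_trans r0 rq).
  - move=> j; apply: (@eq_integrable_on _ r T (fun q => cutoff T (cp j Y1) (w, q))).
      by move=> q /andP[rq qT]; rewrite cutoff_in// (le_trans r0 rq).
    exact: (integrable_onS r0 (lexx T) (I1 j)).
  - have K4 := crd_closedB hc (KJ2 w TTT) (KJ2 w rT).
    rewrite (crd_sub hc i K1 K4) c1 (crd_sub hc i (KJ2 w TTT) (KJ2 w rT)).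
    congr (_ - _); apply: eq_Rint_on => q /andP[rq qT].
    by rewrite cutoff_in// (le_trans r0 rq).
rewrite (Yc s sTT E1) (Yc t tTT E2).
rewrite (Rint_on_split st tT (integrable_onS s0 (lexx T) (I1 i))) /time_integral.
by ring.
Qed.

(** The terminal conditions, in coordinates. *)
Lemma adjoint_terminal i :
  {ae P, forall w, cp i Y1 T w = beta * cp i deviation T w} /\
  {ae P, forall w, cp i Y2 T w = 0}.
Proof.
have TTT : 0 <= T <= T by rewrite lexx ltW.
have tint0 f : tint T T f = (0 : 'rV[R]_d -> R).
  by apply/funext => x; rewrite /tint set_itv1 Rintegral_set1.
split; apply: filterS (hYZ TTT) => w [E1 E2].
  rewrite [LHS]/crd_process E1 tint0 addr0 !subrr subr0 (crd_scale hc)//.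
  exact: (crd_closedB hc (KX w TTT) (hRh TTT)).
by rewrite [LHS]/crd_process E2 tint0 !subrr (crd_zero hc).
Qed.

End adjoint_equation.

(** * The discrete state *)

Section time_grid.
Context {R : realType}.
Variables (T : R) (N : nat).
Hypotheses (T0 : 0 < T) (N0 : (0 < N)%N).
Local Notation t := (tgrid T N).

Lemma tau_gt0 : 0 < T / N%:R.
Proof. by rewrite divr_gt0// ltr0n. Qed.

Lemma tgrid0 : t 0 = 0.
Proof. by rewrite /tgrid mul0r. Qed.

Lemma tgridN : t N = T.
Proof. by rewrite /tgrid mulrCA divff ?mulr1// pnatr_eq0 -lt0n. Qed.

Lemma tgridS n : t n.+1 = t n + T / N%:R.
Proof. by rewrite /tgrid -natr1 mulrDl mul1r. Qed.

Lemma tgrid_ge0 n : 0 <= t n.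
Proof. by rewrite /tgrid; apply: mulr_ge0; [exact: ler0n|exact: ltW tau_gt0]. Qed.

Lemma tgrid_leS n : t n <= t n.+1.
Proof. by rewrite tgridS lerDl; exact: ltW tau_gt0. Qed.

Lemma tgrid_le n : (n <= N)%N -> t n <= T.
Proof.
by move=> nN; rewrite -[leRHS]tgridN /tgrid ler_pM2r ?ler_nat//; exact: tau_gt0.
Qed.

Lemma tgrid_in n : (n <= N)%N -> 0 <= t n <= T.
Proof. by move=> nN; rewrite tgrid_ge0 tgrid_le. Qed.

(** Integrals over [0, T] split along the time grid. *)
Lemma Rint_grid (f : R -> R) :
  (forall n, (n < N)%N -> integrable_on (t n) (t n.+1) f) ->
  \int[@lebesgue_measure R]_(s in `[0, T]) f s =
  \sum_(n < N) \int[@lebesgue_measure R]_(s in `[t n, t n.+1]) f s.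
Proof.
move=> If; suff h m : (m <= N)%N -> integrable_on 0 (t m) f /\
    \int[@lebesgue_measure R]_(s in `[0, t m]) f s =
    \sum_(n < m) \int[@lebesgue_measure R]_(s in `[t n, t n.+1]) f s.
  by have [_] := h N (leqnn N); rewrite tgridN.
elim: m => [_|m IH mN].
  rewrite big_ord0 tgrid0 set_itv1 Rintegral_set1; split=> //.
  rewrite /integrable_on set_itv1; apply/integrableP.
  by split; [exact: measurable_fun_set1|rewrite integral_set1].
have [I1 E1] := IH (ltnW mN).
have I2 := integrable_on_join (tgrid_ge0 m) (tgrid_leS m) I1 (If m mN).
split=> //; rewrite big_ord_recr/= -E1.
exact: Rint_on_split (tgrid_ge0 m) (tgrid_leS m) I2.
Qed.

End time_grid.

Section discrete_state.
Context {dO : measure_display} {Omega : measurableType dO} {R : realType}.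
Variables (P : probability Omega R) (T gamma : R) (W : R -> Omega -> R).
Hypothesis hP : measure_is_complete P.
Hypothesis hW : wiener_process P T W.
Hypothesis T0 : 0 < T.
Context {d : nat} (K : fspace R d) (n : nat).
Variables (e : 'I_n -> 'rV[R]_d -> R) (c : 'I_n -> ('rV[R]_d -> R) -> R).
Hypothesis hc : coordinates K e c.
Notation leb1 := (@lebesgue_measure R).
Notation M := (P \x leb1)%E.
Notation F := (filtration P W).
Variables (A : 'M[R]_n) (Dh : ('rV[R]_d -> R) -> 'rV[R]_d -> R).
Hypothesis hDh : forall v, K v -> K (Dh v) /\
  forall i, c i (Dh v) = - \sum_j A i j * c j v.
Hypothesis psdA : forall x : 'I_n -> R, 0 <= \sum_i \sum_j x i * A i j * x j.
Variables (N : nat) (U X1 X2 : R -> Omega -> 'rV[R]_d -> R).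
Hypothesis N0 : (0 < N)%N.
Hypothesis hU : discrete_control P T W K N U.
Hypothesis hX : is_discrete_state0 P T gamma W K Dh N U X1 X2.
Local Notation t := (tgrid T N).
Local Notation tau := (T / N%:R).
Notation cp := (crd_process c).

Let tin k : (k <= N)%N -> 0 <= t k <= T. Proof. exact: tgrid_in. Qed.
Let KX1 s w : 0 <= s <= T -> K (X1 s w). Proof. by case: hX => [[h _] _ _ _] /h[]. Qed.
Let KX2 s w : 0 <= s <= T -> K (X2 s w). Proof. by case: hX => [[_ h] _ _ _] /h[]. Qed.
Let KU s w : 0 <= s <= T -> K (U s w). Proof. by case: hU => [[h _ _] _] /h[]. Qed.

Lemma state_fmeas i k : (k <= N)%N ->
  Fmeas P W (t k) (cp i X1 (t k)) /\ Fmeas P W (t k) (cp i X2 (t k)).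
Proof.
move=> kN; case: hX => [[h1 h2] _ _ _].
by split; apply: (crd_fmeas hc); [exact: h1 (tin kN)|exact: h2 (tin kN)].
Qed.

(** The values of a piecewise constant control are square integrable, being
    proportional to its integrals over the steps. *)
Lemma control_sqint i k : (k < N)%N -> sqint P (cp i U (t k)).
Proof.
move=> kN; case: hU => hU2 pcU; have tau0 := tau_gt0 T0 N0.
have su := crd_L2L2 hc i hU2.
have [s1 _ _] := time_integralP (tgrid_leS T0 N0 k) su.
rewrite (_ : cp i U (t k) = fun w => tau^-1 *
  time_integral (t k) (t k.+1) (cutoff T (cp i U)) w); first exact: sqintZ.
apply/funext => w; rewrite /time_integral.
have I1 : integrable_on (t k) (t k.+1) (fun=> cp i U (t k) w).
  apply/integrableP; split; first exact: measurable_cst.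
  rewrite integral_cst/=; last exact: measurable_itv.
  rewrite lebesgue_measure_itv/=; case: ifP => _; last by rewrite mule0.
  by rewrite -EFinB -EFinM ltry.
have [|_ <-] := @eq_Rint_on_co R _ _ _ (fun s => cutoff T (cp i U) (w, s)) I1.
  move=> s /andP[ks sk]; rewrite cutoff_in.
    by rewrite /crd_process (pcU k kN s w)// ks sk.
  have /andP[k0 _] := tin (ltnW kN); have /andP[_ kT] := tin kN.
  by rewrite (le_trans k0 ks) (le_trans (ltW sk) kT).
rewrite Rintegral_cst/=; last exact: measurable_itv.
rewrite lebesgue_measure_itv/= lte_fin.
rewrite (_ : t k < t k.+1) ?tgridS ?ltrDl//=.
by rewrite addrAC subrr add0r mulrCA mulVf ?mulr1// gt_eqF.
Qed.

(** The scheme, in coordinates. *)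
Lemma scheme_coordinates k : (k < N)%N -> {ae P, forall w, forall i,
  cp i X1 (t k.+1) w - cp i X1 (t k) w =
    tau / 2 * (cp i X2 (t k.+1) w + cp i X2 (t k) w) /\
  cp i X2 (t k.+1) w - cp i X2 (t k) w =
    tau / 2 * - (\sum_j A i j * (cp j X1 (t k.+1) w + cp j X1 (t k) w))
    + tau * cp i U (t k) w
    + gamma * (increment W (t k) (t k.+1) w * cp i X1 (t k) w)}.
Proof.
move=> kN; case: hX => _ _ _ /(_ k kN); apply: filterS => w [E1 E2] i.
have k1 := tin kN; have k0 := tin (ltnW kN).
have a1 := KX1 w k1; have a0 := KX1 w k0; have b1 := KX2 w k1; have b0 := KX2 w k0.
have u0 := KU w k0.
split.
  rewrite /crd_process -(crd_sub hc i a1 a0) E1 (crd_scale hc); last exact: (crd_closedD hc).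
  by rewrite (crd_add hc i b1 b0).
have Ka := crd_closedD hc a1 a0; have [KD cD] := hDh Ka.
have K1 := crd_closedZ hc (tau / 2) KD; have K2 := crd_closedZ hc tau u0.
have K3 := crd_closedZ hc (gamma * increment W (t k) (t k.+1) w) a0.
rewrite /crd_process -(crd_sub hc i b1 b0) E2.
rewrite (crd_add hc i (crd_closedD hc K1 K2) K3) (crd_add hc i K1 K2).
rewrite !(crd_scale hc i)// cD mulrA; congr (_ * - _ + _ + _).
by apply: eq_bigr => j _; rewrite (crd_add hc j a1 a0).
Qed.

(** The discrete state is square integrable at each time of the grid. *)
Lemma state_sqint k : (k <= N)%N ->
  forall i, sqint P (cp i X1 (t k)) /\ sqint P (cp i X2 (t k)).
Proof.
have tau0 := tau_gt0 T0 N0.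
elim: k => [_ i|k IH kN i].
  have [f1 f2] := state_fmeas i (leq0n N).
  have t0T : t 0 <= T by have /andP[] := tin (leq0n N).
  case: hX => _ _ h0 _; rewrite tgrid0 in f1 f2 t0T *.
  split.
    apply: sqint_ae (sqint0 P); first exact: (Fmeas_measurable hP hW t0T f1).
    by apply: filterS h0 => w [E _]; rewrite /crd_process E (crd_zero hc).
  apply: sqint_ae (sqint0 P); first exact: (Fmeas_measurable hP hW t0T f2).
  by apply: filterS h0 => w [_ E]; rewrite /crd_process E (crd_zero hc).
have {}IH := IH (ltnW kN).
have kT : t k.+1 <= T by have /andP[] := tin kN.
have [B hB] := psd_shift_inverse (sqr_ge0 (tau / 2)) psdA.
(* X2 at the new time is eliminated: (1 + (tau / 2)^2 A) X1 equals rhs there *)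
pose rhs j w := cp j X1 (t k) w + tau / 2 * (2 * cp j X2 (t k) w
  + (tau / 2) * - (\sum_l A j l * cp l X1 (t k) w) + tau * cp j U (t k) w
  + gamma * (increment W (t k) (t k.+1) w * cp j X1 (t k) w)).
have srhs j : sqint P (rhs j).
  apply: sqintD; first exact: (IH j).1.
  apply: sqintZ; apply: sqintD; last first.
    apply: sqintZ; apply: (sqint_increment hP hW) => //.
    - exact: tgrid_ge0.
    - exact: tgrid_leS.
    - exact: (state_fmeas j (ltnW kN)).1.
    - exact: (IH j).1.
  apply: sqintD; last by apply: sqintZ; exact: control_sqint.
  apply: sqintD; first by apply: sqintZ; exact: (IH j).2.
  apply: sqintZ; apply: sqintN; apply: sqint_sum => l _; apply: sqintZ.
  exact: (IH l).1.
have m1 j : measurable_fun setT (cp j X1 (t k.+1)).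
  exact: (Fmeas_measurable hP hW kT (state_fmeas j kN).1).
have m2 j : measurable_fun setT (cp j X2 (t k.+1)).
  exact: (Fmeas_measurable hP hW kT (state_fmeas j kN).2).
have s1 j : sqint P (cp j X1 (t k.+1)).
  apply: (@sqint_ae _ _ _ _ (fun w => \sum_l B j l * rhs l w)) => //.
    apply: filterS (scheme_coordinates kN) => w E; apply/esym.
    apply: (hB (fun l => cp l X1 (t k.+1) w)) => l.
    have [E1 E2] := E l; rewrite /rhs; move: E1 E2.
    rewrite (eq_bigr (fun q => A l q * cp q X1 (t k.+1) w + A l q * cp q X1 (t k) w)); last first.
      by move=> q _; rewrite mulrDr.
    rewrite big_split/=; move: (\sum_q _) (\sum_q _) => SA' SA.
    move: (cp l X1 (t k.+1) w) (cp l X1 (t k) w) (cp l X2 (t k.+1) w) (cp l X2 (t k) w).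
    move: (cp l U (t k) w) (increment W (t k) (t k.+1) w) tau => u0 dw ta x1' x1 x2' x2 E1 E2.
    have -> : x1' = x1 + ta / 2 * (x2' + x2) by rewrite -E1 addrC subrK.
    have -> : x2' = x2 + (ta / 2 * - (SA + SA') + ta * u0 + gamma * (dw * x1)).
      by rewrite -E2 addrC subrK.
    by field.
  by apply: sqint_sum => l _; apply: sqintZ; exact: srhs.
split; first exact: s1.
apply: (@sqint_ae _ _ _ _ (fun w => 2 / tau * (cp i X1 (t k.+1) w - cp i X1 (t k) w)
    - cp i X2 (t k) w)) => //.
  apply: filterS (scheme_coordinates kN) => w /(_ i)[-> _].
  have : tau != 0 by rewrite gt_eqF.
  move: (cp i X2 (t k.+1) w) (cp i X2 (t k) w) tau => a b ta ta0.
  by field.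
apply: sqintB; last exact: (IH i).2.
by apply: sqintZ; apply: sqintB; [exact: s1|exact: (IH i).1].
Qed.

End discrete_state.

(** * The duality *)

Section duality.
Context {dO : measure_display} {Omega : measurableType dO} {R : realType}.
Variables (P : probability Omega R) (T beta gamma : R) (W : R -> Omega -> R).
Hypothesis hP : measure_is_complete P.
Hypothesis hW : wiener_process P T W.
Hypothesis T0 : 0 < T.
Context {d : nat} (K : fspace R d) (n : nat).
Variables (e : 'I_n -> 'rV[R]_d -> R) (c : 'I_n -> ('rV[R]_d -> R) -> R).
Hypothesis hc : coordinates K e c.
Notation leb1 := (@lebesgue_measure R).
Notation M := (P \x leb1)%E.
Notation F := (filtration P W).
Variables (A : 'M[R]_n) (Rh Dh : ('rV[R]_d -> R) -> 'rV[R]_d -> R).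
Variable Xt : R -> 'rV[R]_d -> R.
Variables X1s Y1 Y2 Z1 Z2 : R -> Omega -> 'rV[R]_d -> R.
Hypothesis hDh : forall v, K v -> K (Dh v) /\
  forall i, c i (Dh v) = - \sum_j A i j * c j v.
Hypothesis psdA : forall x : 'I_n -> R, 0 <= \sum_i \sum_j x i * A i j * x j.
Hypothesis hRh : forall t, 0 <= t <= T -> K (Rh (Xt t)).
Hypothesis hRc : forall i t, 0 <= t <= T -> forall eps : R, 0 < eps ->
  exists2 dl : R, 0 < dl & forall s, 0 <= s <= T -> `|s - t| < dl ->
    `|c i (Rh (Xt s)) - c i (Rh (Xt t))| < eps.
Variables B0 B1 : ('rV[R]_d -> R) -> ('rV[R]_d -> R) -> R.
Hypothesis hB0 : forall u v, K u -> K v -> B0 u v = \sum_i c i u * c i v.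
Hypothesis hB1 : forall u v, K u -> K v ->
  B1 u v = \sum_i (\sum_j A i j * c j u) * c i v.
Hypothesis hX1s : L2F_Ct P K F T X1s.
Hypothesis hY : is_adjoint P T beta gamma W K Rh Dh Xt X1s Y1 Y2 Z1 Z2.
Variables (N : nat) (U X1 X2 : R -> Omega -> 'rV[R]_d -> R).
Hypothesis N0 : (0 < N)%N.
Hypothesis hU : discrete_control P T W K N U.
Hypothesis hX : is_discrete_state0 P T gamma W K Dh N U X1 X2.
Local Notation t := (tgrid T N).
Local Notation tau := (T / N%:R).
Notation cp := (crd_process c).
Local Notation G := (deviation Rh Xt X1s).

Let hY1 : L2F_Ct P K F T Y1. Proof. by case: hY => [[]]. Qed.
Let hY2 : L2F_Ct P K F T Y2. Proof. by case: hY => [[]]. Qed.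
Let hZ1 : L2F_L2t P K F T Z1. Proof. by case: hY => _ []. Qed.
Let hZ2 : L2F_L2t P K F T Z2. Proof. by case: hY => _ []. Qed.
Let tin k : (k <= N)%N -> 0 <= t k <= T. Proof. exact: tgrid_in. Qed.
Let KX1 s w : 0 <= s <= T -> K (X1 s w). Proof. by case: hX => [[h _] _ _ _] /h[]. Qed.
Let KX2 s w : 0 <= s <= T -> K (X2 s w). Proof. by case: hX => [[_ h] _ _ _] /h[]. Qed.
Let KU s w : 0 <= s <= T -> K (U s w). Proof. by case: hU => [[h _ _] _] /h[]. Qed.
Let KX s w : 0 <= s <= T -> K (X1s s w). Proof. by case: hX1s => h _ _ /h[]. Qed.
Let KY1 s w : 0 <= s <= T -> K (Y1 s w). Proof. by case: hY1 => h _ _ /h[]. Qed.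
Let KY2 s w : 0 <= s <= T -> K (Y2 s w). Proof. by case: hY2 => h _ _ /h[]. Qed.
Let KG s w : 0 <= s <= T -> K (G s w).
Proof. by move=> sT; apply: (crd_closedB hc); [exact: KX|exact: hRh]. Qed.
Let TTT : 0 <= T <= T. Proof. by rewrite lexx ltW. Qed.

Notation x1 i k := (cp i X1 (t k)).
Notation x2 i k := (cp i X2 (t k)).
Notation y1 i k := (cp i Y1 (t k)).
Notation y2 i k := (cp i Y2 (t k)).
Notation int_y1 i k := (time_integral (t k) (t k.+1) (cutoff T (cp i Y1))).
Notation int_y2 i k := (time_integral (t k) (t k.+1) (cutoff T (cp i Y2))).
Notation int_g i k := (time_integral (t k) (t k.+1) (cutoff T (cp i G))).
Notation dW k := (increment W (t k) (t k.+1)).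

Let sx1 i k : (k <= N)%N -> sqint P (x1 i k).
Proof. by move=> kN; exact: (state_sqint hP hW T0 hc hDh psdA N0 hU hX kN i).1. Qed.
Let sx2 i k : (k <= N)%N -> sqint P (x2 i k).
Proof. by move=> kN; exact: (state_sqint hP hW T0 hc hDh psdA N0 hU hX kN i).2. Qed.
Let su i k : (k < N)%N -> sqint P (cp i U (t k)).
Proof. exact: (control_sqint T0 hc N0 hU). Qed.
Let sy1 i k : (k <= N)%N -> sqint P (y1 i k).
Proof. by move=> kN; apply: (crd_Ct hP hW T0 hc i hY1).2; exact: tin. Qed.
Let sy2 i k : (k <= N)%N -> sqint P (y2 i k).
Proof. by move=> kN; apply: (crd_Ct hP hW T0 hc i hY2).2; exact: tin. Qed.
Let siy1 i k : sqint P (int_y1 i k).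
Proof.
by have [] := time_integralP (tgrid_leS T0 N0 k) (crd_Ct hP hW T0 hc i hY1).1.
Qed.
Let siy2 i k : sqint P (int_y2 i k).
Proof.
by have [] := time_integralP (tgrid_leS T0 N0 k) (crd_Ct hP hW T0 hc i hY2).1.
Qed.
Let sG i := deviation_sqint hP hW T0 hc hRh hRc hX1s i.
Let sig i k : sqint P (int_g i k).
Proof. by have [] := time_integralP (tgrid_leS T0 N0 k) (sG i).1. Qed.
Let sdwx i k : (k < N)%N -> sqint P (fun w => dW k w * x1 i k w).
Proof.
move=> kN; apply: (sqint_increment hP hW).
- exact: tgrid_ge0.
- exact: tgrid_leS.
- by have /andP[] := tin kN.
- exact: (state_fmeas T0 hc N0 hX i (ltnW kN)).1.
- exact: sx1 (ltnW kN).
Qed.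

(** One time step of the duality, in one coordinate. *)
Lemma duality_step i k : (k < N)%N ->
  inner P (y1 i k.+1) (x1 i k.+1) - inner P (y1 i k) (x1 i k) +
  (inner P (y2 i k.+1) (x2 i k.+1) - inner P (y2 i k) (x2 i k)) =
  tau / 2 * inner P (fun w => x2 i k.+1 w + x2 i k w) (y1 i k.+1)
  - inner P (int_y1 i k) (x2 i k) +
  (inner P (fun w => \sum_j A i j * int_y2 j k w) (x1 i k) -
   tau / 2 * inner P (fun w => \sum_j A i j * (x1 j k.+1 w + x1 j k w)) (y2 i k.+1)) +
  tau * inner P (cp i U (t k)) (y2 i k.+1) -
  gamma * inner P (int_y1 i k) (fun w => dW k w * x1 i k w) -
  inner P (int_g i k) (x1 i k).
Proof.
move=> kN; have kN' := ltnW kN.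
have t0 := tgrid_ge0 T0 N0 k; have tt := tgrid_leS T0 N0 k.
have tT : t k.+1 <= T by have /andP[] := tin kN.
have [fx1 fx2] := state_fmeas T0 hc N0 hX i kN'.
have fy2 : Fmeas P W (t k) (y2 i k).
  by apply: (crd_fmeas hc); case: hY2 => h _ _; exact: h (tin kN').
case: hY => _ _ [J1 [J2 [hJ1 hJ2 hYZ]]].
have KJ1 s w : 0 <= s <= T -> K (J1 s w) by case: hJ1 => h _ /h[].
have KJ2 s w : 0 <= s <= T -> K (J2 s w) by case: hJ2 => h _ /h[].
have [sJ1 /(_ _ _ _ t0 tt tT) oJ1] := crd_ito hP hW hc hZ1 hJ1 i.
have [sJ2 /(_ _ _ _ t0 tt tT) oJ2] := crd_ito hP hW hc hZ2 hJ2 i.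
have [inc1 inc2] := adjoint_increment hP hW T0 hc hDh hRh hRc hX1s hY1 hY2 hZ2
  hYZ KJ1 KJ2 i t0 tt tT.
have siz : sqint P (time_integral (t k) (t k.+1) (cutoff T (cp i Z2))).
  by have [] := time_integralP tt (crd_L2L2 hc i hZ2).
apply: (@one_step_identity _ _ _ P tau gamma (x1 i k) (x1 i k.+1) (x2 i k) (x2 i k.+1)
  (cp i U (t k)) (fun w => \sum_j A i j * (x1 j k.+1 w + x1 j k w))
  (y1 i k) (y1 i k.+1) (y2 i k) (y2 i k.+1)
  (fun w => \sum_j A i j * int_y2 j k w)
  (time_integral (t k) (t k.+1) (cutoff T (cp i Z2))) (int_g i k) (int_y1 i k)
  (fun w => cp i J1 (t k.+1) w - cp i J1 (t k) w)
  (fun w => cp i J2 (t k.+1) w - cp i J2 (t k) w)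
  (fun w => dW k w * x1 i k w)).
- exact: sx1.
- exact: sx1.
- exact: sx2.
- exact: sx2.
- exact: su.
- by apply: sqint_sum => j _; apply: sqintZ; apply: sqintD; exact: sx1.
- exact: sy1.
- exact: sy1.
- exact: sy2.
- exact: sy2.
- by apply: sqint_sum => j _; apply: sqintZ; exact: siy2.
- exact: siz.
- exact: sig.
- exact: siy1.
- exact: (sqintB (sJ1 _ (tin kN)) (sJ1 _ (tin kN'))).
- exact: (sqintB (sJ2 _ (tin kN)) (sJ2 _ (tin kN'))).
- exact: sdwx.
- by apply: filterS (scheme_coordinates T0 hc hDh N0 hU hX kN) => w /(_ i)[].
- by apply: filterS (scheme_coordinates T0 hc hDh N0 hU hX kN) => w /(_ i)[].
- exact: inc1.
- exact: inc2.
- exact: (oJ1 _ fx1 (sx1 i kN')).1.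
- exact: (oJ2 _ fx2 (sx2 i kN')).1.
- have fyx : Fmeas P W (t k) (fun w => y2 i k w * x1 i k w) by exact: measurable_funM.
  rewrite -[RHS](expectation_increment hP hW t0 tt tT fyx
    (sqint_mul (sy2 i kN') (sx1 i kN'))).2.
  by apply: eq_Rintegral => w _; rewrite mulrCA.
- exact: (oJ2 _ fx1 (sx1 i kN')).2.
Qed.

(** Summation over the steps: the discrete state starts from 0, and the terminal
    value of Y1 is beta times the deviation, that of Y2 is 0. *)
Lemma duality_telescope i :
  beta * inner P (cp i G T) (x1 i N) + \sum_(k < N) inner P (int_g i k) (x1 i k) =
  \sum_(k < N)
  (tau / 2 * inner P (fun w => x2 i k.+1 w + x2 i k w) (y1 i k.+1)
  - inner P (int_y1 i k) (x2 i k) +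
  (inner P (fun w => \sum_j A i j * int_y2 j k w) (x1 i k) -
   tau / 2 * inner P (fun w => \sum_j A i j * (x1 j k.+1 w + x1 j k w)) (y2 i k.+1)) +
  tau * inner P (cp i U (t k)) (y2 i k.+1) -
  gamma * inner P (int_y1 i k) (fun w => dW k w * x1 i k w)).
Proof.
pose E k := inner P (y1 i k) (x1 i k) + inner P (y2 i k) (x2 i k).
have EN : E N = beta * inner P (cp i G T) (x1 i N).
  case: hY => _ _ [J1 [J2 [hJ1 hJ2 hYZ]]].
  have [a1 a2] := adjoint_terminal T0 hc hRh hX1s hYZ i.
  have s1 := sy1 i (leqnn N); have s2 := sy2 i (leqnn N).
  have sx := sx1 i (leqnn N); have sx' := sx2 i (leqnn N).
  have sg := (sG i).2 T TTT.
  rewrite /E -(innerZl _ sg sx).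
  rewrite (_ : inner P (y2 i N) _ = 0) ?addr0; last first.
    rewrite -[RHS](Rint_zero P); apply: Rint_ae.
    - by apply: measurable_funM; [exact: s2.1|exact: sx'.1].
    - exact: measurable_cst.
    - by apply: filterS a2 => w E2; rewrite (tgridN T N0) E2 mul0r.
  apply: inner_ae.
  - exact: s1.1.
  - exact: (sqintZ beta sg).1.
  - exact: sx.1.
  - exact: sx.1.
  - by apply: filterS a1 => w E1; rewrite (tgridN T N0) E1.
  - exact: aeW.
have E0 : E 0%N = 0.
  case: hX => _ _ h0 _.
  have s1 := sy1 i (leq0n N); have s2 := sy2 i (leq0n N).
  have sx := sx1 i (leq0n N); have sx' := sx2 i (leq0n N).
  rewrite /E -[RHS]addr0; congr (_ + _); rewrite -[RHS](Rint_zero P); apply: Rint_ae.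
  - by apply: measurable_funM; [exact: s1.1|exact: sx.1].
  - exact: measurable_cst.
  - by apply: filterS h0 => w [E1 _]; rewrite /crd_process tgrid0 E1 (crd_zero hc) mulr0.
  - by apply: measurable_funM; [exact: s2.1|exact: sx'.1].
  - exact: measurable_cst.
  - by apply: filterS h0 => w [_ E1]; rewrite /crd_process tgrid0 E1 (crd_zero hc) mulr0.
have tel : \sum_(k < N) (E k.+1 - E k) = E N.
  by rewrite -(big_mkord xpredT (fun k => E k.+1 - E k)) telescope_sumr// E0 subr0.
rewrite -EN -tel -big_split/=; apply: eq_bigr => k _.
have := duality_step i (ltn_ord k).
rewrite /E opprD addrACA => ->.
by rewrite subrK.
Qed.

Let ExE (f : Omega -> R) (g h : 'I_n -> Omega -> R) :
  (forall i, sqint P (g i)) -> (forall i, sqint P (h i)) ->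
  {ae P, forall w, f w = \sum_i g i w * h i w} ->
  Ex P f = \sum_i inner P (g i) (h i).
Proof.
move=> sg sh fE; have Igh i := sqint_mul (sg i) (sh i).
rewrite /Ex (Rint_ae_complete hP _ fE).
  by rewrite Rint_sum.
exact: rint_meas (rint_sum _ (fun i _ => Igh i)).
Qed.

Let ae_int (f : 'I_n -> Omega * measurableTypeR R -> R) : (forall i, sqint M (f i)) ->
  {ae P, forall w, forall i, integrable_on 0 T (fun r => f i (w, r))}.
Proof.
by move=> sf; apply: filter_forall => i; have [_ + _] := time_integralP (ltW T0) (sf i).
Qed.

(** Integrals over a time step of linear combinations of coordinates. *)
Let step_integral (f : 'I_n -> R -> R) (x : 'I_n -> R) k : (k < N)%N ->
  (forall i, integrable_on 0 T (f i)) ->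
  integrable_on (t k) (t k.+1) (fun r => \sum_i x i * f i r) /\
  \int[leb1]_(r in `[t k, t k.+1]) (\sum_i x i * f i r) =
  \sum_i x i * \int[leb1]_(r in `[t k, t k.+1]) f i r.
Proof.
move=> kN If; have /andP[k0 _] := tin (ltnW kN); have /andP[_ kT] := tin kN.
have I1 i := integrable_onS k0 kT (If i).
have [I2 ->] := Rint_sum_on (index_enum _) (measurable_itv `[t k, t k.+1])
  (fun i => integrable_onZ (x i) (I1 i)).
by split=> //; apply: eq_bigr => i _; exact: Rint_onZ.
Qed.

Let tcc k r : (k < N)%N -> t k <= r <= t k.+1 -> 0 <= r <= T.
Proof.
move=> kN /andP[kr rk]; have /andP[k0 _] := tin (ltnW kN); have /andP[_ kT] := tin kN.
by rewrite (le_trans k0 kr) (le_trans rk kT).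
Qed.

(** The duality for bilinear forms [B0] and [B1] given in coordinates by the
    identity matrix and by [A]. *)
Lemma discrete_duality :
  Ex P (fun w =>
    \int[lebesgue_measure]_(s in `[0, T]) B0 (X1s s w - Rh (Xt s)) (X1 s w)
    + beta * B0 (X1s T w - Rh (Xt T)) (X1 T w))
  = (tau / 2 * \sum_(k < N) Ex P (fun w => B0 (X2 (t k.+1) w + X2 (t k) w) (Y1 (t k.+1) w))
     - \sum_(k < N) Ex P (fun w => \int[lebesgue_measure]_(s in `[t k, t k.+1])
         B0 (Y1 s w) (X2 (t k) w)))
  + (\sum_(k < N) Ex P (fun w => \int[lebesgue_measure]_(s in `[t k, t k.+1])
         B1 (Y2 s w) (X1 (t k) w))
     - tau / 2 * \sum_(k < N) Ex P (fun w =>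
         B1 (X1 (t k.+1) w + X1 (t k) w) (Y2 (t k.+1) w)))
  + tau * \sum_(k < N) Ex P (fun w => B0 (U (t k) w) (Y2 (t k.+1) w))
  + - \sum_(k < N) Ex P (fun w => B0 (tint (t k) (t k.+1) (Y1 ^~ w))
         ((gamma * dW k w) *: X1 (t k) w)).
Proof.
have aeY1 := ae_int (fun i => (crd_Ct hP hW T0 hc i hY1).1).
have aeY2 := ae_int (fun i => (crd_Ct hP hW T0 hc i hY2).1).
have aeG := ae_int (fun i => (sG i).1).
have H1 k : (k < N)%N ->
    Ex P (fun w => B0 (X2 (t k.+1) w + X2 (t k) w) (Y1 (t k.+1) w)) =
    \sum_i inner P (fun w => x2 i k.+1 w + x2 i k w) (y1 i k.+1).
  move=> kN; have k1 := tin kN; have k0 := tin (ltnW kN); apply: ExE.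
  - by move=> i; apply: sqintD; apply: sx2 => //; exact: ltnW.
  - by move=> i; exact: sy1.
  - apply: aeW => w; rewrite hB0; [|by apply: (crd_closedD hc); exact: KX2|exact: KY1].
    by apply: eq_bigr => i _; rewrite (crd_add hc)//; exact: KX2.
have H2 k : (k < N)%N ->
    Ex P (fun w => \int[lebesgue_measure]_(s in `[t k, t k.+1])
      B0 (Y1 s w) (X2 (t k) w)) = \sum_i inner P (int_y1 i k) (x2 i k).
  move=> kN; have k1 := tin kN; have k0 := tin (ltnW kN); apply: ExE.
  - by move=> i; exact: siy1.
  - by move=> i; apply: sx2; exact: ltnW.
  - apply: filterS aeY1 => w I1.
    have [_ E] := step_integral (fun i => x2 i k w) kN I1.
    transitivity (\sum_i x2 i k w * int_y1 i k w); last first.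
      by apply: eq_bigr => i _; rewrite mulrC.
    rewrite -[RHS]E; apply: eq_Rint_on => s sk; have sT := tcc kN sk.
    rewrite hB0; [|exact: KY1|exact: KX2].
    by apply: eq_bigr => i _; rewrite cutoff_in// mulrC.
have H3 k : (k < N)%N ->
    Ex P (fun w => \int[lebesgue_measure]_(s in `[t k, t k.+1])
      B1 (Y2 s w) (X1 (t k) w)) =
    \sum_i inner P (fun w => \sum_j A i j * int_y2 j k w) (x1 i k).
  move=> kN; have k1 := tin kN; have k0 := tin (ltnW kN); apply: ExE.
  - by move=> i; apply: sqint_sum => j _; apply: sqintZ; exact: siy2.
  - by move=> i; apply: sx1; exact: ltnW.
  - apply: filterS aeY2 => w I1.
    have [_ E] := step_integral (fun j => \sum_i A i j * x1 i k w) kN I1.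
    transitivity (\sum_j (\sum_i A i j * x1 i k w) * int_y2 j k w); last first.
      under eq_bigr do rewrite mulr_suml.
      rewrite exchange_big; apply: eq_bigr => i _; rewrite mulr_suml.
      by apply: eq_bigr => j _; rewrite mulrAC.
    rewrite -[RHS]E; apply: eq_Rint_on => s sk; have sT := tcc kN sk.
    rewrite hB1; [|exact: KY2|exact: KX1].
    under [RHS]eq_bigr do rewrite mulr_suml.
    rewrite exchange_big; apply: eq_bigr => i _; rewrite mulr_suml.
    by apply: eq_bigr => j _; rewrite cutoff_in// mulrAC.
have H4 k : (k < N)%N ->
    Ex P (fun w => B1 (X1 (t k.+1) w + X1 (t k) w) (Y2 (t k.+1) w)) =
    \sum_i inner P (fun w => \sum_j A i j * (x1 j k.+1 w + x1 j k w)) (y2 i k.+1).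
  move=> kN; have k1 := tin kN; have k0 := tin (ltnW kN); apply: ExE.
  - move=> i; apply: sqint_sum => j _; apply: sqintZ; apply: sqintD; apply: sx1 => //.
    exact: ltnW.
  - by move=> i; exact: sy2.
  - apply: aeW => w; rewrite hB1; [|by apply: (crd_closedD hc); exact: KX1|exact: KY2].
    apply: eq_bigr => i _; congr (_ * _); apply: eq_bigr => j _.
    by rewrite (crd_add hc)//; exact: KX1.
have H5 k : (k < N)%N ->
    Ex P (fun w => B0 (U (t k) w) (Y2 (t k.+1) w)) =
    \sum_i inner P (cp i U (t k)) (y2 i k.+1).
  move=> kN; have k1 := tin kN; have k0 := tin (ltnW kN); apply: ExE.
  - by move=> i; exact: su.
  - by move=> i; exact: sy2.
  - by apply: aeW => w; rewrite hB0; [|exact: KU|exact: KY2].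
have H6 k : (k < N)%N ->
    Ex P (fun w => B0 (tint (t k) (t k.+1) (Y1 ^~ w)) ((gamma * dW k w) *: X1 (t k) w)) =
    \sum_i gamma * inner P (int_y1 i k) (fun w => dW k w * x1 i k w).
  move=> kN; have k1 := tin kN; have k0 := tin (ltnW kN).
  transitivity (\sum_i inner P (fun w => gamma * int_y1 i k w) (fun w => dW k w * x1 i k w)).
    apply: ExE.
    - by move=> i; apply: sqintZ; exact: siy1.
    - by move=> i; exact: sdwx.
    - apply: filterS aeY1 => w I1.
      have [||K1 c1] := @crd_tint _ _ _ _ _ _ hc (t k) (t k.+1) (Y1 ^~ w).
      + by move=> s sk; apply: KY1; exact: tcc sk.
      + move=> i; have /andP[a0 _] := k0; have /andP[_ bT] := k1.
        apply: (@eq_integrable_on _ _ _ (fun r => cutoff T (cp i Y1) (w, r))).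
          by move=> s sk; rewrite cutoff_in//; exact: tcc sk.
        exact: integrable_onS a0 bT (I1 i).
      + have E i : c i (tint (t k) (t k.+1) (Y1 ^~ w)) = int_y1 i k w.
          rewrite c1; apply: eq_Rint_on => s sk; rewrite cutoff_in//.
          exact: tcc sk.
        rewrite hB0//; last by apply: (crd_closedZ hc); exact: KX1.
        apply: eq_bigr => i _; rewrite E (crd_scale hc); last exact: KX1.
        by rewrite /crd_process -[X in _ * X = _]mulrA mulrCA mulrA.
  by apply: eq_bigr => i _; rewrite (innerZl _ (siy1 i k) (sdwx i kN)).
have Slhs i : sqint P (x1 i N) by exact: sx1.
have HL : Ex P (fun w =>
    \int[lebesgue_measure]_(s in `[0, T]) B0 (X1s s w - Rh (Xt s)) (X1 s w)
    + beta * B0 (X1s T w - Rh (Xt T)) (X1 T w)) =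
    \sum_i (beta * inner P (cp i G T) (x1 i N) +
      \sum_(k < N) inner P (int_g i k) (x1 i k)).
  rewrite big_split/= [X in _ = _ + X]exchange_big/= addrC.
  have Ig (k : 'I_N) i : rint P (fun w => int_g i k w * x1 i k w).
    by apply: sqint_mul; [exact: sig|apply: sx1; exact: ltnW].
  have Igs (k : 'I_N) := rint_sum (index_enum _) (fun i (_ : true) => Ig k i).
  have Igss := rint_sum (index_enum _) (fun k (_ : true) => Igs k).
  have sgT i := (sG i).2 T TTT.
  have IT i : rint P (fun w => beta * (cp i G T w * x1 i N w)).
    by apply: rintZ; apply: sqint_mul; [exact: sgT|exact: Slhs].
  have ITs := rint_sum (index_enum _) (fun i (_ : true) => IT i).
  transitivity (\int[P]_w (\sum_(k < N) \sum_i int_g i k w * x1 i k w +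
      \sum_i beta * (cp i G T w * x1 i N w))).
    apply: (Rint_ae_complete hP); first exact: rint_meas (rintD Igss ITs).
    apply: filterS aeG => w I1; congr (_ + _).
      have piece k : (k < N)%N ->
          integrable_on (t k) (t k.+1) (fun s => B0 (X1s s w - Rh (Xt s)) (X1 s w)) /\
          \int[leb1]_(s in `[t k, t k.+1]) B0 (X1s s w - Rh (Xt s)) (X1 s w) =
          \sum_i int_g i k w * x1 i k w.
        move=> kN; have [I2 E2] := step_integral (fun i => x1 i k w) kN I1.
        have [|I3 E3] := @eq_Rint_on_co R _ _ _
            (fun s => B0 (X1s s w - Rh (Xt s)) (X1 s w)) I2.
          move=> s /andP[ks sk]; have sT : 0 <= s <= T.
            by apply: (tcc kN); rewrite ks ltW.
          rewrite hB0; [|exact: KG|exact: KX1].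
          apply: eq_bigr => i _; rewrite cutoff_in// mulrC.
          case: hX => _ [pc _] _ _; congr (_ * _).
          by rewrite /crd_process (pc k kN s w)// ks sk.
        split=> //; rewrite -E3 E2.
        by apply: eq_bigr => i _; rewrite mulrC.
      rewrite (Rint_grid T0 N0); last by move=> k kN; exact: (piece k kN).1.
      by apply: eq_bigr => k _; exact: (piece k (ltn_ord k)).2.
    rewrite hB0; [|exact: (KG w TTT)|exact: KX1].
    by rewrite mulr_sumr; apply: eq_bigr => i _; rewrite (tgridN T N0).
  rewrite RintD// Rint_sum//; congr (_ + _).
    by apply: eq_bigr => k _; rewrite Rint_sum.
  rewrite Rint_sum//; apply: eq_bigr => i _; rewrite RintZ//.
  by apply: sqint_mul; [exact: sgT|exact: Slhs].
rewrite HL; under eq_bigr do rewrite duality_telescope.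
rewrite exchange_big/= !mulr_sumr -!sumrN -!big_split/=; apply: eq_bigr => k _.
rewrite (H1 k (ltn_ord k)) (H2 k (ltn_ord k)) (H3 k (ltn_ord k)).
rewrite (H4 k (ltn_ord k)) (H5 k (ltn_ord k)) (H6 k (ltn_ord k)).
by rewrite !mulr_sumr -sumrN -!sumrN -!big_split/=.
Qed.

End duality.

Theorem proposition4p4
  (R : realType)
  (d : nat) (hd : (1 <= d <= 3)%N)
  (D : set 'rV[R]_d) (hD : bounded_domain D)
  (r : nat) (hr : (1 <= r)%N) (hbD : Ck_boundary r D)
  (T alpha beta gamma : R) (hT : 0 < T) (halpha : 0 < alpha) (hbeta : 0 <= beta)
  (* filtered probability space *)
  (dO : measure_display) (Omega : measurableType dO) (P : probability Omega R)
  (hP : measure_is_complete P)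
  (W : R -> Omega -> R) (hW : wiener_process P T W)
  (* space discretization *)
  (kappa h : R) (m : nat) (p : 'I_m -> 'I_d.+1 -> 'rV[R]_d)
  (hp : regular_triangulation D kappa h p)
  (Rh Dh : ('rV[R]_d -> R) -> 'rV[R]_d -> R)
  (hRh : is_ritz_projection D (Vh D p) Rh)
  (hDh : is_discrete_laplacian D (Vh D p) Dh)
  (* data *)
  (X10 X20 : 'rV[R]_d -> R) (hX10 : H10 D X10) (hX20 : H10 D X20)
  (Xt : R -> 'rV[R]_d -> R) (hXt : CtK (H10_space D) T Xt)
  (sigma : R -> Omega -> 'rV[R]_d -> R)
  (hsigma : L2F_Ct P (H10_space D) (filtration P W) T sigma)
  (* optimal tuple of SLQ_h and solution of the backward equation *)
  (Us X1s X2s : R -> Omega -> 'rV[R]_d -> R)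
  (hopt : is_optimal P T alpha beta gamma W (Vh_space D p) Rh Dh
            X10 X20 Xt sigma Us X1s X2s)
  (Y1 Y2 Z1 Z2 : R -> Omega -> 'rV[R]_d -> R)
  (hY : is_adjoint P T beta gamma W (Vh_space D p) Rh Dh Xt X1s Y1 Y2 Z1 Z2)
  (* time discretization *)
  (N : nat) (hN : (0 < N)%N) (htau : T / N%:R < 1)
  (U : R -> Omega -> 'rV[R]_d -> R)
  (hU : discrete_control P T W (Vh_space D p) N U)
  (X1 X2 : R -> Omega -> 'rV[R]_d -> R)
  (hX : is_discrete_state0 P T gamma W (Vh_space D p) Dh N U X1 X2) :
  let tau := T / N%:R in
  let t := tgrid T N in
  let I1 :=
    tau / 2 * \sum_(n < N)
      Ex P (fun w => ip D (X2 (t n.+1) w + X2 (t n) w) (Y1 (t n.+1) w))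
    - \sum_(n < N)
      Ex P (fun w => \int[lebesgue_measure]_(s in `[t n, t n.+1])
                       ip D (Y1 s w) (X2 (t n) w)) in
  let I2 :=
    \sum_(n < N)
      Ex P (fun w => \int[lebesgue_measure]_(s in `[t n, t n.+1])
                       ip_grad D (Y2 s w) (X1 (t n) w))
    - tau / 2 * \sum_(n < N)
      Ex P (fun w => ip_grad D (X1 (t n.+1) w + X1 (t n) w) (Y2 (t n.+1) w)) in
  let I3 :=
    tau * \sum_(n < N) Ex P (fun w => ip D (U (t n) w) (Y2 (t n.+1) w)) in
  let I4 :=
    - \sum_(n < N)
      Ex P (fun w => ip D (tint (t n) (t n.+1) (Y1 ^~ w))
                       ((gamma * increment W (t n) (t n.+1) w) *: X1 (t n) w)) in
  Ex P (fun w =>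
    \int[lebesgue_measure]_(s in `[0, T])
       ip D (X1s s w - Rh (Xt s)) (X1 s w)
    + beta * ip D (X1s T w - Rh (Xt T)) (X1 T w))
  = I1 + I2 + I3 + I4.
Proof.
move=> tau t I1 I2 I3 I4; rewrite /I1 /I2 /I3 /I4 /tau /t => {I1 I2 I3 I4 tau t}.
have [openD _ _ bndD] := hD.
have coveredD : covered p `<=` closure D by case: hp => _ _ _ _ [].
have d0 : (0 < d)%N by case/andP : hd.
pose i0 : 'I_d := Ordinal d0.
have V0 : Vh D p 0.
  rewrite -(scale0r (Rh X10)); apply: (VhZ openD bndD).
  by have [] := hRh X10 hX10.
have [n [e [oe basis]]] := Vh_orthonormal_basis openD bndD coveredD V0.
have Ve := oe.1.
have hc : coordinates (Vh_space D p) e (basis_coord D e).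
  split.
  - exact: V0.
  - exact: Ve.
  - by move=> u v; exact: (VhD openD bndD).
  - by move=> a u; exact: (VhZ openD bndD).
  - by move=> i u v; exact: (coordD oe).
  - by move=> i a u; exact: (coordZ oe).
  - exact: basis.
  - by move=> a i; exact: (coord_lin openD bndD V0 oe).
  - by move=> i v; exact: (coord_le oe).
have KRt s : 0 <= s <= T -> Vh D p (Rh (Xt s)).
  by move=> sT; have [] := hRh (Xt s) (hXt.1 s sT).
have [_ [hX1s _ _] _] := hopt.
apply: (discrete_duality hP hW hT hc (A := stiff D e) _ _ _ _ _ _ hX1s hY hN hU hX).
- move=> v Vv; have [VD _] := hDh v Vv; split=> // i.
  exact: (coord_laplacian openD bndD V0 oe basis).
- by move=> x; exact: (stiff_psd openD bndD V0 oe basis).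
- exact: KRt.
- have [C C0 hC] := ritz_lipschitz openD bndD oe i0 hRh.
  move=> i s sT eps e0.
  have C1 : 0 < C + 1 by rewrite ltr_wpDl.
  have [dl dl0 hdl] := hXt.2 s sT (eps / (C + 1)) (divr_gt0 e0 C1).
  exists dl => // r1 rT rs; have close := hdl r1 rT rs.
  apply: le_lt_trans (hC _ _ i (hXt.1 r1 rT) (hXt.1 s sT)) _.
  have h' : H1norm D (Xt r1 - Xt s) * (C + 1) < eps by rewrite -ltr_pdivlMr.
  apply: le_lt_trans h'; rewrite mulrC ler_wpM2l ?sqrtr_ge0// lerDl//.
- by move=> u v Vu Vv; exact: (ip_coord openD bndD V0 oe basis).
- move=> u v Vu Vv; rewrite (ip_grad_coord openD bndD V0 oe basis Vu Vv).
  rewrite exchange_big; apply: eq_bigr => j _; rewrite mulr_suml.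
  by apply: eq_bigr => i _; rewrite (stiff_sym D e j i) [X in X * _]mulrC.
Qed.
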